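(* Let $E$ be a finite directed graph and suppose that $E$ is strongly connected. Let $\gamma:\mathbb{T}\to\operatorname{Aut}\mathcal{T}C^*(E)$ be the gauge action and define $\alpha:\mathbb{R}\to\operatorname{Aut}\mathcal{T}C^*(E)$ by $\alpha_t=\gamma_{e^{it}}$. Let $A$ be the vertex matrix of $E$, $A(v,w)=|vE^1w|$, and let $x$ be the unimodular Perron-Frobenius eigenvector of $A$. (a) The system $(\mathcal{T}C^*(E),\alpha)$ has a unique KMS$_{\ln\rho(A)}$ state $\phi$. This state satisfies $$\phi(s_\mu s_\nu^* )=\delta_{\mu,\nu}\rho(A)^{-|\mu|}x_{s(\mu)}\quad\text{for all }\mu,\nu\in E^*,$$ and factors through a KMS$_{\ln\rho(A)}$ state $\bar\phi$ of $(C^*(E),\alpha)$. (b) The state $\bar\phi$ is the only KMS state of $(C^*(E),\alpha)$ (that is, the only state which is a KMS$_\beta$ state for some $\beta\in\mathbb{R}$). (c) If $\beta<\ln\rho(A)$, then $(\mathcal{T}C^*(E),\alpha)$ has no KMS$_\beta$ states.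
   Context: Graphs. A directed graph $E=(E^0,E^1,r,s)$ has a (nonempty) vertex set $E^0$, edge set $E^1$, and range and source maps $r,s:E^1\to E^0$; it is finite if $E^0$ and $E^1$ are finite. A path of length $n\ge 1$ is $\mu=\mu_1\cdots\mu_n$ with $\mu_i\in E^1$ and $s(\mu_i)=r(\mu_{i+1})$; $r(\mu)=r(\mu_1)$, $s(\mu)=s(\mu_n)$, $|\mu|=n$. Vertices are paths of length $0$ with $r(v)=s(v)=v$. $E^*$ is the set of all finite paths; $vE^1w=\{e\in E^1:r(e)=v,\ s(e)=w\}$, $vE^1=\{e\in E^1:r(e)=v\}$. A source is a vertex $v$ with $vE^1=\emptyset$. $E$ is strongly connected if for every $v,w\in E^0$ there is a path $\mu$ of length at least $1$ with $r(\mu)=v$ and $s(\mu)=w$; equivalently, the vertex matrix $A$ is irreducible: for all $v,w$ there is $n\ge1$ with $A^n(v,w)>0$. $\rho(A)$ is the spectral radius of $A$. For irreducible $A$, the unimodular Perron-Frobenius eigenvector is the unique vector $x\in(0,\infty)^{E^0}$ with $Ax=\rho(A)x$ and $\sum_{v}x_v=1$. Algebras. A Toeplitz-Cuntz-Krieger $E$-family consists of mutually orthogonal projections $\{P_v:v\in E^0\}$ and partial isometries $\{S_e:e\in E^1\}$ with $S_e^*S_e=P_{s(e)}$ and $P_v\ge\sum_{e\in F}S_eS_e^*$ for every $v\in E^0$ and every finite $F\subset vE^1$. $\mathcal{T}C^*(E)$ is the $C^*$-algebra generated by a universal such family $(p,s)$. For $\mu=\mu_1\cdots\mu_n$, $s_\mu=s_{\mu_1}\cdots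 s_{\mu_n}$, and $s_v=p_v$ for $v\in E^0$; $\mathcal{T}C^*(E)$ is the closed span of the elements $s_\mu s_\nu^*$. $C^*(E)$ is the quotient of $\mathcal{T}C^*(E)$ by the ideal $J$ generated by $\{p_v-\sum_{f\in vE^1}s_fs_f^*:v\in E^0,\ vE^1\ne\emptyset\}$, with quotient map $q$. A state $\phi$ of $\mathcal{T}C^*(E)$ factors through a state $\bar\phi$ of $C^*(E)$ if $\phi=\bar\phi\circ q$. The gauge action satisfies $\gamma_z(s_\mu s_\nu^* )=z^{|\mu|-|\nu|}s_\mu s_\nu^*$ $(z\in\mathbb{T})$; the dynamics induced by $\alpha$ on $C^*(E)$ is also denoted $\alpha$. $\alpha_z(s_\mu s_\nu^* )=e^{iz(|\mu|-|\nu|)}s_\mu s_\nu^*$ is defined for all $z\in\mathbb{C}$. KMS states. For $\beta\in\mathbb{R}\setminus\{0\}$, a state $\phi$ is a KMS$_\beta$ state if $\phi(ab)=\phi(b\,\alpha_{i\beta}(a))$ for all $\alpha$-analytic $a,b$ (equivalently for all $a,b\in\{s_\mu s_\nu^*\}$). KMS$_0$ states are the $\alpha$-invariant tracial states. *)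

(* Defs.v *)
From HB Require Import structures.
From mathcomp Require Import all_boot all_order all_algebra.
From mathcomp Require Import complex.
From mathcomp Require Import all_classical all_reals all_analysis.
Set Implicit Arguments.
Unset Strict Implicit.
Unset Printing Implicit Defensive.
Import Order.TTheory GRing.Theory Num.Theory.
Import numFieldNormedType.Exports.
Local Open Scope classical_set_scope.
Local Open Scope ring_scope.
Local Open Scope complex_scope.

Record digraph := Digraph {
  vtx : finType;
  edge : finType;
  rng : edge -> vtx;
  src : edge -> vtx;
  digraph_nonempty : (0 < #|vtx|)%N }.

(* A path mu_1 ... mu_n (with s(mu_i) = r(mu_{i+1})) is encoded as the pair of
   its range r(mu) and the sequence of its edges; the vertex v, as a path of
   length 0, is (v, [::]).  When n >= 1 the first component is forced to be
   r(mu_1), so equality of encodings is equality of paths. *)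
Fixpoint path_from (E : digraph) (v : vtx E) (m : seq (edge E)) : bool :=
  if m is e :: m' then (rng e == v) && path_from (src e) m' else true.

Record gpath (E : digraph) := GPath {
  gpath_val : vtx E * seq (edge E);
  gpathP : path_from gpath_val.1 gpath_val.2 }.

HB.instance Definition _ (E : digraph) := [isSub for @gpath_val E].
HB.instance Definition _ (E : digraph) := [Choice of gpath E by <:].

Definition pedges (E : digraph) (mu : gpath E) : seq (edge E) :=
  (gpath_val mu).2.
Definition plen (E : digraph) (mu : gpath E) : nat := size (pedges mu).
Definition prng (E : digraph) (mu : gpath E) : vtx E := (gpath_val mu).1.
Definition psrc (E : digraph) (mu : gpath E) : vtx E :=
  last (prng mu) (map (@src E) (pedges mu)).

Definition strongly_connected (E : digraph) : Prop :=
  forall v w : vtx E, exists mu : gpath E,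
    [/\ (1 <= plen mu)%N, prng mu = v & psrc mu = w].

Definition adj (E : digraph) (v w : vtx E) : nat :=
  #|[set e : edge E | (rng e == v) && (src e == w)]%SET|.

Definition vertex_matrix (R : realType) (E : digraph) : 'M[R[i]]_#|vtx E| :=
  \matrix_(i, j) (adj (enum_val i) (enum_val j))%:R.

Definition spectral_radius (R : realType) (n : nat) (M : 'M[R[i]]_n) : R :=
  sup [set Normc.normc l | l in [set l : R[i] | eigenvalue M l]].

Definition rhoA (R : realType) (E : digraph) : R :=
  spectral_radius (vertex_matrix R E).

Definition unimodular_PF (R : realType) (E : digraph) (x : vtx E -> R) : Prop :=
  [/\ forall v, 0 < x v,
      forall v, \sum_(w : vtx E) (adj v w)%:R * x w = rhoA R E * x v
    & \sum_(v : vtx E) x v = 1].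

(* The norm takes its (real) values in the base field R[i].  The product is a
   new operation, since MathComp has no structure for possibly non-unital rings
   and no join of its rings with its normed modules. *)
HB.mixin Record isCStar (R : realType) A of CompleteNormedModule R[i] A := {
  cmul : A -> A -> A;
  star : A -> A;
  cmulA : associative cmul;
  cmulDl : left_distributive cmul +%R;
  cmulDr : right_distributive cmul +%R;
  cmulZl : forall (k : R[i]) (a b : A), cmul (k *: a) b = k *: cmul a b;
  cmulZr : forall (k : R[i]) (a b : A), cmul a (k *: b) = k *: cmul a b;
  starK : involutive star;
  starD : {morph star : a b / a + b};
  starZ : forall (k : R[i]) (a : A), star (k *: a) = k^* *: star a;
  starM : forall a b : A, star (cmul a b) = cmul (star b) (star a);
  cnormM : forall a b : A, `|cmul a b| <= `|a| * `|b|;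
  cstar_id : forall a : A, `|cmul (star a) a| = `|a| ^+ 2 }.

#[short(type="cstarType")]
HB.structure Definition CStarAlgebra (R : realType) :=
  {A of CompleteNormedModule R[i] A & isCStar R A}.

Declare Scope cstar_scope.
Notation "a ** b" := (cmul a b)
  (at level 40, left associativity) : cstar_scope.
Local Open Scope cstar_scope.

Definition cpositive (R : realType) (A : cstarType R) (a : A) : Prop :=
  exists b : A, a = star b ** b.

Definition cle (R : realType) (A : cstarType R) (a b : A) : Prop :=
  cpositive (b - a).

Definition star_hom (R : realType) (A B : cstarType R) (f : A -> B) : Prop :=
  [/\ linear f, {morph f : a b / a ** b} & {morph f : a / star a}].

Definition star_aut (R : realType) (A : cstarType R) (f : A -> A) : Prop :=
  star_hom f /\ bijective f.

Definition closed_star_subalgebra (R : realType) (A : cstarType R)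
    (D : set A) : Prop :=
  [/\ closed D, D 0, forall (k : R[i]) a b, D a -> D b -> D (k *: a + b),
      forall a b, D a -> D b -> D (a ** b) & forall a, D a -> D (star a)].

Definition cstar_generated_by (R : realType) (A : cstarType R)
    (G : set A) : Prop :=
  forall D : set A, closed_star_subalgebra D -> G `<=` D -> D = setT.

Definition closed_ideal (R : realType) (A : cstarType R) (I : set A) : Prop :=
  [/\ closed I, I 0, forall (k : R[i]) a b, I a -> I b -> I (k *: a + b)
    & forall c a, I a -> I (c ** a) /\ I (a ** c)].

Definition ideal_generated_by (R : realType) (A : cstarType R)
    (G : set A) : set A :=
  \bigcap_(I in [set I : set A | closed_ideal I /\ G `<=` I]) I.

(* q exhibits B as the quotient of A by J.  A surjective *-homomorphism with
   kernel J induces an isometric isomorphism of A / J onto B. *)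
Definition is_quotient_map (R : realType) (A B : cstarType R) (J : set A)
    (q : A -> B) : Prop :=
  [/\ star_hom q, forall b, exists a, q a = b & forall a, q a = 0 <-> J a].

Definition is_projection (R : realType) (A : cstarType R) (a : A) : Prop :=
  a ** a = a /\ star a = a.

Definition partial_isometry (R : realType) (A : cstarType R) (a : A) : Prop :=
  a ** star a ** a = a.

Definition TCK_family (R : realType) (E : digraph) (A : cstarType R)
    (P : vtx E -> A) (S : edge E -> A) : Prop :=
  [/\ (forall v, is_projection (P v)) /\ (forall v w, v != w -> P v ** P w = 0),
      forall e, partial_isometry (S e),
      forall e, star (S e) ** S e = P (src e)
    & forall (v : vtx E) (F : {set edge E}), (forall e, e \in F -> rng e = v) ->
        cle (\sum_(e in F) S e ** star (S e)) (P v)].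

(* (T, p, s) is TC*(E). *)
Definition universal_TCK (R : realType) (E : digraph) (T : cstarType R)
    (p : vtx E -> T) (s : edge E -> T) : Prop :=
  [/\ TCK_family p s,
      cstar_generated_by (range p `|` range s)
    & forall (B : cstarType R) (P : vtx E -> B) (S : edge E -> B),
        TCK_family P S ->
        exists pi : T -> B, [/\ star_hom pi, forall v, pi (p v) = P v
                              & forall e, pi (s e) = S e]].

Fixpoint s_edges (R : realType) (E : digraph) (T : cstarType R)
    (s : edge E -> T) (e : edge E) (m : seq (edge E)) : T :=
  if m is f :: m' then s e ** s_edges s f m' else s e.

Definition s_path (R : realType) (E : digraph) (T : cstarType R)
    (p : vtx E -> T) (s : edge E -> T) (mu : gpath E) : T :=
  if pedges mu is e :: m then s_edges s e m else p (prng mu).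

Definition CK_gap (R : realType) (E : digraph) (T : cstarType R)
    (p : vtx E -> T) (s : edge E -> T) (v : vtx E) : T :=
  p v - \sum_(f : edge E | rng f == v) s f ** star (s f).

Definition CK_ideal (R : realType) (E : digraph) (T : cstarType R)
    (p : vtx E -> T) (s : edge E -> T) : set T :=
  ideal_generated_by
    [set CK_gap p s v | v in [set v | exists e : edge E, rng e = v]].

Definition is_gauge_action (R : realType) (E : digraph) (T : cstarType R)
    (p : vtx E -> T) (s : edge E -> T) (gamma : R[i] -> T -> T) : Prop :=
  [/\ forall z, `|z| = 1 -> star_aut (gamma z),
      gamma 1 = id,
      forall z w, `|z| = 1 -> `|w| = 1 -> gamma (z * w) = gamma z \o gamma w
    & forall z, `|z| = 1 -> forall mu nu : gpath E,
        gamma z (s_path p s mu ** star (s_path p s nu)) =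
        z ^ ((plen mu)%:Z - (plen nu)%:Z) *:
          (s_path p s mu ** star (s_path p s nu))].

Definition expi (R : realType) (t : R) : R[i] := cos t +i* sin t.

(* If phi is unbounded, the supremum takes the junk value 0. *)
Definition functional_norm (R : realType) (A : cstarType R)
    (phi : A -> R[i]) : R :=
  sup [set Normc.normc (phi a) | a in [set a : A | `|a| <= 1]].

Definition is_state (R : realType) (A : cstarType R) (phi : A -> R[i]) : Prop :=
  [/\ scalar phi, forall a, 0 <= phi (star a ** a) & functional_norm phi = 1].

Definition analytic_on_C (R : realType) (A : cstarType R)
    (f : R[i] -> A) : Prop :=
  forall z0 : R[i], exists (r : R) (c : nat -> A), 0 < r /\
    forall z : R[i], `|z - z0| < r%:C ->
      series (fun n => (z - z0) ^+ n *: c n) @ \oo --> f z.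

(* a is alpha-analytic, and f z is alpha_z(a). *)
Definition analytic_extension (R : realType) (A : cstarType R)
    (alpha : R -> A -> A) (a : A) (f : R[i] -> A) : Prop :=
  analytic_on_C f /\ forall t : R, f t%:C = alpha t a.

Definition analytic_element (R : realType) (A : cstarType R)
    (alpha : R -> A -> A) (a : A) : Prop :=
  exists f, analytic_extension alpha a f.

Definition KMS_state (R : realType) (A : cstarType R) (alpha : R -> A -> A)
    (beta : R) (phi : A -> R[i]) : Prop :=
  is_state phi /\
  if beta == 0 then
    (forall t a, phi (alpha t a) = phi a) /\
    (forall a b, phi (a ** b) = phi (b ** a))
  else
    forall (a b : A) (f : R[i] -> A),
      analytic_extension alpha a f -> analytic_element alpha b ->
      phi (a ** b) = phi (b ** f (0 +i* beta)).

(* Main.v *)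
(* Monomials [s_mu s_nu^*] are homogeneous for the gauge dynamics.  For a KMS
   state [psi] at inverse temperature [beta] this gives
   [psi (s_mu s_nu^* ) = delta_(mu, nu) e^(- beta |mu|) psi (p_(s(mu)))], and
   positivity of the gap projections says that the vertex weights
   [y_v = psi (p_v)] satisfy [A y <= e^beta y], with equality if [psi] comes from
   the graph algebra.  Comparison with the Perron-Frobenius eigenvector then
   forces [e^beta = rho(A)] and [y = x].  This yields (c) and both uniqueness
   assertions.

   For existence, represent the Toeplitz algebra on the l^2-space of words and
   average vector states over words of length n, with weights
   [rho(A)^(- n) x_(s(mu))]; these functionals are eventually constant on every
   monomial, and their limit has the required values.  The KMS condition passes
   from monomials to all analytic elements by the identity theorem for entire
   functions, and the limit vanishes on the ideal generated by the gap
   projections by the KMS condition and the Cauchy-Schwarz inequality. *)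
Require Import Defs.
From HB Require Import structures.
From mathcomp Require Import all_boot all_order all_algebra.
From mathcomp Require Import complex.
From mathcomp Require Import all_classical all_reals all_analysis.
From mathcomp Require Import ring lra.
Set Implicit Arguments.
Unset Strict Implicit.
Unset Printing Implicit Defensive.
Import Order.TTheory GRing.Theory Num.Theory.
Import numFieldNormedType.Exports.
Local Open Scope classical_set_scope.
Local Open Scope ring_scope.
Local Open Scope complex_scope.
Local Open Scope cstar_scope.

(** The order of a C*-algebra is given here by elements [star b ** b], and the Toeplitz inequality
    must yield that distinct edges have orthogonal ranges. The usual route, positivity of
    [star d ** d], rests on spectral theory. It is enough that [star d ** d = - (m ** m)] with [m]
    self-adjoint forces [m = 0], and this follows from norm estimates alone, starting from an
    iterated square root of [1 - h]. The same square root bounds positive functionals by their value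
    at the unit. Monomials are indexed by pairs of a word and a source vertex. Arbitrary words are
    allowed: those that are not paths give the zero element, so recursion on words carries no side
    condition. If [rho(A) = 1] the temperature is 0 and the KMS condition becomes invariance and
    traciality. On homogeneous elements both forms of the condition read
    [psi (a b) = e^(- k beta) psi (b a)], and the arguments go through this common form. *)

Local Notation normc := Normc.normc.

(** * Real-valued norms and epsilon forms of convergence and closedness *)

Section RealNorm.
Variable R : realType.

Definition rnorm (V : normedModType R[i]) (a : V) : R := complex.Re `|a|.

Lemma normc_ge0 (z : R[i]) : 0 <= normc z.
Proof. by case: z => a b; exact: sqrtr_ge0. Qed.

Lemma normcE (z : R[i]) : `|z| = (normc z)%:C.
Proof. by []. Qed.

Lemma normcR (x : R) : normc x%:C = `|x|.
Proof. by rewrite /= expr0n addr0 sqrtr_sqr. Qed.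

Lemma normcJ (z : R[i]) : normc z^* = normc z.
Proof. by case: z => a b /=; rewrite sqrrN. Qed.

Section Normed.
Variable V : normedModType R[i].
Implicit Types a b : V.

Lemma rnormE a : `|a| = (rnorm a)%:C.
Proof. by rewrite /rnorm RRe_real ?ger0_real. Qed.

Lemma rnorm_ge0 a : 0 <= rnorm a.
Proof. by rewrite -ler0c -rnormE. Qed.

Lemma rnorm0 : rnorm (0 : V) = 0.
Proof. by rewrite /rnorm normr0. Qed.

Lemma rnorm_eq0 a : rnorm a = 0 -> a = 0.
Proof. by move=> a0; apply/eqP; rewrite -normr_eq0 rnormE a0. Qed.

Lemma rnormD a b : rnorm (a + b) <= rnorm a + rnorm b.
Proof. by rewrite -lecR rmorphD /= -!rnormE ler_normD. Qed.

Lemma rnormN a : rnorm (- a) = rnorm a.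
Proof. by rewrite /rnorm normrN. Qed.

Lemma rnormB a b : rnorm (a - b) <= rnorm a + rnorm b.
Proof. by rewrite -(rnormN b) rnormD. Qed.

Lemma rdistC a b : rnorm (a - b) = rnorm (b - a).
Proof. by rewrite /rnorm distrC. Qed.

Lemma rdistD a b c : rnorm (a - c) <= rnorm (a - b) + rnorm (b - c).
Proof. by have := rnormD (a - b) (b - c); rewrite addrA subrK. Qed.

Lemma rnormZ (k : R[i]) a : rnorm (k *: a) = normc k * rnorm a.
Proof. by apply: complexI; rewrite rmorphM /= -!rnormE normrZ normcE. Qed.

Lemma le_norm_rnorm a (r : R) : (`|a| <= r%:C) = (rnorm a <= r).
Proof. by rewrite rnormE lecR. Qed.

Lemma lt_norm_rnorm a (r : R) : (`|a| < r%:C) = (rnorm a < r).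
Proof. by rewrite rnormE ltcR. Qed.

Lemma gt0_realC (e : R[i]) : 0 < e -> e = (complex.Re e)%:C /\ 0 < complex.Re e.
Proof.
move=> e0; have er : e = (complex.Re e)%:C by rewrite RRe_real ?gtr0_real.
by split => //; rewrite -ltcR -er.
Qed.

Lemma cvg_rnormP (u : nat -> V) (l : V) :
  u @ \oo --> l <->
  forall e : R, 0 < e -> exists N, forall n, (N <= n)%N -> rnorm (u n - l) < e.
Proof.
split=> [/cvgrPdist_lt ul e e0|ul].
  have /ul [N _ uN] : 0 < e%:C :> R[i] by rewrite -[0]/(0%:C) ltcR.
  by exists N => n Nn; rewrite rdistC -lt_norm_rnorm; exact: uN.
apply/cvgrPdist_lt => e /gt0_realC[-> /ul [N uN]].
by exists N => // n Nn; rewrite /= lt_norm_rnorm rdistC uN.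
Qed.

Lemma closed_rnormP (Q : set V) :
  closed Q <->
  forall a, (forall e : R, 0 < e -> exists2 b, Q b & rnorm (a - b) < e) -> Q a.
Proof.
split=> [cQ a aQ|aQ a Qa].
  apply: cQ => B /nbhs_normP[e /= /gt0_realC[eE e0] eB].
  have [b Qb ab] := aQ _ e0; exists b; split => //.
  by apply: eB; rewrite /= eE lt_norm_rnorm.
apply: aQ => e e0.
have /Qa [b [Qb ab]] : nbhs a [set b | `|a - b| < e%:C].
  apply/nbhs_normP; exists e%:C => //=.
  by rewrite -[0]/(0%:C) ltcR.
by exists b => //; rewrite -lt_norm_rnorm.
Qed.

End Normed.

Lemma rnorm_complete (V : completeNormedModType R[i]) (u : nat -> V) :
  (forall e : R, 0 < e -> exists N, forall m n, (N <= m)%N -> (N <= n)%N ->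
     rnorm (u m - u n) < e) ->
  exists l, forall e : R, 0 < e -> exists N, forall n, (N <= n)%N ->
     rnorm (u n - l) < e.
Proof.
move=> uC; suff : cvg (u @ \oo) by move=> /cvg_rnormP ul; exists (lim (u @ \oo)).
apply: cauchy_cvg; apply: cauchy_exP => e /gt0_realC[-> /uC [N uN]].
exists (u N), N => // n /= Nn.
by rewrite -ball_normE /= lt_norm_rnorm uN.
Qed.

End RealNorm.

(** * Elementary algebra and norm identities in a C*-algebra *)

Section CstarBasics.
Variables (R : realType) (A : cstarType R).
Implicit Types a b c x y : A.

Lemma cmul0 a : 0 ** a = 0.
Proof. by have := cmulZl 0 (0 : A) a; rewrite !scale0r. Qed.

Lemma cmulr0 a : a ** 0 = 0.
Proof. by have := cmulZr 0 a (0 : A); rewrite !scale0r. Qed.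

Lemma cmulNl a b : - a ** b = - (a ** b).
Proof. by rewrite -scaleN1r cmulZl scaleN1r. Qed.

Lemma cmulNr a b : a ** (- b) = - (a ** b).
Proof. by rewrite -scaleN1r cmulZr scaleN1r. Qed.

Lemma cmulBl a b c : (a - b) ** c = a ** c - b ** c.
Proof. by rewrite cmulDl cmulNl. Qed.

Lemma cmulBr a b c : a ** (b - c) = a ** b - a ** c.
Proof. by rewrite cmulDr cmulNr. Qed.

(* [starZ] is stated with the conjugation of numeric closed fields. *)
Lemma starZc (k : R[i]) a : star (k *: a) = conjc k *: star a.
Proof. exact: starZ. Qed.

Lemma star0 : star (0 : A) = 0.
Proof. by have := starZc 0 (0 : A); rewrite conjc0 !scale0r. Qed.

Lemma starN a : star (- a) = - star a.
Proof. by apply/eqP; rewrite -addr_eq0 -starD addNr star0. Qed.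

Lemma starB a b : star (a - b) = star a - star b.
Proof. by rewrite starD starN. Qed.

Lemma cmul_suml (I : Type) (r : seq I) (P : pred I) (F : I -> A) b :
  (\sum_(i <- r | P i) F i) ** b = \sum_(i <- r | P i) F i ** b.
Proof.
by apply: (big_morph (fun a => a ** b)) => [x y|]; rewrite ?cmulDl ?cmul0.
Qed.

Lemma cmul_sumr (I : Type) (r : seq I) (P : pred I) (F : I -> A) b :
  b ** (\sum_(i <- r | P i) F i) = \sum_(i <- r | P i) b ** F i.
Proof.
by apply: (big_morph (fun a => b ** a)) => [x y|]; rewrite ?cmulDr ?cmulr0.
Qed.

Lemma star_sum (I : Type) (r : seq I) (P : pred I) (F : I -> A) :
  star (\sum_(i <- r | P i) F i) = \sum_(i <- r | P i) star (F i).
Proof. exact: (big_morph _ starD star0). Qed.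

Lemma rnormM a b : rnorm (a ** b) <= rnorm a * rnorm b.
Proof. by rewrite -lecR rmorphM /= -!rnormE cnormM. Qed.

Lemma rnorm_id a : rnorm (star a ** a) = rnorm a ^+ 2.
Proof. by apply: complexI; rewrite rmorphXn /= -!rnormE cstar_id. Qed.

Lemma rnorm_star a : rnorm (star a) = rnorm a.
Proof.
suff le b : rnorm b <= rnorm (star b).
  by apply/eqP; rewrite eq_le le -{2}(starK a) le.
have [->|b0] := eqVneq (rnorm b) 0; first exact: rnorm_ge0.
have bp : 0 < rnorm b by rewrite lt_def b0 rnorm_ge0.
by rewrite -(ler_pM2r bp) -expr2 -rnorm_id rnormM.
Qed.

Lemma rnorm_sqr a : star a = a -> rnorm (a ** a) = rnorm a ^+ 2.
Proof. by move=> aE; rewrite -{1}aE rnorm_id. Qed.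

Lemma cstar_eq0 a : star a ** a = 0 -> a = 0.
Proof.
move=> a0; apply: rnorm_eq0; apply/eqP.
by rewrite -sqrf_eq0 -rnorm_id a0 rnorm0.
Qed.

Lemma cmul_dist a b a' b' :
  rnorm (a ** b - a' ** b') <=
  rnorm (a - a') * rnorm b + rnorm a' * rnorm (b - b').
Proof.
have -> : a ** b - a' ** b' = (a - a') ** b + a' ** (b - b').
  by rewrite cmulBl cmulBr addrA subrK.
by rewrite (le_trans (rnormD _ _))// lerD// rnormM.
Qed.

End CstarBasics.

(** * Limits and geometric convergence in a C*-algebra *)

Section Limits.
Variable R : realType.

Lemma geometric_small (K r e : R) : 0 <= r < 1 -> 0 < e ->
  exists N, forall n, (N <= n)%N -> K * r ^+ n < e.
Proof.
case/andP=> r0 r1 e0.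
have /cvgrPdist_lt /(_ e e0) [N _ Nr] : geometric K r @ \oo --> (0 : R).
  by apply: cvg_geometric; rewrite ger0_norm.
exists N => n Nn; apply: le_lt_trans (Nr n Nn).
by rewrite /= sub0r normrN ler_norm.
Qed.

Lemma geometric_complete (V : completeNormedModType R[i]) (u : nat -> V)
    (K r : R) : 0 <= r < 1 ->
  (forall n, rnorm (u n.+1 - u n) <= K * r ^+ n) ->
  exists l : V, u @ \oo --> l.
Proof.
move=> rP uP; have [r0 r1] := andP rP.
have r10 : 0 < 1 - r by rewrite subr_gt0.
have K0 : 0 <= K by have := uP 0%N; rewrite expr0 mulr1; apply/le_trans/rnorm_ge0.
(* The bound is the exact geometric sum of the increments from [m] to [m + k], so the induction step
   is an equality. *)
have dist m k : rnorm (u (m + k)%N - u m) <= K / (1 - r) * (r ^+ m - r ^+ (m + k)).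
  elim: k => [|k IH]; first by rewrite addn0 !subrr mulr0 rnorm0.
  rewrite addnS; apply: le_trans (rdistD _ (u (m + k)%N) _) _.
  apply: le_trans (lerD (uP _) IH) _.
  rewrite exprS le_eqVlt; apply/orP; left; apply/eqP; field.
  by rewrite gt_eqF.
have distN N m : (N <= m)%N -> rnorm (u m - u N) <= K / (1 - r) * r ^+ N.
  move=> /subnKC <-; apply: le_trans (dist _ _) _.
  apply: ler_wpM2l; first by rewrite divr_ge0 // ltW.
  by rewrite gerBl exprn_ge0.
have [l ul] : exists l, forall e : R, 0 < e -> exists N, forall n, (N <= n)%N ->
     rnorm (u n - l) < e.
  apply: rnorm_complete => e e0.
  have [N rN] := geometric_small (K / (1 - r)) rP (divr_gt0 e0 (ltr0n _ 2)).
  exists N => m n Nm Nn; rewrite (le_lt_trans (rdistD _ (u N) _))//.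
  rewrite (splitr e) ltrD//; first by rewrite (le_lt_trans (distN _ _ Nm)) ?rN.
  by rewrite rdistC (le_lt_trans (distN _ _ Nn)) ?rN.
by exists l; apply/cvg_rnormP.
Qed.

Variable A : cstarType R.

Lemma cvg_star (u : nat -> A) (a : A) :
  u @ \oo --> a -> (fun n => star (u n)) @ \oo --> star a.
Proof.
move=> /cvg_rnormP ua; apply/cvg_rnormP => e /ua[N uN].
by exists N => n Nn; rewrite -starB rnorm_star uN.
Qed.

Lemma cvg_cmul (u v : nat -> A) a b : u @ \oo --> a -> v @ \oo --> b ->
  (fun n => u n ** v n) @ \oo --> a ** b.
Proof.
move=> /cvg_rnormP ua /cvg_rnormP vb; apply/cvg_rnormP => e e0.
have M0 : 0 < rnorm a + rnorm b + 1 by rewrite ltr_wpDl ?addr_ge0 ?rnorm_ge0.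
(* The minimum with 1 keeps [rnorm (v n)] below [rnorm b + 1]; the two errors then add up to at most
   [(rnorm a + rnorm b + 1)] times the second argument, which is [e]. *)
have d0 : 0 < Num.min 1 (e / (rnorm a + rnorm b + 1)) by rewrite lt_min ltr01 divr_gt0.
have [[N1 uN] [N2 vN]] := (ua _ d0, vb _ d0).
exists (maxn N1 N2) => n; rewrite geq_max => /andP[/uN + /vN].
rewrite !lt_min => /andP[u1 ue] /andP[v1 ve].
apply: le_lt_trans (cmul_dist _ _ _ _) _.
have vn : rnorm (v n) <= rnorm b + 1.
  by rewrite -[v n](subrK b) (le_trans (rnormD _ _))// addrC lerD2l ltW.
set d := e / _ in ue ve.
apply: (@le_lt_trans _ _ (rnorm (u n - a) * (rnorm b + 1) + rnorm a * d)).
  by rewrite lerD// ler_wpM2l ?rnorm_ge0// ltW.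
apply: (@lt_le_trans _ _ (d * (rnorm b + 1) + rnorm a * d)).
  by rewrite ltrD2r ltr_pM2r// ltr_wpDl ?rnorm_ge0.
by rewrite mulrC -mulrDl addrC addrA /d mulrC divfK// gt_eqF.
Qed.

Lemma cvgn_unique (u : nat -> A) (a b : A) : u @ \oo --> a -> u @ \oo --> b -> a = b.
Proof. exact: (@cvg_unique _ (@norm_hausdorff _ A)). Qed.

Lemma cvg_cst_unique (u : nat -> A) (a b : A) :
  u @ \oo --> a -> (forall n, u n = b) -> a = b.
Proof.
move=> ua ub; apply: (cvgn_unique ua).
by rewrite (_ : u = fun=> b); [exact: cvg_cst|apply/funext].
Qed.

End Limits.

(** * Square roots by iteration *)

Section SquareRoot.
Variables (R : realType) (A : cstarType R).
Implicit Types a b c d x y z h : A.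

(* [1 - y] is a square root of [1 - h]; [y] is the limit of the iteration
   [y -> (h + y^2) / 2], a contraction of the ball of radius [rnorm h]. *)
Lemma cstar_sqrt h : star h = h -> rnorm h < 1 ->
  exists y, [/\ star y = y, y + y - y ** y = h
              & forall z, z ** h = h ** z -> z ** y = y ** z].
Proof.
move=> hs h1; set r := rnorm h.
have r0 : 0 <= r by exact: rnorm_ge0.
have half0 : 0 <= 2^-1 :> R by rewrite invr_ge0.
pose half : R[i] := (2^-1)%:C.
have halfE : normc half = 2^-1 by rewrite normcR ger0_norm.
have half2 : half + half = 1.
  by apply/eqP; rewrite eq_complex /= addr0 eqxx andbT; apply/eqP; field.
pose Y n := iter n (fun y => half *: (h + y ** y)) (0 : A).
have YS n : Y n.+1 = half *: (h + Y n ** Y n) by [].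
have Yr n : rnorm (Y n) <= r.
  elim: n => [|n IH]; first by rewrite rnorm0.
  rewrite YS rnormZ halfE (le_trans (ler_wpM2l half0 (rnormD _ _)))//.
  have := rnormM (Y n) (Y n); have := ler_pM (rnorm_ge0 _) (rnorm_ge0 _) IH IH.
  have : r * r <= r by rewrite ler_piMr // ltW.
  rewrite -/r; lra.
have Ys n : star (Y n) = Y n.
  elim: n => [|n IH]; first by rewrite star0.
  by rewrite YS starZc conjc_real starD starM IH hs.
have Yc z n : z ** h = h ** z -> z ** Y n = Y n ** z.
  move=> zh; elim: n => [|n IH]; first by rewrite cmul0 cmulr0.
  rewrite YS cmulZr cmulZl cmulDl cmulDr zh; congr (_ *: (_ + _)).
  by rewrite cmulA IH -cmulA IH cmulA.
have [y Yy] : exists l : A, Y @ \oo --> l.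
  apply: (@geometric_complete _ _ _ r r); first by rewrite r0.
  elim=> [|n IH].
    by rewrite YS cmul0 addr0 subr0 rnormZ halfE expr0 mulr1 -/r; lra.
  rewrite YS YS -scalerBr opprD addrACA subrr add0r rnormZ halfE.
  have := cmul_dist (Y n.+1) (Y n.+1) (Y n) (Y n).
  have := ler_pM (rnorm_ge0 _) (rnorm_ge0 _) IH (Yr n.+1).
  have := ler_pM (rnorm_ge0 _) (rnorm_ge0 _) (Yr n) IH.
  rewrite exprS; lra.
exists y; split.
- apply: cvgn_unique (cvg_star Yy) _.
  by rewrite (_ : (fun n => _) = Y)//; apply/funext.
- have SY : (fun n => Y n.+1) @ \oo --> y by rewrite cvg_shiftS.
  apply: (@cvg_cst_unique _ _
    (fun n => (Y n.+1 + Y n.+1) - Y n ** Y n)) => [|n].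
    apply: cvgB; last exact: cvg_cmul.
    exact: cvgD.
  by rewrite !YS -scalerDl half2 scale1r addrK.
- move=> z zh; apply/eqP; rewrite -subr_eq0; apply/eqP.
  apply: (@cvg_cst_unique _ _ (fun n => z ** Y n - Y n ** z)) => [|n].
    by apply: cvgB; apply: cvg_cmul => //; exact: cvg_cst.
  by rewrite Yc// subrr.
Qed.

End SquareRoot.

(* Reflection for identities between linear combinations: [lin] reduces them to
   identities between coefficients. *)
Section LinearCombinations.
Variables (K : nzRingType) (V : lmodType K).

Inductive lexp :=
  LVar of nat | LZero | LAdd of lexp & lexp | LOpp of lexp | LScale of K & lexp.

Fixpoint leval (env : seq V) (e : lexp) : V :=
  match e with
  | LVar n => nth 0 env n
  | LZero => 0
  | LAdd e1 e2 => leval env e1 + leval env e2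
  | LOpp e1 => - leval env e1
  | LScale k e1 => k *: leval env e1
  end.

Fixpoint lcoef (e : lexp) (i : nat) : K :=
  match e with
  | LVar n => if eqn i n then 1 else 0
  | LZero => 0
  | LAdd e1 e2 => lcoef e1 i + lcoef e2 i
  | LOpp e1 => - lcoef e1 i
  | LScale k e1 => k * lcoef e1 i
  end.

Fixpoint lcoef_eq (n : nat) (e1 e2 : lexp) : Prop :=
  if n is m.+1 then lcoef e1 m = lcoef e2 m /\ lcoef_eq m e1 e2 else True.

Lemma leval_coef env e :
  leval env e = \sum_(i < size env) lcoef e i *: nth 0 env i.
Proof.
elim: e => [n||e1 IH1 e2 IH2|e IH|k e IH] /=.
- have [ltn|len] := ltnP n (size env).
    rewrite (bigD1 (Ordinal ltn))//= -[eqn n n]/(n == n) eqxx scale1r big1 ?addr0// => i.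
    by rewrite -[eqn _ _]/(val i == n) -val_eqE /= => /negPf->; rewrite scale0r.
  rewrite nth_default// big1// => i _; rewrite -[eqn _ _]/(val i == n) ltn_eqF ?scale0r//.
  exact: leq_trans (ltn_ord i) len.
- by rewrite big1// => i _; rewrite scale0r.
- by rewrite IH1 IH2 -big_split; apply: eq_bigr => i _; rewrite scalerDl.
- by rewrite IH -sumrN; apply: eq_bigr => i _; rewrite scaleNr.
- by rewrite IH scaler_sumr; apply: eq_bigr => i _; rewrite scalerA.
Qed.

Lemma leval_eq env e1 e2 : lcoef_eq (size env) e1 e2 ->
  leval env e1 = leval env e2.
Proof.
rewrite !leval_coef => eqc; apply: eq_bigr => i _; congr (_ *: _).
elim: (size env) (i : nat) (ltn_ord i) eqc => // n IH j + [en eqc].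
by rewrite ltnS leq_eqVlt => /orP[/eqP->//|/IH]; exact.
Qed.

End LinearCombinations.

Ltac lin_index x env :=
  lazymatch env with
  | ?y :: ?env' =>
    match goal with
    | _ => let _ := match goal with _ => constr_eq x y end in constr:(O)
    | _ => let n := lin_index x env' in constr:(S n)
    end
  end.

Ltac lin_atoms t env :=
  lazymatch t with
  | (?a + ?b)%R => let env := lin_atoms a env in lin_atoms b env
  | (- ?a)%R => lin_atoms a env
  | (_ *: ?a)%R => lin_atoms a env
  | 0%R => env
  | _ => match goal with
         | _ => let _ := lin_index t env in env
         | _ => constr:(t :: env)
         end
  end.

Ltac lin_reify K t env :=
  lazymatch t with
  | (?a + ?b)%R => let a := lin_reify K a env in let b := lin_reify K b env in
                   constr:(@LAdd K a b)
  | (- ?a)%R => let a := lin_reify K a env in constr:(@LOpp K a)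
  | (?k *: ?a)%R => let a := lin_reify K a env in constr:(@LScale K k a)
  | 0%R => constr:(@LZero K)
  | _ => let n := lin_index t env in constr:(@LVar K n)
  end.

Ltac lin_goal K V :=
  lazymatch goal with
  | |- ?a = ?b =>
    let env := lin_atoms a (@nil V) in
    let env := lin_atoms b env in
    let ea := lin_reify K a env in
    let eb := lin_reify K b env in
    refine (@leval_eq K V env ea eb _);
    cbn [lcoef_eq lcoef eqn size]; repeat split
  end.


(** * Positivity without spectral theory *)

Section Positivity.
Variables (R : realType) (A : cstarType R).
Implicit Types a b c d m w x y z : A.

Ltac lin := lin_goal (R[i] : nzRingType) (A : lmodType R[i]).
Ltac cexpand := rewrite ?(cmulDl, cmulDr, cmulNl, cmulNr, cmulZl, cmulZr, cmulA,
  starD, starN, starZc, starM).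

(** The adjoint of [c + k (1 - y)] is [c - k (1 - y)]; the two terms commute and [k^2 = -1], so the
    product of both is [c^2 + (1 - y)^2 = 1]. The operator is written through its action on [x]
    because [A] is not assumed to have a unit. *)
Lemma rnorm_isom (k : R[i]) c y x : k^* = - k -> k * k = -1 ->
  star c = c -> star y = y -> c ** y = y ** c -> y + y - y ** y = c ** c ->
  rnorm (c ** x + k *: (x - y ** x)) = rnorm x.
Proof.
move=> kJ kk cs ys cy yc; apply/eqP.
rewrite -(eqrXn2 (n := 2))// ?rnorm_ge0// -!rnorm_id; apply/eqP; congr rnorm.
have yy : star x ** y ** y ** x =
    star x ** y ** x + star x ** y ** x - star x ** c ** c ** x.
  rewrite -(cmulA _ c c) -yc; cexpand; lin; ring.
cexpand; rewrite kJ cs ys -(cmulA _ c y) cy cmulA yy.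
lin; ring: kk.
Qed.

(* [c^2 + (1 - y)^2 = 1] makes [c +- i (1 - y)] isometries, and the mean of
   their squares is [2 c^2 - 1]. *)
Lemma reflection_contraction c x : star c = c -> rnorm c < 1 ->
  rnorm (x - 2%:C *: (c ** c ** x)) <= rnorm x.
Proof.
move=> cs c1.
have [||y [ys yc cy]] := @cstar_sqrt _ _ (c ** c).
- by rewrite starM cs.
- by rewrite rnorm_sqr// expr_lt1 ?rnorm_ge0.
have {}cy : c ** y = y ** c by apply: cy; rewrite cmulA.
pose U (k : R[i]) z := c ** z + k *: (z - y ** z).
pose i : R[i] := 'i%C.
have iJ : i^* = - i by rewrite /i; simpc.
have ii : i * i = -1 by rewrite -expr2 sqr_i.
have NiJ : (- i)^* = - - i by rewrite /i; simpc.
have NiNi : - i * - i = -1 by rewrite mulrNN.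
have Ui z : rnorm (U i z) = rnorm z by exact: rnorm_isom.
have UNi z : rnorm (U (- i) z) = rnorm z by exact: rnorm_isom.
have := rnormD (U i (U i x)) (U (- i) (U (- i) x)); rewrite !(Ui, UNi).
have yy : y ** y ** x = y ** x + y ** x - c ** c ** x.
  by rewrite -yc cmulBl cmulDl; lin; ring.
have -> : U i (U i x) + U (- i) (U (- i) x) =
    (- 2%:C) *: (x - 2%:C *: (c ** c ** x)).
  by rewrite /U; cexpand; rewrite cy yy; lin; ring: ii.
by rewrite rnormZ normcN normcR ger0_norm//; lra.
Qed.

(** With a unit this would be the bound 1 on the norm of [1 - l c^2] when [0 <= l c^2 < 2]. Scaling
    [c] by the square root of [l / 2] reduces it to [l = 2]. *)
Lemma square_contraction (l : R) c x : star c = c -> 0 <= l ->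
  l * rnorm c ^+ 2 < 2 -> rnorm (x - l%:C *: (c ** c ** x)) <= rnorm x.
Proof.
move=> cs l0 lc; pose k := Num.sqrt (l / 2).
have kk : k * k = l / 2 by rewrite -expr2 sqr_sqrtr ?divr_ge0.
have k0 : 0 <= k by exact: sqrtr_ge0.
have -> : l%:C *: (c ** c ** x) = 2%:C *: ((k%:C *: c) ** (k%:C *: c) ** x).
  rewrite !(cmulZl, cmulZr) !scalerA -!rmorphM /= kk; congr (_%:C *: _); lra.
apply: reflection_contraction; first by rewrite starZc conjc_real cs.
rewrite rnormZ normcR ger0_norm// -(@expr_lt1 _ 2)// ?mulr_ge0 ?rnorm_ge0//.
rewrite exprMn (expr2 k) kk; lra.
Qed.

Lemma square_shrink (K : R) m x : star m = m -> 0 <= K ->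
  K * rnorm m ^+ 2 < 1 -> rnorm (x - K%:C *: (m ** m ** x)) <= rnorm x.
Proof. by move=> ms K0 Km; apply: square_contraction => //; lra. Qed.

(* With [d = u + i v], [d d^* = 2 u^2 + 2 v^2 + m^2] is a sum of squares. *)
Lemma neg_square_grow (K : R) d m w : star m = m -> star d ** d = - (m ** m) ->
  0 <= K -> 5%:R * K * rnorm m ^+ 2 < 2 ->
  rnorm (m ** w + K%:C *: (m ** m ** (m ** w))) <= rnorm (m ** w).
Proof.
move=> ms dm K0 Km.
have nd z : rnorm (d ** z) = rnorm (m ** z).
  apply/eqP; rewrite -(eqrXn2 (n := 2))// ?rnorm_ge0// -!rnorm_id !starM.
  by rewrite cmulA -(cmulA _ _ d) dm ms cmulNr cmulNl rnormN !cmulA.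
have nd1 : rnorm d = rnorm m.
  apply/eqP; rewrite -(eqrXn2 (n := 2))// ?rnorm_ge0// -!rnorm_id.
  by rewrite dm ms rnormN.
pose i : R[i] := 'i%C.
have iJ : conjc i = - i by rewrite /i; simpc.
have ii : i * i = -1 by rewrite -expr2 sqr_i.
pose h : R[i] := (2^-1)%:C.
have hh : h + h = 1.
  by apply/eqP; rewrite eq_complex /= addr0 eqxx andbT; apply/eqP; field.
have hJ : conjc h = h by exact: conjc_real.
have hiJ : conjc (h * i) = - (h * i) by rewrite /h /i; simpc.
pose u := h *: (d + star d); pose v := (h * i) *: (star d - d).
have us : star u = u by rewrite starZc hJ starD starK addrC.
have vs : star v = v.
  by rewrite /v starZc hiJ starB starK; lin; ring.
have hn : normc h = 2^-1 by rewrite normcR ger0_norm ?invr_ge0.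
have un : rnorm u <= rnorm m.
  by rewrite rnormZ hn; have := rnormD d (star d); rewrite rnorm_star nd1; lra.
have vn : rnorm v <= rnorm m.
  rewrite rnormZ Normc.normcM hn [normc i](_ : _ = 1).
    by have := rnormB (star d) d; rewrite rnorm_star nd1; lra.
  by rewrite /= expr0n expr1n add0r sqrtr1.
have hhu x : u ** u ** x = (h * h) *: (d ** d ** x + d ** star d ** x
    + star d ** d ** x + star d ** star d ** x).
  by rewrite /u; cexpand; lin; ring.
have hhv x : v ** v ** x = - (h * h) *: (d ** d ** x - d ** star d ** x
    - star d ** d ** x + star d ** star d ** x).
  by rewrite /v; cexpand; lin; ring: ii.
(* The coefficients 2, 2, 1 of [u^2], [v^2], [m^2] in [d ** star d] have sum 5. Hence [1 - K d d^*]
   is the convex combination, with weights 2/5, 2/5, 1/5, of the contractions [1 - 5 K c^2] for [c]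
   among [u], [v], [m]. *)
have five c : star c = c -> rnorm c <= rnorm m -> forall x,
    rnorm (x - (5%:R * K)%:C *: (c ** c ** x)) <= rnorm x.
  move=> cs cm x; apply: square_contraction => //; first lra.
  apply: le_lt_trans Km; rewrite ler_wpM2l//; first lra.
  by rewrite lerXn2r ?nnegrE ?rnorm_ge0.
have kx x : rnorm (x - K%:C *: (d ** star d ** x)) <= rnorm x.
  have -> : x - K%:C *: (d ** star d ** x) =
      (2 / 5)%:C *: (x - (5%:R * K)%:C *: (u ** u ** x)) +
      (2 / 5)%:C *: (x - (5%:R * K)%:C *: (v ** v ** x)) +
      (1 / 5)%:C *: (x - (5%:R * K)%:C *: (m ** m ** x)).
    have -> : m ** m ** x = - (star d ** d ** x) by rewrite dm cmulNl opprK.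
    by rewrite hhu hhv /h; lin;
      rewrite ?(rmorphM, fmorphV, rmorph1, rmorph_nat) /=; field.
  have := five u us un x; have := five v vs vn x; have := five m ms (lexx _) x.
  set a := rnorm (x - _ *: (u ** _ ** _)); set b := rnorm (x - _ *: (v ** _ ** _)).
  set c := rnorm (x - _ *: (m ** _ ** _)) => c1 b1 a1.
  apply: le_trans (rnormD _ _) _; apply: le_trans (lerD (rnormD _ _) (lexx _)) _.
  rewrite !rnormZ !normcR !ger0_norm ?divr_ge0// -/a -/b -/c; lra.
have := kx (d ** w); rewrite nd.
(* Moving [d] through the bracket turns [d ** star d] into [star d ** d = - (m ** m)]. The sign
   change makes a contraction with a plus sign, and [nd] replaces the left factor [d] by [m]. *)
suff -> : d ** w - K%:C *: (d ** star d ** (d ** w)) =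
    d ** (w + K%:C *: (m ** m ** w)) by rewrite nd cmulDr cmulZr !cmulA.
rewrite cmulDr cmulZr -(cmulA d) (cmulA (star d)) dm cmulNl cmulNr !cmulA.
by rewrite scalerN opprK.
Qed.

(** If [m] were nonzero, both [1 + K m^2] and [1 - K m^2] would not increase norms along the powers
    of [m], so their cubes applied to [m^2] would stay too close together. *)
Lemma neg_square_eq0 d m : star m = m -> star d ** d = - (m ** m) -> m = 0.
Proof.
move=> ms dm; apply: rnorm_eq0; apply/eqP/contraT => mu0.
set mu := rnorm m in mu0.
have mup : 0 < mu by rewrite lt_def mu0 rnorm_ge0.
(* [K * mu ^+ 2 = 0.39] lies just below the limit 2/5 of [neg_square_grow]. As
   [(1 + t)^3 - (1 - t)^3 = 6 t + 2 t^3], the estimates give [6 * 0.39 <= 2 + 2 * 0.39^3], which is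
   false. First or second powers of [F] and [G] would not give a contradiction. *)
pose K : R := 39%:R / 100%:R / mu ^+ 2.
have mu2 : mu ^+ 2 != 0 by rewrite expf_neq0.
have K0 : 0 <= K by rewrite !divr_ge0// sqr_ge0.
have Kmu : K * mu ^+ 2 = 39%:R / 100%:R by rewrite divfK.
clearbody K.
pose F w := w + K%:C *: (m ** m ** w); pose G w := w - K%:C *: (m ** m ** w).
have Fm w : rnorm (F (m ** w)) <= rnorm (m ** w).
  by apply: neg_square_grow dm _ _ => //; rewrite -mulrA Kmu; lra.
have Gm w : rnorm (G w) <= rnorm w.
  by apply: square_shrink => //; rewrite Kmu; lra.
have FmE w : F (m ** w) = m ** F w by rewrite /F cmulDr cmulZr !cmulA.
pose p0 := m ** m; pose p1 := m ** m ** p0; pose p3 := m ** m ** (m ** m ** p1).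
(* [F] commutes with left multiplication by [m], so each iterate of [p0 = m ** m] is again of the
   form [m ** w], where [Fm] applies. *)
have F3 : rnorm (F (F (F p0))) <= rnorm p0.
  rewrite /p0 !FmE -FmE (le_trans (Fm _))// -FmE (le_trans (Fm _))// -FmE.
  exact: Fm.
have G3 : rnorm (G (G (G p0))) <= rnorm p0.
  by rewrite (le_trans (Gm _))// (le_trans (Gm _)).
have := rnormB (F (F (F p0))) (G (G (G p0))).
have -> : F (F (F p0)) - G (G (G p0)) =
   6%:R *: (K%:C *: p1) + (2%:R * K%:C * K%:C * K%:C) *: p3.
  by rewrite /F /G /p1 /p3; cexpand; lin; ring.
have n2 a : star a = a -> star (a ** a) = a ** a by move=> e; rewrite starM e.
have p0n : rnorm p0 = mu ^+ 2 by rewrite rnorm_sqr.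
have p1n : rnorm p1 = mu ^+ 4 by rewrite /p1 rnorm_sqr ?n2// p0n -exprM.
have p3n : rnorm p3 <= mu ^+ 8.
  have -> : mu ^+ 8 = mu ^+ 2 * (mu ^+ 2 * mu ^+ 4) by rewrite -!exprD.
  rewrite (le_trans (rnormM _ _))// p0n ler_wpM2l ?sqr_ge0//.
  by rewrite (le_trans (rnormM _ _))// p0n p1n.
set q := _ *: p3 => h.
have qn : rnorm q <= 2%:R * K ^+ 3 * mu ^+ 8.
  rewrite rnormZ !Normc.normcM normcR -[2%:R](rmorph_nat (real_complex R)) normcR.
  rewrite !ger0_norm//; apply: le_trans (ler_wpM2l _ p3n) _; last by rewrite !exprS; lra.
  by rewrite !mulr_ge0.
have e1 : K * mu ^+ 4 = 39%:R / 100%:R * mu ^+ 2.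
  by rewrite (exprD _ 2 2) mulrA Kmu.
have e2 : K ^+ 3 * mu ^+ 8 = (39%:R / 100%:R) ^+ 3 * mu ^+ 2.
  rewrite -Kmu; ring.
have Xn : rnorm (6%:R *: (K%:C *: p1)) = 6%:R * (39%:R / 100%:R * mu ^+ 2).
  rewrite rnormZ rnormZ normcR -[6%:R](rmorph_nat (real_complex R)) normcR p1n.
  by rewrite !ger0_norm// e1.
move: qn; rewrite -mulrA e2 => qn.
have := rnormB (6%:R *: (K%:C *: p1) + q) q; rewrite addrK Xn.
have t0 : 0 < mu ^+ 2 by rewrite exprn_gt0.
move: F3 G3 h; rewrite p0n; set f := rnorm (F _); set g := rnorm (G _).
lra.
Qed.
End Positivity.

(** * Order and orthogonality of projections *)

Section Projections.
Variables (R : realType) (A : cstarType R).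
Implicit Types a b P Q : A.

(** Compressing [P - Q = star b ** b] by [(1 - P) Q] gives [- m^2] with [m = Q (1 - P) Q]. So
    [m = 0], and [m] is the square of the absolute value of [(1 - P) Q]. *)
Lemma projection_le P Q : is_projection P -> is_projection Q -> cle Q P ->
  P ** Q = Q.
Proof.
move=> [PP Ps] [QQ Qs] [b Pb].
have xPP x : x ** P ** P = x ** P by rewrite -cmulA PP.
have xQQ x : x ** Q ** Q = x ** Q by rewrite -cmulA QQ.
pose m := Q - Q ** P ** Q.
have ms : star m = m by rewrite starB !starM Ps Qs cmulA.
have m0 : m = 0.
  apply: (@neg_square_eq0 _ _ (b ** (Q - P ** Q))) => //.
  rewrite starM -cmulA (cmulA (star b)) -Pb starB starM Ps Qs /m.
  rewrite !(cmulBl, cmulBr) !cmulA ?(xPP, xQQ, QQ, PP).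
  lin_goal (R[i] : nzRingType) (A : lmodType R[i]); ring.
apply/esym/eqP; rewrite -subr_eq0; apply/eqP/cstar_eq0.
rewrite starB starM Ps Qs !(cmulBl, cmulBr) !cmulA ?(xPP, xQQ, QQ, PP).
by rewrite subrr subr0; exact: m0.
Qed.

(** Compressing [P - Q - Q'] by [Q Q'] gives [- m^2] with [m = Q' Q Q'], because [P] acts as the
    identity on [Q]. *)
Lemma projection_orthogonal P Q Q' : is_projection P -> is_projection Q ->
  is_projection Q' -> P ** Q = Q -> cle (Q + Q') P -> Q ** Q' = 0.
Proof.
move=> [PP Ps] [QQ Qs] [QQ' Qs'] PQ [b Pb].
have QP : Q ** P = Q by rewrite -Ps -Qs -starM PQ.
have xQP x : x ** Q ** P = x ** Q by rewrite -cmulA QP.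
have xQQ x : x ** Q ** Q = x ** Q by rewrite -cmulA QQ.
have xQQ' x : x ** Q' ** Q' = x ** Q' by rewrite -cmulA QQ'.
pose m := Q' ** Q ** Q'.
have ms : star m = m by rewrite !starM Qs Qs' cmulA.
have m0 : m = 0.
  apply: (@neg_square_eq0 _ _ (b ** (Q ** Q'))) => //.
  rewrite !starM Qs Qs' -cmulA (cmulA (star b)) -Pb /m.
  rewrite !(cmulBl, cmulBr, cmulDl, cmulDr) !cmulA ?(xQP, xQQ, xQQ').
  lin_goal (R[i] : nzRingType) (A : lmodType R[i]); ring.
by apply: cstar_eq0; rewrite starM Qs Qs' !cmulA xQQ.
Qed.

End Projections.

(** * Multiplication rules of a Toeplitz-Cuntz-Krieger family *)

Section ToeplitzRelations.
Variables (R : realType) (E : digraph) (A : cstarType R).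
Variables (P : vtx E -> A) (S : edge E -> A).
Hypothesis PS : TCK_family P S.

Lemma tck_projection v : is_projection (P v).
Proof. by case: PS => -[]. Qed.

Lemma tck_mulPP v w : P v ** P w = if v == w then P v else 0.
Proof.
case: eqVneq => [<-|vw]; first by case: (tck_projection v).
by case: PS => -[_ ->].
Qed.

Lemma tck_starP v : star (P v) = P v.
Proof. by case: (tck_projection v). Qed.

Lemma tck_starSS e : star (S e) ** S e = P (src e).
Proof. by case: PS. Qed.

Lemma tck_mulSSS e : S e ** star (S e) ** S e = S e.
Proof. by case: PS => _ /(_ e). Qed.

Lemma tck_mulSP e : S e ** P (src e) = S e.
Proof. by rewrite -tck_starSS cmulA tck_mulSSS. Qed.

Lemma tck_range_projection e : is_projection (S e ** star (S e)).
Proof.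
split; last by rewrite starM starK.
by rewrite cmulA tck_mulSSS.
Qed.

Lemma tck_mulPQ e : P (rng e) ** (S e ** star (S e)) = S e ** star (S e).
Proof.
apply: projection_le; [exact: tck_projection|exact: tck_range_projection|].
case: PS => _ _ _ /(_ (rng e) [set e]%SET); rewrite big_set1; apply.
by move=> f /set1P ->.
Qed.

Lemma tck_mulPS v e : P v ** S e = if v == rng e then S e else 0.
Proof.
have PSe : P (rng e) ** S e = S e.
  rewrite -{2}(tck_mulSP e) -tck_starSS cmulA -tck_mulPQ -cmulA.
  by rewrite -cmulA tck_starSS tck_mulSP.
by case: eqVneq => [->//|ve]; rewrite -PSe cmulA tck_mulPP (negPf ve) cmul0.
Qed.

Lemma tck_mulSP_neq e v : S e ** P v = if v == src e then S e else 0.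
Proof.
case: eqVneq => [->|ve]; first exact: tck_mulSP.
by rewrite -tck_mulSP -cmulA tck_mulPP eq_sym (negPf ve) cmulr0.
Qed.

(** For [e != f] the product factors through the product of the two range projections. These are
    orthogonal by the family inequality for the set of both edges if the edges have the same range,
    and by orthogonality of the vertex projections otherwise. *)
Lemma tck_mul_starSS e f :
  star (S e) ** S f = if e == f then P (src e) else 0.
Proof.
case: eqVneq => [<-|ef]; first exact: tck_starSS.
have sSSS : star (S e) ** S e ** star (S e) = star (S e).
  by rewrite -{4}tck_mulSSS !starM starK cmulA.
have <- : star (S e) ** ((S e ** star (S e)) ** (S f ** star (S f))) ** S f =
    star (S e) ** S f.
  by rewrite !cmulA sSSS -!cmulA (cmulA (S f)) tck_mulSSS.
suff -> : (S e ** star (S e)) ** (S f ** star (S f)) = 0.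
  by rewrite cmulr0 cmul0.
have [ref|ref] := eqVneq (rng e) (rng f).
  apply: (projection_orthogonal (tck_projection (rng e))).
  - exact: tck_range_projection.
  - exact: tck_range_projection.
  - exact: tck_mulPQ.
  case: PS => _ _ _ /(_ (rng e) [set e; f]%SET).
  rewrite big_setU1 ?inE// big_set1; apply.
  by move=> g /set2P[] ->.
have QP : S e ** star (S e) ** P (rng e) = S e ** star (S e).
  have [_ Qs] := tck_range_projection e.
  by rewrite -{1}Qs -(tck_starP (rng e)) -starM tck_mulPQ Qs.
rewrite -QP -(tck_mulPQ f).
by rewrite -cmulA (cmulA (P _)) tck_mulPP (negPf ref) cmul0 cmulr0.
Qed.

End ToeplitzRelations.

(** * Positive sesquilinear forms and the Cauchy-Schwarz inequality *)

Section PositiveForms.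
Variables (R : realType) (V : lmodType R[i]).
Implicit Types (x y z : V) (B : V -> V -> R[i]).

Definition positive_form B :=
  [/\ forall x k y z, B x (k *: y + z) = k * B x y + B x z,
      forall k x y z, B (k *: x + y) z = conjc k * B x z + B y z
    & forall x, 0 <= B x x].

Section Form.
Variable B : V -> V -> R[i].
Hypothesis BP : positive_form B.

Lemma positive_formE x : B x x = (complex.Re (B x x))%:C.
Proof. by case: BP => _ _ B0; rewrite RRe_real// ger0_real. Qed.

Lemma positive_form_expand x y (k : R[i]) :
  B (k *: y + x) (k *: y + x) =
  B x x + k * B x y + conjc k * B y x + conjc k * k * B y y.
Proof. by case: BP => Br Bl _; rewrite Br !Bl; ring. Qed.

(** Symmetry comes from positivity: the values at [y + x] and at [i y + x] are real, and their
    imaginary parts give two real equations for [B x y] and [B y x]. *)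
Lemma positive_form_herm x y : B y x = conjc (B x y).
Proof.
case: BP => _ _ B0.
have := B0 (1 *: y + x); have := B0 ('i%C *: y + x).
rewrite !positive_form_expand (positive_formE x) (positive_formE y).
case: (B x y) => a b; case: (B y x) => u v.
rewrite !lecE /= => /andP[/eqP h1 _] /andP[/eqP h2 _].
by apply/eqP; rewrite eq_complex /=; apply/andP; split; apply/eqP; lra.
Qed.

Lemma form_cauchy_schwarz x y :
  normc (B x y) ^+ 2 <= complex.Re (B x x) * complex.Re (B y y).
Proof.
case: BP => _ _ B0; set z := B x y.
(* The form at [x - t conj(z) y] is a real quadratic polynomial in [t]. *)
have H (t : R) : 0 <= complex.Re (B x x) - 2 * t * normc z ^+ 2 +
    t ^+ 2 * normc z ^+ 2 * complex.Re (B y y).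
  have := B0 ((- t%:C * conjc z) *: y + x).
  rewrite positive_form_expand (positive_form_herm x y) (positive_formE x).
  rewrite (positive_formE y) -/z.
  move: (complex.Re (B x x)) (complex.Re (B y y)) => p q.
  case: z => a b; rewrite lecE /= sqr_sqrtr; last by rewrite addr_ge0 ?sqr_ge0.
  by case/andP=> _; congr (_ <= _); ring.
move: H (B0 x) (B0 y); rewrite !lecE => + /andP[_ /=] + /andP[_ /=].
move: (complex.Re (B x x)) (complex.Re (B y y)) (normc z ^+ 2) (sqr_ge0 (normc z)).
move=> p q n n0 H p0 q0.
have [q00|q_neq] := eqVneq q 0.
  rewrite q00 mulr0 leNgt; apply/negP => np.
  (* For [q = 0] the polynomial is affine, and at this [t] its value is [- p - 2 < 0]. *)
  have := H ((p + 1) / n); rewrite q00 mulr0 addr0.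
  rewrite -mulrA divfK ?gt_eqF//; lra.
(* The minimum of the polynomial is at [t = 1 / q]. *)
have := H q^-1.
have -> : p - 2 * q^-1 * n + q^-1 ^+ 2 * n * q = p - n / q by field.
have qp : 0 < q by rewrite lt_def q_neq.
by rewrite subr_ge0 ler_pdivrMr.
Qed.

End Form.
End PositiveForms.

(** * Positive functionals and states *)

Section PositiveFunctionals.
Variables (R : realType) (A : cstarType R).
Implicit Types (a b : A) (psi : A -> R[i]).

Definition positive_functional psi :=
  scalar psi /\ forall a, 0 <= psi (star a ** a).

Section Scalar.
Variable psi : A -> R[i].
Hypothesis psiL : scalar psi.

Lemma functionalD a b : psi (a + b) = psi a + psi b.
Proof. by have := psiL 1 a b; rewrite scale1r /= mul1r. Qed.

Lemma functional0 : psi 0 = 0.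
Proof. by apply: (@addrI _ (psi 0)); rewrite -functionalD !addr0. Qed.

Lemma functionalZ (k : R[i]) a : psi (k *: a) = k * psi a.
Proof. by have := psiL k a 0; rewrite functional0 !addr0. Qed.

Lemma functionalN a : psi (- a) = - psi a.
Proof. by rewrite -scaleN1r functionalZ mulN1r. Qed.

Lemma functionalB a b : psi (a - b) = psi a - psi b.
Proof. by rewrite functionalD functionalN. Qed.

Lemma functional_sum (I : Type) (r : seq I) (Q : pred I) (F : I -> A) :
  psi (\sum_(i <- r | Q i) F i) = \sum_(i <- r | Q i) psi (F i).
Proof. exact: (big_morph _ functionalD functional0). Qed.

End Scalar.

Section CauchySchwarz.
Variable psi : A -> R[i].
Hypothesis psiP : positive_functional psi.

Let B a b := psi (star a ** b).

Let BP : positive_form B.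
Proof.
rewrite /B; split=> [a k b c|k a b c|]; last exact: psiP.2.
  by rewrite cmulDr cmulZr psiP.1.
by rewrite starD starZc cmulDl cmulZl psiP.1.
Qed.

Lemma functional_ge0E a : psi (star a ** a) = (complex.Re (psi (star a ** a)))%:C.
Proof. exact: (positive_formE BP). Qed.

Lemma cauchy_schwarz a b : normc (psi (star a ** b)) ^+ 2 <=
  complex.Re (psi (star a ** a)) * complex.Re (psi (star b ** b)).
Proof. exact: (form_cauchy_schwarz BP). Qed.

End CauchySchwarz.

Section Unital.
Variable e : A.
Hypothesis eP : forall a, e ** a = a /\ a ** e = a.

Lemma star_unit : star e = e.
Proof.
have [_ h] := eP (star e).
by rewrite -[in RHS](starK e) -[in RHS]h starM starK h.
Qed.

Lemma rnorm_unit : rnorm e <= 1.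
Proof.
have := rnorm_id e; rewrite star_unit (eP e).1 expr2 => h.
have [->|e0] := eqVneq (rnorm e) 0; first by rewrite ler01.
have ep : 0 < rnorm e by rewrite lt_def e0 rnorm_ge0.
by rewrite -(ler_pM2r ep) mul1r -h.
Qed.

Variable psi : A -> R[i].
Hypothesis psiP : positive_functional psi.
Let M := complex.Re (psi e).

Lemma functional_unitE : psi e = M%:C.
Proof. by have := functional_ge0E psiP e; rewrite star_unit (eP e).1. Qed.

Lemma functional_unit_ge0 : 0 <= M.
Proof. by have := psiP.2 e; rewrite star_unit (eP e).1 functional_unitE ler0c. Qed.

(** The square root of [e - star a ** a] is [e - y], and [psi] is nonnegative on its square, which
    equals [e - star a ** a]. *)
Lemma functional_sqr_le a : rnorm a < 1 ->
  complex.Re (psi (star a ** a)) <= M.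
Proof.
move=> a1; have [||y [ys yh _]] := @cstar_sqrt _ _ (star a ** a).
- by rewrite starM starK.
- by rewrite rnorm_id expr_lt1 ?rnorm_ge0.
have := psiP.2 (e - y); rewrite starB star_unit ys.
have -> : (e - y) ** (e - y) = e - star a ** a.
  rewrite -yh !(cmulBl, cmulBr) !(eP _).1 (eP y).2.
  by lin_goal (R[i] : nzRingType) (A : lmodType R[i]); ring.
rewrite (functionalB psiP.1) functional_unitE (functional_ge0E psiP a).
by rewrite -rmorphB /= ler0c subr_ge0.
Qed.

Lemma functional_bound a : normc (psi a) <= M * rnorm a.
Proof.
have h b : rnorm b < 1 -> normc (psi b) <= M.
  move=> b1; have := cauchy_schwarz psiP e b.
  rewrite star_unit !(eP _).1 -/M => cs.
  rewrite -(@ler_pXn2r _ 2)// ?nnegrE ?normc_ge0 ?functional_unit_ge0//.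
  rewrite (le_trans cs)// expr2 ler_wpM2l ?functional_unit_ge0//.
  exact: functional_sqr_le.
apply/ler_addgt0Pr => eps eps0.
(* Dividing [a] by [rnorm a + d] brings it strictly inside the unit ball; the cost in the bound is
   [M * d <= eps]. *)
pose d := eps / (M + 1).
have M1 : 0 < M + 1 by rewrite ltr_wpDl ?functional_unit_ge0.
have d0 : 0 < d by rewrite divr_gt0.
have r0 : 0 < rnorm a + d by rewrite ltr_wpDl ?rnorm_ge0.
have := h (((rnorm a + d)^-1)%:C *: a).
rewrite rnormZ (functionalZ psiP.1) Normc.normcM normcR gtr0_norm ?invr_gt0//.
rewrite mulrC ltr_pdivrMr// mul1r ltrDl => /(_ d0).
rewrite mulrC ler_pdivrMr// => /le_trans; apply.
rewrite mulrDr lerD2l /d mulrA ler_pdivrMr// mulrC ler_wpM2l// ?ltW//; lra.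
Qed.

Lemma functional_normE : functional_norm psi = M.
Proof.
have M0 := functional_unit_ge0.
have ub : ubound [set normc (psi a) | a in [set a : A | `|a| <= 1]] M.
  move=> _ [a /= a1 <-]; apply: le_trans (functional_bound a) _.
  by rewrite ler_piMr// -le_norm_rnorm.
have inM : [set normc (psi a) | a in [set a : A | `|a| <= 1]] M.
  exists e; first by rewrite /= (le_norm_rnorm e 1) rnorm_unit.
  by rewrite functional_unitE normcR ger0_norm.
apply/eqP; rewrite eq_le; apply/andP; split.
  by apply: ge_sup => //; exists M.
by apply: ub_le_sup => //; exists M.
Qed.

(** The supremum in [functional_norm] is attained at the unit, so being a state becomes a
    normalization that survives limits and quotients. *)
Lemma is_state_unit : is_state psi <-> psi e = 1.
Proof.
rewrite /is_state functional_normE functional_unitE; split.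
  by case=> _ _ ->.
by move=> [->]; split => //; case: psiP.
Qed.

End Unital.
End PositiveFunctionals.

(** * Limits of complex sequences *)

Section ComplexLimits.
Variable R : realType.
Implicit Types (u v : nat -> R[i]) (l k z w : R[i]).

Definition scvg u l :=
  forall e : R, 0 < e -> exists N, forall n, (N <= n)%N -> normc (u n - l) < e.

Lemma normcD z w : normc (z + w) <= normc z + normc w.
Proof. exact: le_normcD. Qed.

Lemma normcB z w : normc (z - w) <= normc z + normc w.
Proof. by rewrite -(normcN w) normcD. Qed.

Lemma normc_distC z w : normc (z - w) = normc (w - z).
Proof. by rewrite -normcN opprB. Qed.

Lemma normcX z n : normc (z ^+ n) = normc z ^+ n.
Proof.
elim: n => [|n IH]; first by rewrite !expr0 Normc.normc1.
by rewrite !exprS Normc.normcM IH.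
Qed.

Lemma normc_sum (I : Type) (r : seq I) (P : pred I) (F : I -> R[i]) :
  normc (\sum_(i <- r | P i) F i) <= \sum_(i <- r | P i) normc (F i).
Proof.
elim/big_rec2: _ => [|i x y _ xy]; first by rewrite Normc.normc0.
by rewrite (le_trans (normcD _ _))// lerD2l.
Qed.

Lemma Re_le_normc z : `|complex.Re z| <= normc z.
Proof.
by case: z => x y /=; rewrite -sqrtr_sqr ler_wsqrtr// lerDl sqr_ge0.
Qed.

Lemma Im_le_normc z : `|complex.Im z| <= normc z.
Proof.
by case: z => x y /=; rewrite -sqrtr_sqr ler_wsqrtr// lerDr sqr_ge0.
Qed.

Lemma normc_le_ReIm z : normc z <= `|complex.Re z| + `|complex.Im z|.
Proof.
rewrite {1}(complexE z) (le_trans (normcD _ _))// Normc.normcM !normcR.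
by rewrite lerD2l [normc 'i%C]/= expr0n expr1n add0r sqrtr1 mul1r.
Qed.

Lemma scvg_ReImP u l : scvg u l <->
  (fun n => complex.Re (u n)) @ \oo --> complex.Re l /\
  (fun n => complex.Im (u n)) @ \oo --> complex.Im l.
Proof.
split=> [ul|[/cvgrPdist_lt ur /cvgrPdist_lt ui] e e0].
  split; apply/cvgrPdist_lt => e /ul[N uN]; exists N => // n /= /uN;
    rewrite normc_distC; apply: le_lt_trans.
    by apply: le_trans (Re_le_normc _); case: l (u n) {ul uN} => ? ? [].
  by apply: le_trans (Im_le_normc _); case: l (u n) {ul uN} => ? ? [].
have e2 : 0 < e / 2 by rewrite divr_gt0.
have [[N1 _ uN1] [N2 _ uN2]] := (ur _ e2, ui _ e2).
exists (maxn N1 N2) => n; rewrite geq_max => /andP[/uN1 h1 /uN2 h2].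
rewrite normc_distC (le_lt_trans (normc_le_ReIm _))// (splitr e).
by move: h1 h2; case: l (u n) {ur ui uN1 uN2} => ? ? [? ?] /=; exact: ltrD.
Qed.

Lemma scvg_unique u l k : scvg u l -> scvg u k -> l = k.
Proof.
move=> /scvg_ReImP[lr li] /scvg_ReImP[kr ki].
apply/eqP; rewrite eq_complex (cvg_unique (@Rhausdorff R) lr kr).
by rewrite (cvg_unique (@Rhausdorff R) li ki) !eqxx.
Qed.

Lemma scvg_cst l : scvg (fun=> l) l.
Proof. by move=> e e0; exists 0%N => n _; rewrite subrr Normc.normc0. Qed.

Lemma scvgD u v l k : scvg u l -> scvg v k -> scvg (fun n => u n + v n) (l + k).
Proof.
move=> ul vk e e0; have e2 : 0 < e / 2 by rewrite divr_gt0.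
have [[N1 uN] [N2 vN]] := (ul _ e2, vk _ e2).
exists (maxn N1 N2) => n; rewrite geq_max => /andP[/uN h1 /vN h2].
by rewrite opprD addrACA (le_lt_trans (normcD _ _))// (splitr e) ltrD.
Qed.

Lemma complex_ReM z w : complex.Re (z * w) =
  complex.Re z * complex.Re w - complex.Im z * complex.Im w.
Proof. by case: z w => ? ? []. Qed.

Lemma complex_ImM z w : complex.Im (z * w) =
  complex.Re z * complex.Im w + complex.Im z * complex.Re w.
Proof. by case: z w => ? ? []. Qed.

Lemma scvgM u v l k : scvg u l -> scvg v k -> scvg (fun n => u n * v n) (l * k).
Proof.
move=> /scvg_ReImP[lr li] /scvg_ReImP[kr ki]; apply/scvg_ReImP.
rewrite complex_ReM complex_ImM; split.
  rewrite (_ : (fun n => _) = (fun n => complex.Re (u n) * complex.Re (v n)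
      - complex.Im (u n) * complex.Im (v n))).
    exact: (cvgB (cvgM lr kr) (cvgM li ki)).
  by apply/funext => n; rewrite complex_ReM.
rewrite (_ : (fun n => _) = (fun n => complex.Re (u n) * complex.Im (v n)
    + complex.Im (u n) * complex.Re (v n))).
  exact: (cvgD (cvgM lr ki) (cvgM li kr)).
by apply/funext => n; rewrite complex_ImM.
Qed.

Lemma scvg_dist0 u l (d : nat -> R) : d @ \oo --> (0 : R) ->
  (forall n, normc (u n - l) <= d n) -> scvg u l.
Proof.
move=> /cvgrPdist_lt d0 ud e /d0[N _ dN]; exists N => n /dN /=.
rewrite sub0r normrN; apply: le_lt_trans.
by rewrite (le_trans (ud n))// ler_norm.
Qed.

End ComplexLimits.

(** * The complex exponential and its power series *)

Section ComplexExponential.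
Variable R : realType.
Implicit Types z w : R[i].

Definition cexp z : R[i] := (expR (complex.Re z))%:C * expi (complex.Im z).

Lemma expiD (s t : R) : expi (s + t) = expi s * expi t.
Proof. by rewrite /expi sinD cosD; simpc; rewrite [sin s * _ + _]addrC. Qed.

Lemma expi0 : expi (0 : R) = 1.
Proof. by rewrite /expi cos0 sin0. Qed.

Lemma cexpD z w : cexp (z + w) = cexp z * cexp w.
Proof.
rewrite /cexp mulrACA -expiD -rmorphM /= -expRD.
by case: z w => ? ? [].
Qed.

Definition exp_partial (F : fieldType) (n : nat) (x : F) : F :=
  \sum_(j < n) x ^+ j / j`!%:R.

Lemma sum_triangle (V : nmodType) (N : nat) (F : nat -> nat -> V) :
  \sum_(n < N) \sum_(j < n.+1) F j (n - j)%N =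
  \sum_(j < N) \sum_(l < N - j) F j l.
Proof.
elim: N => [|N IH]; first by rewrite !big_ord0.
rewrite big_ord_recr IH /= [RHS]big_ord_recr /= subSnn big_ord1.
rewrite [X in _ + X]big_ord_recr /= subnn addrA; congr (_ + _).
rewrite -big_split /=; apply: eq_bigr => j _.
by rewrite subSn ?big_ord_recr// ltnW.
Qed.

(** The binomial theorem writes the truncated exponential of [x + y] as the sum over the triangle
    [j + l < N] inside the square [j, l < N]. What remains has nonnegative coefficients, so it can
    be dominated termwise by its value at the absolute values. *)
Lemma exp_partial_split (F : numFieldType) N (x y : F) :
  exp_partial N x * exp_partial N y - exp_partial N (x + y) =
  \sum_(j < N) \sum_(N - j <= l < N) (x ^+ j / j`!%:R) * (y ^+ l / l`!%:R).
Proof.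
have -> : exp_partial N (x + y) =
    \sum_(j < N) \sum_(l < N - j) (x ^+ j / j`!%:R) * (y ^+ l / l`!%:R).
  rewrite -(sum_triangle N (fun j l => (x ^+ j / j`!%:R) * (y ^+ l / l`!%:R))).
  apply: eq_bigr => n _; rewrite addrC exprDn mulr_suml.
  apply: eq_bigr => j _; rewrite mulrnAl -mulr_natr.
  have jn : (j <= n)%N by rewrite -ltnS.
  have f0 m : (m`!)%:R != 0 :> F by rewrite pnatr_eq0 -lt0n fact_gt0.
  rewrite -(bin_fact jn) !natrM.
  have b0 : 'C(n, j)%:R != 0 :> F by rewrite pnatr_eq0 -lt0n bin_gt0.
  by field; rewrite b0 !f0.
rewrite /exp_partial mulr_suml -sumrB; apply: eq_bigr => j _.
rewrite mulr_sumr -!(big_mkord xpredT (fun l => x ^+ j / j`!%:R * (y ^+ l / l`!%:R))).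
by rewrite (big_cat_nat _ (leq_subr j N))//= addrAC subrr add0r.
Qed.

Lemma exp_partial_dist N z w :
  normc (exp_partial N z * exp_partial N w - exp_partial N (z + w)) <=
  exp_partial N (normc z) * exp_partial N (normc w) -
  exp_partial N (normc z + normc w).
Proof.
rewrite !exp_partial_split (le_trans (normc_sum _ _ _))// ler_sum// => j _.
rewrite (le_trans (normc_sum _ _ _))// ler_sum// => l _.
rewrite !Normc.normcM !normcX !Normc.normcV.
by rewrite -2!(rmorph_nat (real_complex R)) !normcR !ger0_norm.
Qed.

Lemma cvg_exp_partial (x : R) : (fun n => exp_partial n x) @ \oo --> expR x.
Proof.
rewrite (_ : (fun n => _) = series (exp_coeff x)); first exact: is_cvg_series_exp_coeff.
by apply/funext => n; rewrite /series /= big_mkord.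
Qed.

Lemma sum_complex n (a b : nat -> R) :
  \sum_(j < n) (a j +i* b j) = (\sum_(j < n) a j) +i* (\sum_(j < n) b j).
Proof. by elim: n => [|n IH]; rewrite ?big_ord0// !big_ord_recr /= IH; simpc. Qed.

Lemma expr_i n : 'i%C ^+ n =
  ((~~ odd n)%:R * (-1) ^+ n./2) +i* ((odd n)%:R * (-1) ^+ n.-1./2) :> R[i].
Proof.
rewrite -{1}(odd_double_half n) exprD -mul2n exprM sqr_i.
have -> : (-1) ^+ n./2 = ((-1) ^+ n./2 : R)%:C :> R[i].
  by rewrite rmorphXn /= rmorphN1.
case: (boolP (odd n)) => on; last by rewrite expr0; simpc.
have -> : n.-1./2 = n./2 by rewrite -{1}(odd_double_half n) on /= doubleK.
by rewrite expr1; simpc.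
Qed.

Lemma scvg_expi (y : R) : scvg (fun n => exp_partial n (y *i)) (expi y).
Proof.
have E n : (y *i) ^+ n / n`!%:R = cos_coeff y n +i* sin_coeff y n :> R[i].
  have -> : y *i = y%:C * 'i%C by simpc.
  rewrite exprMn -rmorphXn /= expr_i -(rmorph_nat (real_complex R)) -fmorphV /=.
  rewrite /cos_coeff /sin_coeff /= -exprnP.
  move: (n`!%:R^-1) ((-1) ^+ n./2) ((-1) ^+ n.-1./2) => c a b.
  by apply/eqP; rewrite eq_complex /=; apply/andP; split; apply/eqP; ring.
have E2 n : exp_partial n (y *i) = series (cos_coeff y) n +i* series (sin_coeff y) n.
  rewrite /series /= !big_mkord -sum_complex; apply: eq_bigr => j _; exact: E.
apply/scvg_ReImP; split.
  rewrite (_ : (fun n => _) = series (cos_coeff y)).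
    by rewrite /expi /= unlock; exact: is_cvg_series_cos_coeff.
  by apply/funext => n; rewrite E2.
rewrite (_ : (fun n => _) = series (sin_coeff y)).
  by rewrite /expi /= unlock; exact: is_cvg_series_sin_coeff.
by apply/funext => n; rewrite E2.
Qed.

Lemma exp_partialC n (x : R) : exp_partial n x%:C = (exp_partial n x)%:C.
Proof.
rewrite /exp_partial rmorph_sum; apply: eq_bigr => j _ /=.
by rewrite rmorphM fmorphV rmorphXn rmorph_nat.
Qed.

Lemma scvg_realC (u : nat -> R) (l : R) : u @ \oo --> l ->
  scvg (fun n => (u n)%:C) l%:C.
Proof. by move=> ul; apply/scvg_ReImP; split => //; exact: cvg_cst. Qed.

(* The defect of multiplicativity of the truncated exponentials of [z] and [w]
   is dominated by that of [|z|] and [|w|], which tends to 0 by [expRD]. *)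
Lemma scvg_cexp z : scvg (fun n => exp_partial n z) (cexp z).
Proof.
case: z => x y; pose b := y *i.
have P := scvgM (scvg_realC (@cvg_exp_partial x)) (@scvg_expi y).
pose d n := exp_partial n (normc x%:C) * exp_partial n (normc b) -
  exp_partial n (normc x%:C + normc b).
have d0 : d @ \oo --> (0 : R).
  rewrite -(subrr (expR (normc x%:C + normc b))) {1}expRD.
  exact: (cvgB (cvgM (@cvg_exp_partial _) (@cvg_exp_partial _))
               (@cvg_exp_partial _)).
pose D n := exp_partial n (x +i* y) - exp_partial n x%:C * exp_partial n b.
have D0 : scvg D 0.
  apply: scvg_dist0 d0 _ => n.
  rewrite subr0 normc_distC; apply: le_trans (exp_partial_dist _ _ _).
  by rewrite (_ : x%:C + b = x +i* y)//; simpc.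
move=> e /(scvgD P D0)[N uN]; exists N => n /uN.
by rewrite addr0 /D exp_partialC (addrC (_ * _)) subrK.
Qed.

End ComplexExponential.

(** * The identity theorem for entire functions *)

Section IdentityTheorem.
Variable R : realType.
Implicit Types (c : nat -> R[i]) (z w : R[i]).

Definition power_sum c w n := \sum_(j < n) c j * w ^+ j.

Lemma power_sum_terms_bounded c w l : scvg (power_sum c w) l ->
  exists M : R, forall j, normc (c j) * normc w ^+ j <= M.
Proof.
move=> /(_ 1 ltr01)[N cN].
pose B j := normc (c j) * normc w ^+ j.
have B0 j : 0 <= B j by rewrite mulr_ge0 ?normc_ge0 ?exprn_ge0 ?normc_ge0.
exists (2 + \sum_(j < N) B j) => j; rewrite -/(B j).
have [Nj|jN] := leqP N j; last first.
  rewrite (bigD1 (Ordinal jN))//= ler_wpDl// lerDl sumr_ge0//.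
have -> : B j = normc (power_sum c w j.+1 - power_sum c w j).
  by rewrite /power_sum big_ord_recr /= addrAC subrr add0r Normc.normcM normcX.
apply: (@le_trans _ _ 2); last by rewrite lerDl sumr_ge0.
rewrite -(subrK l (power_sum c w j.+1)) -addrA (le_trans (normcD _ _))//.
rewrite (_ : 2 = 1 + 1)// lerD// ltW//; first by rewrite cN// leqW.
by rewrite normc_distC cN.
Qed.

(* If [c m] is the first nonzero coefficient, the tail is [O(|w|^(m+1))]. *)
Lemma power_sum_tail c (r M : R) m w n : 0 < r ->
  (forall j, normc (c j) * r ^+ j <= M) -> (forall j, (j < m)%N -> c j = 0) ->
  normc w <= r / 2 ->
  normc (power_sum c w (m.+1 + n)%N - c m * w ^+ m) <=
  2 * M * (normc w / r) ^+ m.+1.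
Proof.
move=> r0 cM c0 wr; set q := normc w / r.
have q0 : 0 <= q by rewrite divr_ge0 ?normc_ge0// ltW.
have q2 : q <= 2^-1 by rewrite ler_pdivrMr// mulrC.
have M0 : 0 <= M by apply: le_trans (cM 0%N); rewrite mulr_ge0 ?normc_ge0.
have -> : power_sum c w (m.+1 + n) - c m * w ^+ m =
    \sum_(j < n) c (m.+1 + j)%N * w ^+ (m.+1 + j).
  rewrite /power_sum big_split_ord /= big_ord_recr /= big1; last first.
    by move=> j _; rewrite c0 ?mul0r.
  by rewrite add0r addrAC subrr add0r.
have term j : normc (c j * w ^+ j) <= M * q ^+ j.
  rewrite Normc.normcM normcX -[normc w](divfK (lt0r_neq0 r0)) exprMn mulrCA.
  by rewrite mulrC ler_wpM2r ?exprn_ge0.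
(* The factor [1 - 2^(- n)] leaves room for the next term: since [q <= 1/2], that term is at most
   [M q^(m+1) 2^(- n)], exactly the growth of the right-hand side. *)
suff : normc (\sum_(j < n) c (m.+1 + j)%N * w ^+ (m.+1 + j)) <=
    2 * M * q ^+ m.+1 * (1 - 2^-1 ^+ n).
  by move=> /le_trans; apply; rewrite ler_piMr ?mulr_ge0 ?exprn_ge0.
elim: n => [|n IH]; first by rewrite big_ord0 expr0 subrr mulr0 Normc.normc0.
rewrite big_ord_recr /= (le_trans (normcD _ _))//.
apply: le_trans (lerD IH (term _)) _.
have : q ^+ n <= 2^-1 ^+ n by rewrite lerXn2r ?nnegrE// invr_ge0.
have : 0 <= M * q ^+ m.+1 by rewrite mulr_ge0 ?exprn_ge0.
have -> : 2 * M * q ^+ m.+1 * (1 - 2^-1 ^+ n.+1) =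
    2 * M * q ^+ m.+1 * (1 - 2^-1 ^+ n) + M * q ^+ m.+1 * 2^-1 ^+ n.
  by rewrite (exprS 2^-1); field.
by rewrite exprD mulrA lerD2l => t0 /(ler_wpM2l t0).
Qed.

(** If the coefficients before [c m] vanish, then at a zero [w] of [g] the term [c m * w ^+ m] is
    cancelled by the tail. Hence [normc (c m) <= K * normc w], and [w] can be taken arbitrarily
    small and nonzero. *)
Lemma power_series_zero c (g : R[i] -> R[i]) (r : R) : 0 < r ->
  (forall w, normc w < r -> scvg (power_sum c w) (g w)) ->
  (forall d : R, 0 < d -> exists2 w, 0 < normc w < d & g w = 0) ->
  forall j, c j = 0.
Proof.
move=> r0 cg g0 j; have [m] := ubnP j; elim: m j => // m IH j.
rewrite ltnS leq_eqVlt => /orP[/eqP->|/IH//] {j}.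
have r2 : 0 < r / 2 by rewrite divr_gt0.
have [M cM] : exists M : R, forall j, normc (c j) * (r / 2) ^+ j <= M.
  have /cg/power_sum_terms_bounded : normc (r / 2)%:C < r.
    by rewrite normcR gtr0_norm//; lra.
  by rewrite normcR gtr0_norm.
have M0 : 0 <= M by apply: le_trans (cM 0%N); rewrite mulr_ge0 ?normc_ge0.
apply: Normc.eq0_normc; apply/eqP; rewrite eq_le normc_ge0 andbT.
apply/ler_addgt0Pr => e e0; rewrite add0r.
pose K := 2 * M * (2 / r) ^+ m.+1.
have K0 : 0 <= K by rewrite !mulr_ge0// exprn_ge0// divr_ge0// ltW.
(* The coefficients are controlled at radius [r / 2], and [power_sum_tail] needs half of that
   radius, hence [r / 4]. The other bound makes [K * normc w] at most [e]. *)
have [|w /andP[w0 wd] gw] := g0 (Num.min (r / 4) (e / (K + 1))).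
  by rewrite lt_min !divr_gt0// ltr_wpDl.
move: wd; rewrite lt_min => /andP[wr we].
have wm : 0 < normc w ^+ m by rewrite exprn_gt0.
have bound : normc (c m) * normc w ^+ m <= K * normc w ^+ m.+1.
  apply/ler_addgt0Pr => d d0.
  have /cg : normc w < r by lra.
  rewrite gw => /(_ d d0)[N pN].
  have := pN (m.+1 + N)%N (leq_addl _ _); rewrite subr0 => pN1.
  have wr2 : normc w <= r / 2 / 2 by lra.
  have := power_sum_tail N r2 cM IH wr2.
  have -> : 2 * M * (normc w / (r / 2)) ^+ m.+1 = K * normc w ^+ m.+1.
    rewrite /K -(mulrA (2 * M)) -exprMn; congr (_ * _ ^+ _); field.
    exact: lt0r_neq0.
  move=> tail; rewrite -normcX -Normc.normcM.
  rewrite -[c m * _](subrK (power_sum c w (m.+1 + N))) (le_trans (normcD _ _))//.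
  by apply: lerD; [rewrite normc_distC|exact: ltW].
rewrite -(ler_pM2r wm) (le_trans bound)// exprS mulrA ler_pM2r//.
move: we; rewrite ltr_pdivlMr ?ltr_wpDl// => we.
rewrite mulrC; have := normc_ge0 w; lra.
Qed.

Lemma power_series_zero_fun c (g : R[i] -> R[i]) (r : R) : 0 < r ->
  (forall w, normc w < r -> scvg (power_sum c w) (g w)) ->
  (forall d : R, 0 < d -> exists2 w, 0 < normc w < d & g w = 0) ->
  forall w, normc w < r -> g w = 0.
Proof.
move=> r0 cg g0 w wr; apply: scvg_unique (cg w wr) _.
have c0 := power_series_zero r0 cg g0.
move=> e e0; exists 0%N => n _; rewrite subr0 /power_sum big1 ?Normc.normc0//.
by move=> j _; rewrite c0 mul0r.
Qed.

Definition sanalytic (g : R[i] -> R[i]) := forall z0, exists (r : R) c, 0 < r /\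
  forall z, normc (z - z0) < r -> scvg (power_sum c (z - z0)) (g z).

Lemma sanalytic_zero (g : R[i] -> R[i]) z0 : sanalytic g ->
  (forall d : R, 0 < d -> exists2 w, 0 < normc (w - z0) < d & g w = 0) ->
  exists2 r : R, 0 < r & forall z, normc (z - z0) < r -> g z = 0.
Proof.
move=> /(_ z0)[r [c [r0 cg]]] g0; exists r => // z zr.
have := @power_series_zero_fun c (fun w => g (w + z0)) r r0 _ _ (z - z0) zr.
rewrite subrK; apply.
  by move=> w wr; have := cg (w + z0); rewrite addrK; exact.
by move=> d /g0[w wd gw]; exists (w - z0); rewrite ?subrK.
Qed.

(* The points of the segment from 0 to [z1] around which [g] vanishes form an
   open and closed subset. *)
Lemma identity_theorem (g : R[i] -> R[i]) : sanalytic g ->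
  (forall t : R, g t%:C = 0) -> forall z, g z = 0.
Proof.
move=> ga g0 z1; have [->|z10] := eqVneq z1 0; first exact: g0 0.
have nz : 0 < normc z1.
  rewrite lt_def normc_ge0 andbT; apply: contra z10 => /eqP h.
  by apply/eqP/Normc.eq0_normc.
pose Z (t : R) := exists2 r : R, 0 < r &
  forall z, normc (z - t%:C * z1) < r -> g z = 0.
have distZ (s t : R) : normc (t%:C * z1 - s%:C * z1) = `|t - s| * normc z1.
  by rewrite -mulrBl Normc.normcM -(rmorphB (real_complex R)) normcR.
(* The real zeros of [g] accumulate at 0. *)
have Z0 : Z 0.
  rewrite /Z mul0r; apply: sanalytic_zero => // d d0; exists (d / 2)%:C => //.
  rewrite subr0 normcR gtr0_norm ?divr_gt0//=; lra.
have Zopen (s : R) : Z s -> exists2 d : R, 0 < d & forall t, `|t - s| < d -> Z t.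
  move=> [r r0 gr]; exists (r / 2 / normc z1); first by rewrite !divr_gt0.
  move=> t ts; exists (r / 2); first by rewrite divr_gt0.
  move=> z zt; apply: gr; rewrite -(subrK (t%:C * z1) z) -addrA.
  rewrite (le_lt_trans (normcD _ _))// (splitr r) ltrD// distZ.
  by rewrite -ltr_pdivlMr.
have Zclosed (s : R) : (forall d : R, 0 < d -> exists2 t, 0 < `|t - s| < d & Z t) -> Z s.
  move=> sZ; apply: sanalytic_zero => // d d0.
  have [|t /andP[t0 td] [r r0 gr]] := sZ (d / normc z1); first by rewrite divr_gt0.
  exists (t%:C * z1).
    by rewrite distZ mulr_gt0//= -ltr_pdivlMr.
  by apply: gr; rewrite subrr Normc.normc0.
pose S := [set s : R | 0 <= s <= 1 /\ forall t, 0 <= t <= s -> Z t].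
have S0 : S 0.
  split; first by rewrite lexx ler01.
  by move=> t; rewrite -eq_le => /eqP <-.
have hS : has_sup S by split; [exists 0|exists 1 => s [/andP[]]].
pose s := sup S.
have s0 : 0 <= s by apply: ub_le_sup S0; case: hS.
have s1 : s <= 1 by apply: ge_sup; [exists 0|move=> t [/andP[]]].
have below (t : R) : 0 <= t -> t < s -> Z t.
  move=> t0 ts; have st0 : 0 < s - t by rewrite subr_gt0.
  have [u [_ uZ] tu] := sup_adherent st0 hS.
  by apply: uZ; rewrite t0 ltW//; move: tu; rewrite -/s; lra.
have Zs : Z s.
  have [->//|sn0] := eqVneq s 0.
  have sp : 0 < s by rewrite lt_def sn0.
  apply: Zclosed => d d0; exists (s - Num.min d s / 2).
    rewrite addrAC subrr add0r normrN gtr0_norm ?divr_gt0 ?lt_min ?d0//=.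
    by rewrite ltr_pdivrMr// gt_min ltr_pMr// ltr1n.
  have m0 : 0 < Num.min d s by rewrite lt_min d0.
  have ms : Num.min d s <= s by rewrite ge_min lexx orbT.
  by apply: below; lra.
have [d d0 dZ] := Zopen _ Zs.
have Sle (t : R) : t <= 1 -> 0 <= t < s + d -> S t.
  move=> t1 /andP[t0 td]; split; first by rewrite t0.
  move=> u /andP[u0 ut]; have [us|su] := ltP u s; first exact: below.
  by apply: dZ; rewrite ger0_norm ?subr_ge0//; lra.
have s_eq1 : s = 1.
  apply/eqP; rewrite eq_le s1 /= leNgt; apply/negP => slt1.
  have m0 : 0 < Num.min (d / 2) (1 - s) by rewrite lt_min divr_gt0// subr_gt0.
  have m1 : Num.min (d / 2) (1 - s) <= d / 2 by rewrite ge_min lexx.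
  have m2 : Num.min (d / 2) (1 - s) <= 1 - s by rewrite ge_min lexx orbT.
  have : S (s + Num.min (d / 2) (1 - s)) by apply: Sle; [lra|apply/andP; split; lra].
  by move=> /(ub_le_sup hS.2); rewrite -/s; lra.
have [r r0 gr] := Zs; apply: gr.
by rewrite s_eq1 mul1r subrr Normc.normc0.
Qed.
End IdentityTheorem.

(** * Homogeneous elements and analytic extensions *)

Section AnalyticElements.
Variables (R : realType) (A : cstarType R).
Implicit Types (a b : A) (alpha : R -> A -> A) (psi : A -> R[i]) (k t beta : R).

Definition homogeneous alpha k a := forall t, alpha t a = expi (k * t) *: a.

Lemma expi_expz t (n : int) : expi t ^ n = expi (n%:~R * t).
Proof.
have N m : expi t ^+ m = expi (m%:R * t).
  elim: m => [|m IH]; first by rewrite expr0 mul0r expi0.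
  by rewrite exprS IH -expiD -{1}(mul1r t) -mulrDl -natr1 addrC.
case: n => m; first by rewrite -exprnP N.
rewrite NegzE -exprnN N rmorphN mulNr; apply: mulr1_eq.
by rewrite -expiD subrr expi0.
Qed.

Lemma cexp_imag k t : cexp ('i%C * k%:C * t%:C) = expi (k * t).
Proof.
have -> : 'i%C * k%:C * t%:C = 0 +i* (k * t).
  by apply/eqP; rewrite eq_complex /=; apply/andP; split; apply/eqP; ring.
by rewrite /cexp /= expR0 mul1r.
Qed.

Lemma cexp_at_beta k beta :
  cexp ('i%C * k%:C * (0 +i* beta)) = (expR (- (k * beta)))%:C.
Proof.
have -> : 'i%C * k%:C * (0 +i* beta) = (- (k * beta)) +i* 0.
  by apply/eqP; rewrite eq_complex /=; apply/andP; split; apply/eqP; ring.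
by rewrite /cexp /= expi0 mulr1.
Qed.

Lemma homogeneous_extension alpha k a : homogeneous alpha k a ->
  analytic_extension alpha a (fun z => cexp ('i%C * k%:C * z) *: a).
Proof.
move=> ha; split; last by move=> t; rewrite cexp_imag ha.
move=> z0; pose c n : A := (cexp ('i%C * k%:C * z0) * (('i%C * k%:C) ^+ n / n`!%:R)) *: a.
exists 1, c; split=> // z _.
pose w := 'i%C * k%:C * (z - z0).
have E n : series (fun n => (z - z0) ^+ n *: c n) n =
    (cexp ('i%C * k%:C * z0) * exp_partial n w) *: a.
  rewrite /series /= big_mkord /exp_partial mulr_sumr scaler_suml.
  apply: eq_bigr => j _; rewrite /c scalerA /w [in RHS]exprMn; congr (_ *: _).
  by rewrite mulrCA; congr (_ * _); rewrite mulrCA mulrA.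
have -> : cexp ('i%C * k%:C * z) = cexp ('i%C * k%:C * z0) * cexp w.
  by rewrite -cexpD /w -mulrDr addrC subrK.
apply/cvg_rnormP => e e0.
pose M := rnorm a + 1.
have M0 : 0 < M by rewrite ltr_wpDl ?rnorm_ge0.
have [N wN] := scvgM (scvg_cst (cexp ('i%C * k%:C * z0))) (scvg_cexp w) (divr_gt0 e0 M0).
exists N => n /wN; rewrite E -scalerBl rnormZ ltr_pdivlMr// => h.
apply: le_lt_trans h; rewrite ler_wpM2l ?normc_ge0// /M lerDl//.
Qed.

Lemma homogeneous_analytic alpha k a : homogeneous alpha k a ->
  analytic_element alpha a.
Proof. by move=> /homogeneous_extension h; exists (fun z => cexp ('i%C * k%:C * z) *: a). Qed.

Lemma KMS_homogeneous alpha beta psi k l a b : KMS_state alpha beta psi ->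
  homogeneous alpha k a -> homogeneous alpha l b ->
  psi (a ** b) = (expR (- (k * beta)))%:C * psi (b ** a).
Proof.
move=> [[psiL _ _] K] ha hb; move: K; case: eqVneq => [->|_].
  by move=> [_ tr]; rewrite mulr0 oppr0 expR0 mul1r tr.
move=> /(_ a b _ (homogeneous_extension ha) (homogeneous_analytic hb)) ->.
by rewrite cexp_at_beta cmulZr (functionalZ psiL).
Qed.

(** For [beta = 0], invariance at time [pi / k] gives [psi a = - psi a]. Otherwise the KMS condition
    against the unit gives [psi a = e^(- k beta) psi a] with [k * beta != 0]. *)
Lemma KMS_degree0 alpha beta psi k a e : KMS_state alpha beta psi ->
  (forall b, e ** b = b /\ b ** e = b) -> homogeneous alpha 0 e ->
  homogeneous alpha k a -> k != 0 -> psi a = 0.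
Proof.
move=> psiK eP he ha k0; have [beta0|beta0] := eqVneq beta 0.
  move: psiK; rewrite /KMS_state beta0 eqxx => -[[psiL _ _] [inv _]].
  have := inv (pi / k) a; rewrite ha mulrCA divff// mulr1 (functionalZ psiL).
  rewrite /expi cospi sinpi => /eqP; rewrite -subr_eq0.
  have -> : ((-1 : R) +i* 0) * psi a - psi a = (- 2) * psi a.
    have -> : (-1 : R) +i* 0 = -1 by apply/eqP; rewrite eq_complex /= oppr0 !eqxx.
    ring.
  by rewrite mulf_eq0 oppr_eq0 pnatr_eq0 => /eqP.
have := KMS_homogeneous psiK ha he; rewrite (eP a).1 (eP a).2 => /eqP.
rewrite -subr_eq0 -{1}(mul1r (psi a)) -mulrBl mulf_eq0 => /orP[|/eqP//].
rewrite subr_eq0 => /eqP/esym/complexI/(congr1 (@ln R)).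
by rewrite expRK ln1 => /eqP; rewrite oppr_eq0 mulf_eq0 (negPf k0) (negPf beta0).
Qed.

Lemma sanalyticB (f g : R[i] -> R[i]) : sanalytic f -> sanalytic g ->
  sanalytic (fun z => f z - g z).
Proof.
move=> fa ga z0; have [r [c [r0 cf]]] := fa z0; have [s [d [s0 dg]]] := ga z0.
exists (Num.min r s), (fun n => c n - d n); split; first by rewrite lt_min r0.
move=> z; rewrite lt_min => /andP[/cf fz /dg gz].
have := scvgD fz (scvgM (scvg_cst (-1)) gz); rewrite mulN1r.
congr scvg; apply/funext => n; rewrite /power_sum mulr_sumr -big_split.
by apply: eq_bigr => j _ /=; ring.
Qed.

Lemma sanalytic_cexp (u v : R[i]) : sanalytic (fun z => cexp (u * z) * v).
Proof.
move=> z0; exists 1, (fun n => cexp (u * z0) * v * (u ^+ n / n`!%:R)); split=> // z _.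
have := scvgM (scvg_cst (cexp (u * z0) * v)) (scvg_cexp (u * (z - z0))).
have -> : cexp (u * z0) * v * cexp (u * (z - z0)) = cexp (u * z) * v.
  by rewrite mulrAC -cexpD -mulrDr addrC subrK.
congr scvg; apply/funext => n; rewrite /power_sum /exp_partial mulr_sumr.
by apply: eq_bigr => j _; rewrite exprMn; move: (_^-1) (u ^+ j) => p q; ring.
Qed.

Definition bounded_functional psi :=
  exists M : R, forall a, normc (psi a) <= M * rnorm a.

Lemma sanalytic_functional psi (f : R[i] -> A) : scalar psi ->
  bounded_functional psi -> analytic_on_C f -> sanalytic (fun z => psi (f z)).
Proof.
move=> psiL [M psiM] fa z0; have [r [c [r0 cf]]] := fa z0.
exists r, (fun n => psi (c n)); split => // z zr e e0.
have M1 : 0 < `|M| + 1 by rewrite ltr_wpDl.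
have /cf/cvg_rnormP/(_ _ (divr_gt0 e0 M1))[N cN] : `|z - z0| < r%:C.
  by rewrite normcE ltcR.
exists N => n /cN; rewrite ltr_pdivlMr// mulrC.
have -> : power_sum (fun n => psi (c n)) (z - z0) n =
    psi (series (fun n => (z - z0) ^+ n *: c n) n).
  rewrite /series /= big_mkord (functional_sum psiL); apply: eq_bigr => j _.
  by rewrite (functionalZ psiL) mulrC.
rewrite -(functionalB psiL); apply: le_lt_trans; apply: le_trans (psiM _) _.
by rewrite ler_wpM2r ?rnorm_ge0// (le_trans (ler_norm M))// lerDl.
Qed.

(* The entire function [z -> psi (b f(z))] is determined by its restriction
   [t -> psi (b alpha_t a)] to the real line. *)
Lemma KMS_from_homogeneous alpha beta psi k b : scalar psi ->
  bounded_functional psi ->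
  (forall a, psi (a ** b) = (expR (k * beta))%:C * psi (b ** a)) ->
  (forall t a, psi (b ** alpha t a) = expi (- (k * t)) * psi (b ** a)) ->
  forall a f, analytic_extension alpha a f ->
    psi (a ** b) = psi (b ** f (0 +i* beta)).
Proof.
move=> psiL [M psiM] tw inv a f [fa ft].
pose g z := psi (b ** f z) - cexp ('i%C * (- k)%:C * z) * psi (b ** a).
have g0 : forall z, g z = 0.
  apply: identity_theorem => [|t]; last first.
    by rewrite /g ft inv cexp_imag mulNr subrr.
  apply: sanalyticB; last exact: sanalytic_cexp.
  apply: (sanalytic_functional (psi := fun a => psi (b ** a))) fa.
    by move=> l x y; rewrite cmulDr cmulZr psiL.
  exists (`|M| * rnorm b) => x; apply: le_trans (psiM _) _.
  rewrite -mulrA; apply: (@le_trans _ _ (`|M| * rnorm (b ** x))).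
    by rewrite ler_wpM2r ?rnorm_ge0// ler_norm.
  by rewrite ler_wpM2l// rnormM.
have /eqP := g0 (0 +i* beta); rewrite subr_eq0 cexp_at_beta mulNr opprK => /eqP ->.
exact: tw.
Qed.

End AnalyticElements.

(** * Hilbert spaces and the C*-algebra of their bounded operators *)

Section HilbertSpaces.
Variable R : realType.

Record hilbert := Hilbert {
  hsort :> lmodType R[i];
  ip : hsort -> hsort -> R[i];
  ipP : positive_form ip;
  ip_eq0 : forall x, ip x x = 0 -> x = 0;
  hilbert_complete : forall u : nat -> hsort,
    (forall e : R, 0 < e -> exists N, forall m n, (N <= m)%N -> (N <= n)%N ->
       complex.Re (ip (u m - u n) (u m - u n)) < e) ->
    exists l, forall e : R, 0 < e -> exists N, forall n, (N <= n)%N ->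
       complex.Re (ip (u n - l) (u n - l)) < e }.

Variable H : hilbert.
Implicit Types (x y z : H) (f g : H -> H).

Lemma ipDr x y z : ip x (y + z) = ip x y + ip x z.
Proof. by case: (ipP H) => r _ _; rewrite -{1}(scale1r y) r mul1r. Qed.

Lemma ipDl x y z : ip (x + y) z = ip x z + ip y z.
Proof. case: (ipP H) => _ /(_ 1 x y z) + _; rewrite scale1r => ->.
by rewrite [X in X * _](conjc1 R) mul1r. Qed.

Lemma ip0r x : ip x (0 : H) = 0.
Proof. by apply: (@addrI _ (ip x 0)); rewrite -ipDr !addr0. Qed.

Lemma ip0l x : ip (0 : H) x = 0.
Proof. by apply: (@addrI _ (ip 0 x)); rewrite -ipDl !addr0. Qed.

Lemma ipZr k x y : ip x (k *: y) = k * ip x y.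
Proof. by case: (ipP H) => r _ _; rewrite -(addr0 (k *: y)) r ip0r addr0. Qed.

Lemma ipZl k x y : ip (k *: x) y = conjc k * ip x y.
Proof. by case: (ipP H) => _ l _; rewrite -(addr0 (k *: x)) l ip0l addr0. Qed.

Lemma ipNr x y : ip x (- y) = - ip x y.
Proof. by rewrite -scaleN1r ipZr mulN1r. Qed.

Lemma ipBr x y z : ip x (y - z) = ip x y - ip x z.
Proof. by rewrite ipDr ipNr. Qed.

Lemma ipBl x y z : ip (x - y) z = ip x z - ip y z.
Proof. by apply: (@addIr _ (ip y z)); rewrite -ipDl !subrK. Qed.

Lemma ipC x y : ip y x = conjc (ip x y).
Proof. exact: (positive_form_herm (ipP H)). Qed.

Lemma ip_ext y z : (forall x, ip x y = ip x z) -> y = z.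
Proof.
move=> yz; apply/eqP; rewrite -subr_eq0; apply/eqP/ip_eq0.
by rewrite ipBr yz subrr.
Qed.

Definition hnorm x : R := Num.sqrt (complex.Re (ip x x)).

Lemma ip_ge0 x : 0 <= complex.Re (ip x x).
Proof. by case: (ipP H) => _ _ /(_ x); rewrite (positive_formE (ipP H)) ler0c. Qed.

Lemma hnorm_ge0 x : 0 <= hnorm x. Proof. exact: sqrtr_ge0. Qed.

Lemma hnorm_sqr x : hnorm x ^+ 2 = complex.Re (ip x x).
Proof. by rewrite sqr_sqrtr ?ip_ge0. Qed.

Lemma hnorm_sqrE x : ip x x = (hnorm x ^+ 2)%:C.
Proof. by rewrite hnorm_sqr -(positive_formE (ipP H)). Qed.

Lemma hnorm0 : hnorm 0 = 0. Proof. by rewrite /hnorm ip0r sqrtr0. Qed.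

Lemma hnorm_eq0 x : hnorm x = 0 -> x = 0.
Proof. by move=> x0; apply: ip_eq0; rewrite hnorm_sqrE x0 expr0n. Qed.

Lemma ip_le x y : normc (ip x y) <= hnorm x * hnorm y.
Proof.
rewrite -(@ler_pXn2r _ 2)// ?nnegrE ?normc_ge0 ?mulr_ge0 ?hnorm_ge0//.
by rewrite exprMn !hnorm_sqr (form_cauchy_schwarz (ipP H)).
Qed.

Lemma normc_conjM (k : R[i]) : conjc k * k = (normc k ^+ 2)%:C.
Proof.
case: k => a b; rewrite /= sqr_sqrtr; last by rewrite addr_ge0 ?sqr_ge0.
by apply/eqP; rewrite eq_complex /=; apply/andP; split; apply/eqP; ring.
Qed.

Lemma hnormZ k x : hnorm (k *: x) = normc k * hnorm x.
Proof.
apply/eqP; rewrite -(eqrXn2 (n := 2))// ?mulr_ge0 ?hnorm_ge0 ?normc_ge0//.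
apply/eqP/complexI; rewrite -hnorm_sqrE ipZl ipZr mulrA normc_conjM.
by rewrite hnorm_sqrE -(rmorphM (real_complex R)) exprMn.
Qed.

Lemma hnormN x : hnorm (- x) = hnorm x.
Proof. by rewrite -scaleN1r hnormZ normcN Normc.normc1 mul1r. Qed.

Lemma hnormD x y : hnorm (x + y) <= hnorm x + hnorm y.
Proof.
rewrite -(@ler_pXn2r _ 2)// ?nnegrE ?addr_ge0 ?hnorm_ge0//.
rewrite hnorm_sqr ipDl !ipDr (ipC x y) !hnorm_sqrE.
have := Re_le_normc (ip x y); have := ip_le x y.
case: (ip x y) => a b /= h1; rewrite ler_norml => /andP[_ h2].
by rewrite sqrrD; lra.
Qed.

Lemma hnorm_distC x y : hnorm (x - y) = hnorm (y - x).
Proof. by rewrite -hnormN opprB. Qed.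

Lemma hcomplete (u : nat -> H) :
  (forall e : R, 0 < e -> exists N, forall m n, (N <= m)%N -> (N <= n)%N ->
     hnorm (u m - u n) < e) ->
  exists l, forall e : R, 0 < e -> exists N, forall n, (N <= n)%N ->
     hnorm (u n - l) < e.
Proof.
have lt (e : R) x : 0 < e -> (hnorm x < e) = (complex.Re (ip x x) < e ^+ 2).
  by move=> e0; rewrite -hnorm_sqr ltr_pXn2r ?nnegrE ?hnorm_ge0// ltW.
move=> uC; have [e e0|l ul] := @hilbert_complete H u.
  have s0 : 0 < Num.sqrt e by rewrite sqrtr_gt0.
  have [N uN] := uC _ s0; exists N => m n Nm Nn.
  by have := uN m n Nm Nn; rewrite lt// sqr_sqrtr// ltW.
exists l => e e0; have [|N uN] := ul (e ^+ 2); first by rewrite exprn_gt0.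
by exists N => n Nn; rewrite lt// uN.
Qed.

Definition adjoint f g := forall x y, ip (f x) y = ip x (g y).

Lemma adjoint_sym f g : adjoint f g -> adjoint g f.
Proof. by move=> fg x y; rewrite ipC -fg -ipC. Qed.

Lemma adjoint_linear f g : adjoint f g -> linear f.
Proof.
move=> /adjoint_sym fg k x y; apply: ip_ext => z.
by rewrite -fg !(ipDr, ipZr) !fg.
Qed.

Lemma adjoint_unique f g g' : adjoint f g -> adjoint f g' -> g = g'.
Proof.
by move=> fg fg'; apply/funext => y; apply: ip_ext => x; rewrite -fg fg'.
Qed.

Definition bounded_map f := exists M : R, forall x, hnorm (f x) <= M * hnorm x.

Lemma adjoint_bound f g (M : R) : adjoint f g -> 0 <= M ->
  (forall x, hnorm (f x) <= M * hnorm x) -> forall x, hnorm (g x) <= M * hnorm x.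
Proof.
move=> fg M0 fM x; have [->|gx0] := eqVneq (hnorm (g x)) 0.
  by rewrite mulr_ge0 ?hnorm_ge0.
have gxp : 0 < hnorm (g x) by rewrite lt_def gx0 hnorm_ge0.
rewrite -(ler_pM2r gxp) -expr2.
have -> : hnorm (g x) ^+ 2 = complex.Re (ip (f (g x)) x).
  by rewrite hnorm_sqr fg.
rewrite (le_trans (ler_norm _))// (le_trans (Re_le_normc _))//.
by rewrite (le_trans (ip_le _ _))// mulrAC ler_wpM2r ?hnorm_ge0.
Qed.

(** Possession of an adjoint is part of the definition: linearity follows from it by
    [adjoint_linear], and the involution is obtained by choosing the adjoint, which is unique. *)
Definition bop_pred : {pred (H -> H)} :=
  [pred f | `[< (exists g, adjoint f g) /\ bounded_map f >]].

Lemma bop_predP f : reflect ((exists g, adjoint f g) /\ bounded_map f) (f \in bop_pred).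
Proof. exact: asboolP. Qed.

Record bop := Bop { bop_fun :> H -> H; bop_funP : bop_fun \in bop_pred }.

HB.instance Definition _ := [isSub for bop_fun].
HB.instance Definition _ := [Choice of bop by <:].

Lemma bop_submod : submod_closed bop_pred.
Proof.
split=> [|k f f' /bop_predP[[g fg] [M fM]] /bop_predP[[g' fg'] [M' fM']]].
  apply/bop_predP; split; first by exists 0 => x y; rewrite ip0l ip0r.
  by exists 0 => x; rewrite hnorm0 mul0r.
apply/bop_predP; split.
  exists (conjc k *: g + g') => x y; rewrite ipDl ipZl ipDr ipZr.
  by rewrite fg fg'.
exists (normc k * M + M') => x; rewrite (le_trans (hnormD _ _))// hnormZ.
by rewrite mulrDl lerD// -mulrA ler_wpM2l ?normc_ge0.
Qed.

HB.instance Definition _ := GRing.isSubmodClosed.Build R[i] (H -> H) bop_pred bop_submod.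
HB.instance Definition _ := [SubChoice_isSubLmodule of bop by <:].

Implicit Types a b c : bop.

Lemma bop_ext a b : bop_fun a =1 bop_fun b -> a = b.
Proof. by move=> ab; apply/val_inj/funext. Qed.

Lemma bop_exists_adjoint a : exists g, adjoint a g.
Proof. by case: (bop_predP a (bop_funP a)). Qed.

Definition bop_adj_fun a : H -> H := projT1 (cid (bop_exists_adjoint a)).

Lemma bop_adj_funP a : adjoint a (bop_adj_fun a).
Proof. exact: projT2 (cid (bop_exists_adjoint a)). Qed.

Lemma bop_linear a : linear a.
Proof. exact: adjoint_linear (bop_adj_funP a). Qed.

Lemma bopD a x y : a (x + y) = a x + a y.
Proof. by have := bop_linear a 1 x y; rewrite !scale1r. Qed.

Lemma bop0 a : a 0 = 0.
Proof. by apply: (@addrI _ (a 0)); rewrite -bopD !addr0. Qed.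

Lemma bopZ a k x : a (k *: x) = k *: a x.
Proof. by have := bop_linear a k x 0; rewrite bop0 !addr0. Qed.

Definition opnorm a : R := sup [set hnorm (a x) | x in [set x : H | hnorm x <= 1]].

Lemma opnorm_sup a : has_sup [set hnorm (a x) | x in [set x : H | hnorm x <= 1]].
Proof.
split; first by exists (hnorm (a 0)), 0 => //=; rewrite hnorm0.
have [_ [M aM]] := bop_predP a (bop_funP a).
exists `|M| => _ [x /= x1 <-]; apply: le_trans (aM x) _.
apply: (@le_trans _ _ (`|M| * hnorm x)); first by rewrite ler_wpM2r ?hnorm_ge0// ler_norm.
by rewrite ler_piMr.
Qed.

Lemma opnorm_ge0 a : 0 <= opnorm a.
Proof.
apply: (@le_trans _ _ (hnorm (a 0))); first exact: hnorm_ge0.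
by apply: ub_le_sup; [case: (opnorm_sup a)|exists 0 => //=; rewrite hnorm0].
Qed.

Lemma le_opnorm a x : hnorm (a x) <= opnorm a * hnorm x.
Proof.
have [x0|xn0] := eqVneq (hnorm x) 0.
  by rewrite x0 mulr0 (hnorm_eq0 x0) bop0 hnorm0.
have xp : 0 < hnorm x by rewrite lt_def xn0 hnorm_ge0.
have xi : 0 <= (hnorm x)^-1 by rewrite invr_ge0 ltW.
have : hnorm (a (((hnorm x)^-1)%:C *: x)) <= opnorm a.
  apply: ub_le_sup; first by case: (opnorm_sup a).
  exists (((hnorm x)^-1)%:C *: x) => //=.
  by rewrite hnormZ normcR ger0_norm// mulVf.
by rewrite bopZ hnormZ normcR ger0_norm// mulrC ler_pdivrMr.
Qed.

Lemma opnorm_le a (M : R) : 0 <= M ->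
  (forall x, hnorm (a x) <= M * hnorm x) -> opnorm a <= M.
Proof.
move=> M0 aM; apply: ge_sup; first by case: (opnorm_sup a).
by move=> _ [x /= x1 <-]; rewrite (le_trans (aM x))// ler_piMr.
Qed.

Definition bop_norm a : R[i] := (opnorm a)%:C.

Lemma bop_normD a b : bop_norm (a + b) <= bop_norm a + bop_norm b.
Proof.
rewrite /bop_norm -(rmorphD (real_complex R)) lecR opnorm_le ?addr_ge0 ?opnorm_ge0// => x.
by rewrite mulrDl (le_trans (hnormD _ _))// lerD// le_opnorm.
Qed.

Lemma bop_normZ (k : R[i]) a : bop_norm (k *: a) = `|k| * bop_norm a.
Proof.
rewrite normcE /bop_norm -(rmorphM (real_complex R)); congr (_%:C).
have le l b : opnorm (l *: b) <= normc l * opnorm b.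
  apply: opnorm_le => [|x]; first by rewrite mulr_ge0 ?normc_ge0 ?opnorm_ge0.
  by rewrite [(l *: b) x]/(l *: b x) hnormZ -mulrA ler_wpM2l ?normc_ge0// le_opnorm.
apply/eqP; rewrite eq_le le /=.
have [->|k0] := eqVneq k 0; first by rewrite Normc.normc0 mul0r opnorm_ge0.
have nk : 0 < normc k.
  rewrite lt_def normc_ge0 andbT; apply: contra k0 => /eqP h.
  by apply/eqP/Normc.eq0_normc.
have := le k^-1 (k *: a); rewrite scalerA mulVf// scale1r Normc.normcV.
by rewrite ler_pdivlMl.
Qed.

Lemma bop_norm_eq0 a : bop_norm a = 0 -> a = 0.
Proof.
move=> /complexI a0; apply: bop_ext => x; apply: hnorm_eq0.
by apply/eqP; rewrite eq_le hnorm_ge0 andbT (le_trans (le_opnorm _ _))// a0 mul0r.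
Qed.

HB.instance Definition _ := Lmodule_isNormed.Build R[i] bop
  bop_normD bop_normZ bop_norm_eq0.

Lemma rnorm_bop a : rnorm a = opnorm a.
Proof. by []. Qed.

Lemma bop_complete (F : set_system bop) : ProperFilter F -> cauchy F -> cvg F.
Proof.
move=> FF /cauchyP FC.
pose d n : R := n.+1%:R^-1.
have d0 n : 0 < d n by rewrite invr_gt0.
have dC0 n : 0 < (d n)%:C :> R[i] by rewrite -[0]/(0%:C) ltcR.
have dsmall (e : R) : 0 < e -> exists N, forall n, (N <= n)%N -> d n < e.
  move=> e0; have [N _ Ne] := near_infty_natSinv_lt (PosNum e0).
  by exists N => n /Ne.
pose u n := projT1 (cid (FC _ (dC0 n))).
have uF n : F (ball (u n) (d n)%:C) := projT2 (cid (FC _ (dC0 n))).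
have ballE a b (e : R) : ball a e%:C b = (opnorm (a - b) < e) :> Prop.
  by rewrite -ball_normE /= lt_norm_rnorm.
have udist m n : opnorm (u m - u n) < d m + d n.
  have [b []] := filter_ex (filterI (uF m) (uF n)).
  rewrite !ballE => mb nb; have -> : u m - u n = (u m - b) - (u n - b).
    by rewrite opprB addrA subrK.
  by rewrite (le_lt_trans (rnormB (u m - b) (u n - b)))// ltrD.
have uC (e : R) : 0 < e -> exists N, forall m n, (N <= m)%N -> (N <= n)%N ->
    opnorm (u m - u n) < e.
  move=> e0; have [N dN] := dsmall (e / 2) (divr_gt0 e0 (ltr0Sn R 1)).
  exists N => m n Nm Nn; rewrite (lt_trans (udist m n))// (splitr e).
  by rewrite ltrD ?dN.
have [f fP] : {f : H -> H & forall x (e : R), 0 < e ->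
    exists N, forall n, (N <= n)%N -> hnorm (u n x - f x) < e}.
  apply: (@choice _ _ (fun x l => forall e : R, 0 < e ->
      exists N, forall n, (N <= n)%N -> hnorm (u n x - l) < e)) => x.
  apply: (@hcomplete (fun n => u n x)) => e e0.
  have x1 : 0 < hnorm x + 1 by rewrite ltr_wpDl ?hnorm_ge0.
  have [N uN] := uC _ (divr_gt0 e0 x1); exists N => m n Nm Nn.
  rewrite (le_lt_trans (le_opnorm (u m - u n) x))//.
  have := uN m n Nm Nn; rewrite ltr_pdivlMr//; apply: le_lt_trans.
  by rewrite ler_wpM2l ?opnorm_ge0// lerDl.
(* The adjoints of the [u n] satisfy the same Cauchy estimate, so they converge pointwise; their
   limit is the adjoint that membership of [f] in [bop_pred] requires. *)
have [g gP] : {g : H -> H & forall x (e : R), 0 < e ->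
    exists N, forall n, (N <= n)%N -> hnorm (bop_adj_fun (u n) x - g x) < e}.
  apply: (@choice _ _ (fun x l => forall e : R, 0 < e ->
      exists N, forall n, (N <= n)%N -> hnorm (bop_adj_fun (u n) x - l) < e)) => x.
  apply: (@hcomplete (fun n => bop_adj_fun (u n) x)) => e e0.
  have x1 : 0 < hnorm x + 1 by rewrite ltr_wpDl ?hnorm_ge0.
  have [N uN] := uC _ (divr_gt0 e0 x1); exists N => m n Nm Nn.
  have adj : adjoint (u m - u n) (fun y => bop_adj_fun (u m) y - bop_adj_fun (u n) y).
    move=> y z; rewrite ipBr -!bop_adj_funP.
    by rewrite [(u m - u n) y]/(u m y - u n y) ipBl.
  rewrite (le_lt_trans (adjoint_bound adj (opnorm_ge0 _) (le_opnorm _) x))//.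
  have := uN m n Nm Nn; rewrite ltr_pdivlMr//; apply: le_lt_trans.
  by rewrite ler_wpM2l ?opnorm_ge0// lerDl.
(* Letting the second index tend to infinity turns the Cauchy estimate into a distance to the
   pointwise limit, uniform on the unit ball. *)
have fu N (e : R) : 0 <= e -> (forall m n, (N <= m)%N -> (N <= n)%N ->
    opnorm (u m - u n) < e) ->
    forall n x, (N <= n)%N -> hnorm (u n x - f x) <= e * hnorm x.
  move=> e0 uN n x Nn; apply/ler_addgt0Pr => r r0.
  have [K fK] := fP x r r0.
  have h1 := fK (maxn N K) (leq_maxr _ _); have h2 := uN n (maxn N K) Nn (leq_maxl _ _).
  have -> : u n x - f x = (u n - u (maxn N K)) x + (u (maxn N K) x - f x).
    by rewrite [(u n - _) x]/(u n x - u (maxn N K) x) addrA subrK.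
  rewrite (le_trans (hnormD _ _))//; apply: lerD (ltW h1).
  by rewrite (le_trans (le_opnorm _ _))// ler_wpM2r ?hnorm_ge0// ltW.
have fbop : f \in bop_pred.
  apply/bop_predP; split.
    exists g => x y; apply: (@scvg_unique _ (fun n => ip (u n x) y)).
      move=> e e0; have y1 : 0 < hnorm y + 1 by rewrite ltr_wpDl ?hnorm_ge0.
      have [N fN] := fP x _ (divr_gt0 e0 y1); exists N => n /fN.
      rewrite ltr_pdivlMr//; apply: le_lt_trans.
      have -> : ip (u n x) y - ip (f x) y = ip (u n x - f x) y.
        by rewrite ipBl.
      by rewrite (le_trans (ip_le _ _))// ler_wpM2l ?hnorm_ge0// lerDl.
    move=> e e0; have x1 : 0 < hnorm x + 1 by rewrite ltr_wpDl ?hnorm_ge0.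
    have [N gN] := gP y _ (divr_gt0 e0 x1); exists N => n /gN.
    rewrite bop_adj_funP -ipBr ltr_pdivlMr//; apply: le_lt_trans.
    by rewrite (le_trans (ip_le _ _))// mulrC ler_wpM2l ?hnorm_ge0// lerDl.
  have [N uN] := uC 1 ltr01; exists (opnorm (u N) + 1) => x.
  have -> : f x = u N x - (u N x - f x) by rewrite opprB addrC subrK.
  rewrite (le_trans (hnormD _ _))// hnormN mulrDl lerD// ?le_opnorm//.
  exact: fu uN _ _ (leqnn _).
apply/cvg_ex; exists (Bop fbop); apply/cvg_ballP => e /gt0_realC[-> e0].
have [K dK] := dsmall _ (divr_gt0 e0 (ltr0Sn R 1)).
have [N uN] := uC _ (divr_gt0 e0 (ltr0Sn R 1)).
pose n := maxn N K; apply: filterS (uF n) => b; rewrite !ballE => nb.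
have -> : Bop fbop - b = (Bop fbop - u n) + (u n - b) by rewrite addrA subrK.
rewrite (le_lt_trans (rnormD (Bop fbop - u n) (u n - b)))// (splitr (complex.Re e)).
rewrite ler_ltD ?(lt_trans nb) ?dK ?leq_maxr// -/(opnorm _).
apply: opnorm_le => [|x]; first by rewrite ltW// divr_gt0.
rewrite [(Bop fbop - u n) x]/(f x - u n x) hnorm_distC.
by apply: fu uN _ _ _; rewrite ?leq_maxl// ltW// divr_gt0.
Qed.

HB.instance Definition _ := Uniform_isComplete.Build bop bop_complete.

Lemma bop_mul_subproof a b : (fun x => a (b x)) \in bop_pred.
Proof.
apply/bop_predP; split.
  exists (fun x => bop_adj_fun b (bop_adj_fun a x)) => x y.
  by rewrite !bop_adj_funP.
exists (opnorm a * opnorm b) => x; rewrite (le_trans (le_opnorm _ _))//.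
by rewrite -mulrA ler_wpM2l ?opnorm_ge0// le_opnorm.
Qed.

Lemma bop_star_subproof a : bop_adj_fun a \in bop_pred.
Proof.
apply/bop_predP; split; first by exists a; exact: adjoint_sym (bop_adj_funP a).
exists (opnorm a).
exact: adjoint_bound (bop_adj_funP a) (opnorm_ge0 a) (le_opnorm a).
Qed.

Definition bop_mul a b := Bop (bop_mul_subproof a b).
Definition bop_star a := Bop (bop_star_subproof a).

Lemma bop_starE a b : adjoint a b -> bop_star a = b.
Proof.
by move=> ab; apply: val_inj; apply: adjoint_unique (bop_adj_funP a) ab.
Qed.

Lemma bop_mulA : associative bop_mul.
Proof. by move=> a b c; exact: bop_ext. Qed.

Lemma bop_mulDl : left_distributive bop_mul +%R.
Proof. by move=> a b c; exact: bop_ext. Qed.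

Lemma bop_mulDr : right_distributive bop_mul +%R.
Proof. by move=> a b c; apply: bop_ext => x; exact: bopD. Qed.

Lemma bop_mulZl (k : R[i]) a b : bop_mul (k *: a) b = k *: bop_mul a b.
Proof. exact: bop_ext. Qed.

Lemma bop_mulZr (k : R[i]) a b : bop_mul a (k *: b) = k *: bop_mul a b.
Proof. by apply: bop_ext => x; exact: bopZ. Qed.

Lemma bop_starK : involutive bop_star.
Proof. by move=> a; apply: bop_starE; exact: adjoint_sym (bop_adj_funP a). Qed.

Lemma bop_starD : {morph bop_star : a b / a + b}.
Proof.
move=> a b; apply: bop_starE => x y.
by rewrite [(a + b) x]/(a x + b x) ipDl !bop_adj_funP -ipDr.
Qed.

Lemma bop_starZ (k : R[i]) a : bop_star (k *: a) = conjc k *: bop_star a.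
Proof.
apply: bop_starE => x y.
by rewrite [(k *: a) x]/(k *: a x) ipZl bop_adj_funP -ipZr.
Qed.

Lemma bop_starM a b : bop_star (bop_mul a b) = bop_mul (bop_star b) (bop_star a).
Proof. by apply: bop_starE => x y; rewrite /= !bop_adj_funP. Qed.

Lemma opnormM a b : opnorm (bop_mul a b) <= opnorm a * opnorm b.
Proof.
apply: opnorm_le => [|x]; first by rewrite mulr_ge0 ?opnorm_ge0.
rewrite (le_trans (le_opnorm a (b x)))// -mulrA.
by rewrite ler_wpM2l ?opnorm_ge0// le_opnorm.
Qed.

Lemma opnorm_star a : opnorm (bop_star a) <= opnorm a.
Proof.
apply: opnorm_le (opnorm_ge0 a) _.
exact: adjoint_bound (bop_adj_funP a) (opnorm_ge0 a) (le_opnorm a).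
Qed.

Lemma opnorm_id a : opnorm (bop_mul (bop_star a) a) = opnorm a ^+ 2.
Proof.
apply/eqP; rewrite eq_le; apply/andP; split.
  by rewrite (le_trans (opnormM _ _))// expr2 ler_wpM2r ?opnorm_ge0 ?opnorm_star.
set M := opnorm (bop_mul _ _); have M0 : 0 <= M by exact: opnorm_ge0.
rewrite -[M]sqr_sqrtr// lerXn2r ?nnegrE ?opnorm_ge0 ?sqrtr_ge0//.
apply: opnorm_le (sqrtr_ge0 _) _ => x.
rewrite -(@ler_pXn2r _ 2)// ?nnegrE ?mulr_ge0 ?hnorm_ge0 ?sqrtr_ge0//.
rewrite hnorm_sqr exprMn (sqr_sqrtr M0) bop_adj_funP.
rewrite (le_trans (ler_norm _))// (le_trans (Re_le_normc _))//.
rewrite (le_trans (ip_le _ _))// expr2 mulrA (mulrC (hnorm x)).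
rewrite ler_wpM2r ?hnorm_ge0//.
exact: le_opnorm (bop_mul (bop_star a) a) x.
Qed.

Lemma bop_norm_mul a b : `|bop_mul a b| <= `|a| * `|b|.
Proof. by rewrite !rnormE -(rmorphM (real_complex R)) lecR opnormM. Qed.

Lemma bop_norm_id a : `|bop_mul (bop_star a) a| = `|a| ^+ 2.
Proof. by rewrite !rnormE -(rmorphXn (real_complex R)) rnorm_bop opnorm_id. Qed.

HB.instance Definition _ := isCStar.Build R bop bop_mulA bop_mulDl bop_mulDr
  bop_mulZl bop_mulZr bop_starK bop_starD bop_starZ bop_starM
  bop_norm_mul bop_norm_id.

Lemma bop_linE (k : R[i]) a b x : (k *: a + b) x = k *: a x + b x.
Proof. by []. Qed.

Lemma bop_addE a b x : (a + b) x = a x + b x.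
Proof. by []. Qed.

End HilbertSpaces.

(** * Sums over words of bounded length *)

Section WordSums.
Variable X : finType.

(** The words that occur are those of length less than [N]. Splitting off the first letter makes one
    step of the recursion match one edge shift. *)
Fixpoint wsum (V : nmodType) (N : nat) (F : seq X -> V) : V :=
  if N is N'.+1 then F [::] + \sum_e wsum N' (fun m => F (e :: m)) else 0.

Lemma eq_wsum (V : nmodType) N (F G : seq X -> V) :
  F =1 G -> wsum N F = wsum N G.
Proof.
elim: N F G => //= N IH F G FG; rewrite FG; congr (_ + _).
by apply: eq_bigr => e _; apply: IH => m.
Qed.

Lemma wsum_morph (V W : nmodType) (phi : V -> W) N (F : seq X -> V) :
  phi 0 = 0 -> {morph phi : x y / x + y} ->
  phi (wsum N F) = wsum N (fun m => phi (F m)).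
Proof.
move=> phi0 phiD; elim: N F => //= N IH F; rewrite phiD (big_morph _ phiD phi0).
by congr (_ + _); apply: eq_bigr => e _; rewrite IH.
Qed.

Lemma wsumD (V : nmodType) N (F G : seq X -> V) :
  wsum N (fun m => F m + G m) = wsum N F + wsum N G.
Proof.
elim: N F G => /= [|N IH] F G; first by rewrite addr0.
rewrite addrACA -big_split; congr (_ + _).
by apply: eq_bigr => e _; rewrite IH.
Qed.

Lemma wsumZ (R : pzRingType) (V : lmodType R) (k : R) N (F : seq X -> V) :
  wsum N (fun m => k *: F m) = k *: wsum N F.
Proof.
by rewrite (wsum_morph (phi := fun v => k *: v)) ?scaler0// => x y; rewrite scalerDr.
Qed.

Lemma wsum_ge0 (R : numDomainType) N (F : seq X -> R) :
  (forall m, 0 <= F m) -> 0 <= wsum N F.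
Proof.
elim: N F => //= N IH F F0.
by rewrite addr_ge0// sumr_ge0// => e _; apply: IH.
Qed.

Lemma wsum_homo (R : numDomainType) N (F : seq X -> R) :
  (forall m, 0 <= F m) -> wsum N F <= wsum N.+1 F.
Proof.
elim: N F => [|N IH] F F0; first by rewrite wsum_ge0.
by rewrite lerD2l ler_sum// => e _; apply: IH.
Qed.

Lemma wsum_term (R : numDomainType) (F : seq X -> R) m :
  (forall m, 0 <= F m) -> F m <= wsum (size m).+1 F.
Proof.
elim: m F => [|e m IH] F F0 /=; first by rewrite lerDl sumr_ge0.
rewrite ler_wpDl// (bigD1 e)//= ler_wpDr ?sumr_ge0// => [f _|].
  by rewrite addr_ge0// sumr_ge0// => g _; rewrite wsum_ge0.
exact: (IH (fun m => F (e :: m))).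
Qed.

Lemma wsum0 (V : nmodType) N : wsum N (fun=> 0 : V) = 0.
Proof. by elim: N => //= N IH; rewrite add0r big1. Qed.

Lemma wsum_delta (V : nmodType) N m0 (c : V) : (size m0 < N)%N ->
  wsum N (fun m => if m == m0 then c else 0) = c.
Proof.
elim: m0 N => [|e m0 IH] [|N]//= mN.
  by rewrite big1 ?addr0// => e _; rewrite wsum0.
rewrite add0r (bigD1 e)//= big1 => [|f fe].
  rewrite addr0 (@eq_wsum _ N _ (fun m => if m == m0 then c else 0)) ?IH// => m.
  by rewrite eqseq_cons eqxx.
rewrite (@eq_wsum _ N _ (fun=> 0)) ?wsum0// => m.
by rewrite eqseq_cons (negPf fe).
Qed.

Lemma scvg_sum (R : realType) (I : Type) (r : seq I) (F : nat -> I -> R[i]) G :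
  (forall i, scvg (F^~ i) (G i)) ->
  scvg (fun n => \sum_(i <- r) F n i) (\sum_(i <- r) G i).
Proof.
move=> FG; elim: r => [|i r IH].
  rewrite big_nil (_ : (fun n => _) = fun=> 0); first exact: scvg_cst.
  by apply/funext => n; rewrite big_nil.
rewrite big_cons (_ : (fun n => _) = fun n => F n i + \sum_(j <- r) F n j).
  exact: scvgD.
by apply/funext => n; rewrite big_cons.
Qed.

Lemma scvg_wsum (R : realType) N (F : nat -> seq X -> R[i]) G :
  (forall m, scvg (F^~ m) (G m)) ->
  scvg (fun n => wsum N (F n)) (wsum N G).
Proof.
elim: N F G => [|N IH] F G FG /=; first exact: scvg_cst.
apply: scvgD => //; apply: (@scvg_sum _ _ _ (fun n e => wsum N (fun m => F n (e :: m)))) => e.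
by apply: (IH (fun n m => F n (e :: m))) => m.
Qed.

End WordSums.

(** * The Hilbert space of square-summable functions of a word and a vertex *)

Section SquareSummable.
Variables (R : realType) (X Y : finType).

Local Notation fn := (seq X -> Y -> R[i]).
Implicit Types f g h : fn.

Definition ipN N f g : R[i] := wsum N (fun m => \sum_y conjc (f m y) * g m y).

Lemma ipN_form N : positive_form (ipN N).
Proof.
split=> [f k g h|k f g h|f].
- rewrite /ipN -[k * _](wsumZ (V := R[i]^o) k) -wsumD; apply: eq_wsum => m.
  rewrite scaler_sumr -big_split; apply: eq_bigr => y _ /=.
  by rewrite mulrDr /GRing.scale /= mulrCA.
- rewrite /ipN -[conjc k * _](wsumZ (V := R[i]^o) (conjc k)) -wsumD; apply: eq_wsum => m.
  rewrite scaler_sumr -big_split; apply: eq_bigr => y _ /=.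
  by rewrite /GRing.scale /= rmorphD rmorphM mulrDl mulrA.
- by apply: wsum_ge0 => m; apply: sumr_ge0 => y _; rewrite mulrC mulcJ_ge0.
Qed.

Lemma ipNE N f : ipN N f f =
  (wsum N (fun m => \sum_y normc (f m y) ^+ 2))%:C.
Proof.
rewrite (wsum_morph _ _ (phi := real_complex R)) ?rmorph0//; last exact: rmorphD.
apply: eq_wsum => m; rewrite rmorph_sum; apply: eq_bigr => y _.
exact: normc_conjM.
Qed.

Lemma sum_sqr_ge0 f m : 0 <= \sum_y normc (f m y) ^+ 2.
Proof. by rewrite sumr_ge0// => y _; rewrite sqr_ge0. Qed.

Lemma Re_ipN_ge0 N f : 0 <= complex.Re (ipN N f f).
Proof. by rewrite ipNE wsum_ge0// => m; exact: sum_sqr_ge0. Qed.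

Lemma Re_ipN_homo f : {homo (fun N => complex.Re (ipN N f f)) : N M / (N <= M)%N >-> N <= M}.
Proof.
apply/nondecreasing_seqP => N; rewrite !ipNE.
by apply: wsum_homo => m; exact: sum_sqr_ge0.
Qed.

Lemma Re_ipN_coord f m y :
  normc (f m y) ^+ 2 <= complex.Re (ipN (size m).+1 f f).
Proof.
rewrite ipNE; apply: le_trans (wsum_term _ (sum_sqr_ge0 f)).
by rewrite (bigD1 y)//= lerDl sumr_ge0// => z _; rewrite sqr_ge0.
Qed.

(** This is the parallelogram law without the nonnegative term of [- k *: g + f]. *)
Lemma ipN_parallelogram N f g (k : R[i]) : normc k = 1 ->
  complex.Re (ipN N (k *: g + f) (k *: g + f)) <=
  2 * complex.Re (ipN N f f) + 2 * complex.Re (ipN N g g).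
Proof.
move=> k1; have := Re_ipN_ge0 N (- k *: g + f).
have F := ipN_form N; rewrite !(positive_form_expand F) (positive_form_herm F f g).
have kk : conjc k * k = 1 by rewrite normc_conjM k1 expr1n.
have kk' : conjc (- k) * - k = 1 by rewrite rmorphN mulrNN.
rewrite kk kk' !mul1r !raddfD /=.
case: k k1 {kk kk'} => a b _; case: (ipN N f g) => c d /=; lra.
Qed.

Definition l2_pred : {pred fn} :=
  [pred f | `[< exists M : R, forall N, complex.Re (ipN N f f) <= M >]].

Lemma l2_predP f :
  reflect (exists M : R, forall N, complex.Re (ipN N f f) <= M) (f \in l2_pred).
Proof. exact: asboolP. Qed.

Record l2 := L2 { l2_fun :> fn; l2_funP : l2_fun \in l2_pred }.

HB.instance Definition _ := [isSub for l2_fun].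
HB.instance Definition _ := [Choice of l2 by <:].

Lemma Re_ipNZ N f (k : R[i]) :
  complex.Re (ipN N (k *: f) (k *: f)) = normc k ^+ 2 * complex.Re (ipN N f f).
Proof.
have [r _ _] := ipN_form N.
have z0 h : ipN N h 0 = 0.
  by apply: (@addrI _ (ipN N h 0)); have := r h 1 0 0; rewrite scale1r mul1r !addr0.
have z1 h : ipN N 0 h = 0.
  by rewrite (positive_form_herm (ipN_form N)) z0 conjc0.
have := positive_form_expand (ipN_form N) 0 f k.
rewrite addr0 !z0 !z1 !mulr0 !add0r normc_conjM => ->.
by case: (ipN N f f) => a b; rewrite complex_ReM /= mul0r subr0.
Qed.

Lemma l2_submod : submod_closed l2_pred.
Proof.
split=> [|k f g /l2_predP[M fM] /l2_predP[K gK]].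
  apply/l2_predP; exists 0 => N.
  have := Re_ipNZ N (0 : fn) 0; rewrite scaler0 => ->.
  by rewrite Normc.normc0 expr0n mul0r.
apply/l2_predP; exists (2 * K + 2 * (normc k ^+ 2 * M)) => N.
have := ipN_parallelogram N g (k *: f) (Normc.normc1 R).
rewrite scale1r Re_ipNZ => /le_trans; apply.
by rewrite lerD// ler_wpM2l// ler_wpM2l// sqr_ge0.
Qed.

HB.instance Definition _ :=
  GRing.isSubmodClosed.Build R[i] fn l2_pred l2_submod.
HB.instance Definition _ := [SubChoice_isSubLmodule of l2 by <:].

Implicit Types u v w : l2.

Lemma ipN_cvg_sqr u : exists l, scvg (fun N => ipN N u u) l.
Proof.
have [M uM] := l2_predP _ (l2_funP u).
have /cvg_ex[/= l ul] : cvgn (fun N => complex.Re (ipN N u u)).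
  apply: nondecreasing_is_cvgn; first exact: Re_ipN_homo.
  by exists M => _ [N _ <-].
exists l%:C; have := scvg_realC ul.
by congr scvg; apply/funext => N; rewrite -(positive_formE (ipN_form N)).
Qed.

(** By polarization over [1, i, -1, -i], mixed products are combinations of squares, whose partial
    sums are monotone and bounded. *)
Lemma ipN_cvg u v : exists l, scvg (fun N => ipN N u v) l.
Proof.
have sq (k : R[i]) : exists l, scvg (fun N => conjc k * ipN N (k *: (v : fn) + u) (k *: (v : fn) + u)) l.
  have [l hl] := ipN_cvg_sqr (k *: v + u); exists (conjc k * l).
  exact: (scvgM (scvg_cst _) hl).
have [[l1 h1] [l2 h2]] := (sq 1, sq 'i%C).
have [[l3 h3] [l4 h4]] := (sq (- 1), sq (- 'i%C)).
exists (4^-1 * (l1 + l2 + l3 + l4)).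
have := scvgM (scvg_cst 4^-1) (scvgD (scvgD (scvgD h1 h2) h3) h4).
congr scvg; apply/funext => N.
rewrite !(positive_form_expand (ipN_form N)).
have -> : conjc ('i%C : R[i]) = - 'i%C by simpc.
have -> : conjc (- 'i%C : R[i]) = 'i%C by simpc.
have -> : conjc (- 1 : R[i]) = - 1.
  by apply/eqP; rewrite eq_complex /= !oppr0 !eqxx.
have -> : conjc (1 : R[i]) = 1 by exact: conjc1.
have ii : 'i%C * 'i%C = -1 :> R[i] by rewrite -expr2 sqr_i.
move: (ipN N u u) (ipN N u v) (ipN N v u) (ipN N v v) ('i%C : R[i]) ii => a b c d j jj.
have -> : 1 * (a + 1 * b + 1 * c + 1 * 1 * d) +
  - j * (a + j * b + - j * c + - j * j * d) +
  -1 * (a + -1 * b + -1 * c + -1 * -1 * d) +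
  j * (a + - j * b + j * c + j * - j * d) = 4 * b by ring: jj.
by rewrite mulKf// pnatr_eq0.
Qed.

Definition l2_ip u v : R[i] := projT1 (cid (ipN_cvg u v)).

Lemma l2_ipP u v : scvg (fun N => ipN N u v) (l2_ip u v).
Proof. exact: projT2 (cid (ipN_cvg u v)). Qed.

Lemma scvg_conj (a : nat -> R[i]) l : scvg a l ->
  scvg (fun n => conjc (a n)) (conjc l).
Proof. by move=> al e /al[N aN]; exists N => n /aN; rewrite -rmorphB normcJ. Qed.

Lemma scvg_le (a : nat -> R) (l e : R) K : scvg (fun n => (a n)%:C) l%:C ->
  (forall n, (K <= n)%N -> a n <= e) -> l <= e.
Proof.
move=> al ae; apply/ler_addgt0Pr => d /al[N aN].
have := aN (maxn N K) (leq_maxl _ _); rewrite -(rmorphB (real_complex R)) normcR.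
rewrite ltr_norml => /andP[h _]; have := ae (maxn N K) (leq_maxr _ _); lra.
Qed.

Lemma scvg_ge (a : nat -> R) (l e : R) K : scvg (fun n => (a n)%:C) l%:C ->
  (forall n, (K <= n)%N -> e <= a n) -> e <= l.
Proof.
move=> al ae; apply/ler_addgt0Pr => d /al[N aN].
have := aN (maxn N K) (leq_maxl _ _); rewrite -(rmorphB (real_complex R)) normcR.
rewrite ltr_norml => /andP[_ h]; have := ae (maxn N K) (leq_maxr _ _); lra.
Qed.

Lemma l2_ipE u :
  [/\ l2_ip u u = (complex.Re (l2_ip u u))%:C,
      forall N, complex.Re (ipN N u u) <= complex.Re (l2_ip u u)
    & forall M, (forall N, complex.Re (ipN N u u) <= M) ->
        complex.Re (l2_ip u u) <= M].
Proof.
have /scvg_ReImP[ur ui] := l2_ipP u u.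
have i0 : complex.Im (l2_ip u u) = 0.
  apply: (cvg_unique (@Rhausdorff R) ui).
  rewrite (_ : (fun n => _) = fun=> 0); first exact: cvg_cst.
  by apply/funext => N; rewrite (positive_formE (ipN_form N)).
have E : l2_ip u u = (complex.Re (l2_ip u u))%:C.
  by apply/eqP; rewrite eq_complex /= i0 !eqxx.
have hr : scvg (fun N => (complex.Re (ipN N u u))%:C) (complex.Re (l2_ip u u))%:C.
  exact: scvg_realC.
split=> // [N|M uM].
  by apply: (scvg_ge hr) => n; exact: Re_ipN_homo.
by apply: (@scvg_le _ _ _ 0 hr) => n _.
Qed.

Lemma l2_ip_form : positive_form l2_ip.
Proof.
split=> [u k v w|k u v w|u].
- apply: scvg_unique (l2_ipP _ _) _.
  have := scvgD (scvgM (scvg_cst k) (l2_ipP u v)) (l2_ipP u w).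
  by congr scvg; apply/funext => N; have [r _ _] := ipN_form N; rewrite -r.
- apply: scvg_unique (l2_ipP _ _) _.
  have := scvgD (scvgM (scvg_cst (conjc k)) (l2_ipP u w)) (l2_ipP v w).
  by congr scvg; apply/funext => N; have [_ l _] := ipN_form N; rewrite -l.
- have [-> h _] := l2_ipE u; rewrite ler0c.
  exact: le_trans (Re_ipN_ge0 0 u) (h 0%N).
Qed.

Lemma l2_coord u m y : normc (u m y) ^+ 2 <= complex.Re (l2_ip u u).
Proof.
by have [_ h _] := l2_ipE u; rewrite (le_trans (Re_ipN_coord _ _ _))// h.
Qed.

Lemma l2_ip_eq0 u : l2_ip u u = 0 -> u = 0.
Proof.
move=> u0; apply/val_inj/funext => m; apply/funext => y.
apply: Normc.eq0_normc; apply/eqP; rewrite -sqrf_eq0 eq_le sqr_ge0 andbT.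
by rewrite (le_trans (l2_coord u m y))// u0.
Qed.

Lemma real_complete (a : nat -> R) :
  (forall e : R, 0 < e -> exists N, forall m n, (N <= m)%N -> (N <= n)%N ->
     `|a m - a n| < e) -> exists l : R, a @ \oo --> l.
Proof.
move=> aC; suff : cvg (a @ \oo) by move=> ?; exists (lim (a @ \oo)).
apply: cauchy_cvg; apply: cauchy_exP => e /aC[N aN].
by exists (a N), N => // n /= Nn; rewrite -ball_normE /= aN.
Qed.

Lemma scvg_complete (a : nat -> R[i]) :
  (forall e : R, 0 < e -> exists N, forall m n, (N <= m)%N -> (N <= n)%N ->
     normc (a m - a n) < e) -> exists l, scvg a l.
Proof.
move=> aC.
have [x ax] : exists l : R, (fun n => complex.Re (a n)) @ \oo --> l.
  apply: real_complete => e /aC[N aN]; exists N => m n Nm Nn.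
  apply: le_lt_trans (aN m n Nm Nn); apply: le_trans (Re_le_normc _).
  by case: (a m) (a n) => ? ? [].
have [y ay] : exists l : R, (fun n => complex.Im (a n)) @ \oo --> l.
  apply: real_complete => e /aC[N aN]; exists N => m n Nm Nn.
  apply: le_lt_trans (aN m n Nm Nn); apply: le_trans (Im_le_normc _).
  by case: (a m) (a n) => ? ? [].
by exists (x +i* y); apply/scvg_ReImP.
Qed.

Lemma l2_complete (u : nat -> l2) :
  (forall e : R, 0 < e -> exists N, forall m n, (N <= m)%N -> (N <= n)%N ->
     complex.Re (l2_ip (u m - u n) (u m - u n)) < e) ->
  exists l : l2, forall e : R, 0 < e -> exists N, forall n, (N <= n)%N ->
     complex.Re (l2_ip (u n - l) (u n - l)) < e.
Proof.
move=> uC.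
have [f0 f0P] : {f : seq X * Y -> R[i] &
    forall p, scvg (fun n => u n p.1 p.2) (f p)}.
  apply: (@choice _ _ (fun p l => scvg (fun n => u n p.1 p.2) l)) => -[m y] /=.
  apply: scvg_complete => e e0; have [|N uN] := uC (e ^+ 2); first by rewrite exprn_gt0.
  exists N => i j Ni Nj; rewrite -(@ltr_pXn2r _ 2)// ?nnegrE ?normc_ge0 ?(ltW e0)//.
  exact: le_lt_trans (l2_coord (u i - u j) m y) (uN i j Ni Nj).
pose f : fn := fun m y => f0 (m, y).
have fP m y : scvg (fun n => u n m y) (f m y) by exact: f0P (m, y).
(* For fixed [N] the partial product involves finitely many coordinates, so it passes to the
   pointwise limit; the bound does not depend on [N]. *)
have bound (e : R) K n : 0 < e -> (K <= n)%N ->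
    (forall i j, (K <= i)%N -> (K <= j)%N ->
     complex.Re (l2_ip (u i - u j) (u i - u j)) < e) ->
    forall N, complex.Re (ipN N ((u n : fn) - f) ((u n : fn) - f)) <= e.
  move=> e0 Kn uK N.
  apply: (@scvg_le (fun j => complex.Re (ipN N (u n - u j) (u n - u j))) _ _ K).
    rewrite -(positive_formE (ipN_form N)).
    have : scvg (fun j => ipN N (u n - u j) (u n - u j)) (ipN N ((u n : fn) - f) ((u n : fn) - f)).
      apply: scvg_wsum => m; apply: scvg_sum => y.
      have d : scvg (fun j => (u n - u j) m y) (((u n : fn) - f) m y).
        have := scvgD (scvg_cst (u n m y)) (scvgM (scvg_cst (-1)) (fP m y)).
        by rewrite mulN1r; congr scvg; apply/funext => j; rewrite mulN1r.
      exact: scvgM (scvg_conj d) d.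
    by congr scvg; apply/funext => j; rewrite -(positive_formE (ipN_form N)).
  move=> j Kj; have [_ h _] := l2_ipE (u n - u j).
  exact: le_trans (h N) (ltW (uK n j Kn Kj)).
have [K0 uK0] := uC 1 ltr01.
have f2 : f \in l2_pred.
  have d2 : (u K0 : fn) - f \in l2_pred.
    by apply/l2_predP; exists 1; apply: (bound 1 K0 K0).
  have -> : f = -1 *: ((u K0 : fn) - f) + u K0 by rewrite scaleN1r opprB subrK.
  by have [_ h] := l2_submod; apply: h d2 (l2_funP (u K0)).
exists (L2 f2) => e e0; have [K uK] := uC (e / 2) (divr_gt0 e0 (ltr0Sn R 1)).
exists K => n Kn; have [_ _ h] := l2_ipE (u n - L2 f2).
apply: (@le_lt_trans _ _ (e / 2)); last by lra.
by apply: h; apply: (bound _ K) => //; rewrite divr_gt0.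
Qed.

Definition l2_space : hilbert R := Hilbert l2_ip_form l2_ip_eq0 l2_complete.

Lemma l2_linE (k : R[i]) u v m y : (k *: u + v) m y = k * u m y + v m y.
Proof. by []. Qed.

Lemma l2_addE u v m y : (u + v) m y = u m y + v m y.
Proof. by []. Qed.

End SquareSummable.

(** * Operators induced by maps of functions on words *)

Section L2Operators.
Variables (R : realType) (X Y : finType).
Local Notation fn := (seq X -> Y -> R[i]).
Local Notation H := (l2_space R X Y).
Implicit Types (T : fn -> fn) (f g : fn) (u v : l2 R X Y).

(** The right-hand side reaches one length further because removing an edge reads the value of the
    function at a word with one more letter. The offset [k] in [l2_adjoint] compensates the same
    effect. *)
Definition l2_contraction T := forall N f,
  complex.Re (ipN N (T f) (T f)) <= complex.Re (ipN N.+1 f f).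

Lemma l2_map_subproof T u : l2_contraction T -> T u \in @l2_pred R X Y.
Proof.
move=> cT; have [M uM] := l2_predP _ (l2_funP u).
by apply/l2_predP; exists M => N; exact: le_trans (cT N u) (uM _).
Qed.

Definition l2_map T (cT : l2_contraction T) (u : H) : H := L2 (l2_map_subproof u cT).

Lemma l2_map_le T (cT : l2_contraction T) (u : H) :
  hnorm (l2_map cT u) <= 1 * hnorm u.
Proof.
rewrite mul1r ler_wsqrtr//=.
have [_ _ h] := l2_ipE (l2_map cT u); apply: h => N.
by apply: le_trans (cT N u) _; have [_ h _] := l2_ipE u.
Qed.

Lemma l2_map_bop T T' (cT : l2_contraction T) (cT' : l2_contraction T') :
  adjoint (l2_map cT) (l2_map cT') -> l2_map cT \in @bop_pred R H.
Proof.
move=> TT'; apply/bop_predP; split; first by exists (l2_map cT').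
by exists 1 => u; exact: l2_map_le.
Qed.

Lemma l2_adjoint T T' (cT : l2_contraction T) (cT' : l2_contraction T') (k : nat) :
  (forall N f g, ipN (k + N) (T f) g = ipN N f (T' g)) ->
  adjoint (l2_map cT) (l2_map cT').
Proof.
move=> TT' u v; apply: scvg_unique (l2_ipP u (l2_map cT' v)).
move=> e e0; have [N uN] := @l2_ipP _ _ _ (l2_map cT u) v e e0.
by exists N => n Nn; rewrite -TT' uN// (leq_trans Nn)// leq_addl.
Qed.

End L2Operators.

Lemma conjc0_mul (R : realType) (z : R[i]) : conjc 0 * z = 0.
Proof. by rewrite conjc0 mul0r. Qed.

Lemma morph_subr_sum (U V : zmodType) (f : U -> V) :
  {morph f : x y / x + y} -> forall (I : Type) x (r : seq I) (P : pred I) (F : I -> U),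
  f (x - \sum_(i <- r | P i) F i) = f x - \sum_(i <- r | P i) f (F i).
Proof.
move=> fD I x r P F; have f0 : f 0 = 0.
  by apply: (@addrI _ (f 0)); rewrite -fD !addr0.
by apply: (@addIr _ (f (\sum_(i <- r | P i) F i))); rewrite -fD (big_morph f fD f0) !subrK.
Qed.

(** * The Fock representation of the Toeplitz relations *)

Section FockRepresentation.
Variables (R : realType) (E : digraph).
Local Notation fn := (seq (edge E) -> vtx E -> R[i]).
Local Notation H := (l2_space R (edge E) (vtx E)).
Local Notation B := (bop H).
Implicit Types (f g : fn) (e : edge E) (v w : vtx E) (m : seq (edge E)).
Implicit Types (D : seq (edge E) -> vtx E -> bool).

(* The range of the word [m] read as a path of source [w]. *)
Definition word_rng m w : vtx E := if m is e :: _ then rng e else w.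

Definition diag_fun D f : fn := fun m w => if D m w then f m w else 0.

(** The creation operator of [e]: it puts [e] in front of a word. Only the junction between [e] and
    the word is tested; the restriction to paths enters later through [level_weight]. *)
Definition shift_fun e f : fn := fun m w =>
  if m is d :: m' then
    if (d == e) && (word_rng m' w == src e) then f m' w else 0
  else 0.

Definition unshift_fun e f : fn := fun m w =>
  if word_rng m w == src e then f (e :: m) w else 0.

Lemma ipN_shift N e f g :
  ipN N.+1 (shift_fun e f) g = ipN N f (unshift_fun e g).
Proof.
rewrite /ipN /= big1 => [|w _]; last exact: conjc0_mul.
rewrite add0r (bigD1 e)//= big1 ?addr0 => [|d de]; last first.
  rewrite -[RHS](@wsum0 (edge E) R[i] N); apply: eq_wsum => m.
  by rewrite big1// => w _; rewrite (negPf de); exact: conjc0_mul.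
apply: eq_wsum => m; apply: eq_bigr => w _; rewrite eqxx /unshift_fun /=.
by case: ifP => _; rewrite ?mulr0//; exact: conjc0_mul.
Qed.

Lemma ipN_diag N D f g : ipN N (diag_fun D f) g = ipN N f (diag_fun D g).
Proof.
apply: eq_wsum => m; apply: eq_bigr => w _; rewrite /diag_fun.
by case: ifP => _; rewrite ?mulr0//; exact: conjc0_mul.
Qed.

Lemma wsum_le (F G : seq (edge E) -> R) N : (forall m, F m <= G m) ->
  wsum N F <= wsum N G.
Proof.
elim: N F G => //= N IH F G FG.
by rewrite lerD// ler_sum// => e _; apply: IH.
Qed.

Lemma diag_contraction D : l2_contraction (diag_fun D).
Proof.
move=> N f; apply: le_trans (Re_ipN_homo f (leqnSn N)); rewrite !ipNE.
apply: wsum_le => m; apply: ler_sum => w _; rewrite /diag_fun.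
by case: ifP => _; rewrite ?Normc.normc0 ?expr0n ?sqr_ge0.
Qed.

Lemma unshift_contraction e : l2_contraction (unshift_fun e).
Proof.
move=> N f; rewrite !ipNE /= ler_wpDl ?sumr_ge0// => [w _|].
  by rewrite sqr_ge0.
rewrite (bigD1 e)//= ler_wpDr ?sumr_ge0// => [d _|].
  by apply: wsum_ge0 => m; exact: sum_sqr_ge0.
apply: wsum_le => m; apply: ler_sum => w _; rewrite /unshift_fun.
by case: ifP => _; rewrite ?Normc.normc0 ?expr0n ?sqr_ge0.
Qed.

Lemma unshiftK e f :
  unshift_fun e (shift_fun e f) = diag_fun (fun m w => word_rng m w == src e) f.
Proof.
apply/funext => m; apply/funext => w; rewrite /unshift_fun /shift_fun /diag_fun.
by rewrite eqxx /=; case: eqP.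
Qed.

Lemma shift_contraction e : l2_contraction (shift_fun e).
Proof.
move=> [|N] f; first by rewrite {1}/ipN /= Re_ipN_ge0.
rewrite ipN_shift unshiftK.
have -> : ipN N f (diag_fun (fun m w => word_rng m w == src e) f) =
    ipN N (diag_fun (fun m w => word_rng m w == src e) f)
          (diag_fun (fun m w => word_rng m w == src e) f).
  rewrite ipN_diag; congr ipN; apply/funext => m; apply/funext => w.
  by rewrite /diag_fun; case: eqP.
apply: le_trans (diag_contraction _ N f) _.
exact: Re_ipN_homo (leqnSn _).
Qed.

Lemma diag_adjoint D : adjoint (l2_map (diag_contraction D)) (l2_map (diag_contraction D)).
Proof. by apply: (@l2_adjoint _ _ _ _ _ _ _ 0%N) => N f g; exact: ipN_diag. Qed.

Lemma shift_adjoint e :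
  adjoint (l2_map (@shift_contraction e)) (l2_map (@unshift_contraction e)).
Proof. by apply: (@l2_adjoint _ _ _ _ _ _ _ 1%N) => N f g; exact: ipN_shift. Qed.

Definition diag_op D : B := Bop (l2_map_bop (diag_adjoint D)).
Definition shift_op e : B := Bop (l2_map_bop (shift_adjoint e)).
Definition unshift_op e : B := Bop (l2_map_bop (adjoint_sym (shift_adjoint e))).

Lemma star_diag_op D : star (diag_op D) = diag_op D.
Proof. exact: (@bop_starE _ _ (diag_op D) (diag_op D) (diag_adjoint D)). Qed.

Lemma star_shift_op e : star (shift_op e) = unshift_op e.
Proof. exact: (@bop_starE _ _ (shift_op e) (unshift_op e) (shift_adjoint e)). Qed.

Lemma fock_op_ext (a b : B) :
  (forall (u : H) m w, (a u : l2 R _ _) m w = (b u : l2 R _ _) m w) -> a = b.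
Proof.
move=> ab; apply: bop_ext => u; apply: val_inj; apply/funext => m.
by apply/funext => w; exact: ab.
Qed.

Lemma fock_evalD (u : H) m w :
  {morph (fun a : B => (a u : l2 R _ _) m w) : a b / a + b}.
Proof. by move=> a b; rewrite bop_addE; exact: l2_addE. Qed.

Lemma diag_opM D D' : diag_op D ** diag_op D' = diag_op (fun m w => D m w && D' m w).
Proof.
apply: fock_op_ext => u m w; rewrite /= /diag_fun.
by case: (D m w).
Qed.

Definition fock_P v : B := diag_op (fun m w => word_rng m w == v).
Definition fock_S e : B := shift_op e.

Lemma fock_range e : fock_S e ** star (fock_S e) =
  diag_op (fun m w => if m is d :: m' then (d == e) && (word_rng m' w == src e)
                      else false).
Proof.
rewrite star_shift_op; apply: fock_op_ext => u [|d m] w //=.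
rewrite /diag_fun /unshift_fun; case: eqVneq => //= -> {d}.
by case: eqP.
Qed.

Lemma fock_TCK : TCK_family fock_P fock_S.
Proof.
split.
- split=> [v|v w vw].
    split; last exact: star_diag_op.
    rewrite /fock_P diag_opM; congr diag_op; apply/funext => m.
    by apply/funext => w; rewrite andbb.
  apply: fock_op_ext => u m y; rewrite /= /diag_fun.
  by case: eqVneq => // ->; rewrite (negPf vw).
- move=> e; rewrite /partial_isometry star_shift_op.
  apply: fock_op_ext => u [|d m] w //=.
  by rewrite unshiftK /diag_fun; case: (d == e); case: (_ == src e).
- move=> e; rewrite star_shift_op.
  by apply: fock_op_ext => u m w; rewrite /= unshiftK.
(* The gap is the diagonal projection onto the pairs of range [v] that do not begin with a
   composable edge of [F]. Being self-adjoint and idempotent, it is its own witness of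
   positivity. *)
- move=> v F Fv; pose D m w := (word_rng m w == v) &&
    ~~ (if m is d :: m' then (d \in F) && (word_rng m' w == src d) else false).
  exists (diag_op D); rewrite star_diag_op diag_opM.
  apply: fock_op_ext => u m w.
  under eq_bigr do rewrite fock_range.
  apply: etrans (morph_subr_sum (@fock_evalD u m w) _ _ _ _) _.
  rewrite /= /diag_fun andbb {}/D.
  case: m => [|d m] /=; first by rewrite big1 ?subr0 ?andbT.
  have [dF|dF] := boolP (d \in F); last first.
    rewrite big1 ?subr0 ?andbT// => e eF; case: eqVneq => // de.
    by rewrite de eF in dF.
  rewrite (bigD1 d)//= eqxx big1 ?addr0 => [|e /andP[_ ed]]; last first.
    by rewrite eq_sym (negPf ed).
  rewrite (Fv d dF) eqxx /=.
  by case: (_ == src d); rewrite ?subrr ?subr0.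
Qed.

End FockRepresentation.

(** * Closed subspaces and their preimages *)

Section ClosedSubspaces.
Variables (R : realType) (A : cstarType R).
Implicit Types (a b x : A) (Q : set A).

Definition closed_subspace Q :=
  [/\ closed Q, Q 0 & forall (k : R[i]) a b, Q a -> Q b -> Q (k *: a + b)].

Lemma closed_preimage_lipschitz (h : A -> A) (M : R) Q :
  (forall a b, rnorm (h a - h b) <= M * rnorm (a - b)) ->
  closed Q -> closed (h @^-1` Q).
Proof.
move=> hM /closed_rnormP cQ; apply/closed_rnormP => a aQ; apply: cQ => e e0.
have M1 : 0 < `|M| + 1 by rewrite ltr_wpDl.
have [b Qb ab] := aQ _ (divr_gt0 e0 M1); exists (h b) => //.
move: ab; rewrite ltr_pdivlMr// mulrC; apply: le_lt_trans.
apply: le_trans (hM a b) _; rewrite ler_wpM2r ?rnorm_ge0//.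
by rewrite (le_trans (ler_norm M))// lerDl.
Qed.

(** The scalar [l] may differ from [k] so that the conjugate-linear [star] is covered together with
    multiplications. *)
Lemma closed_subspace_preimage (h : A -> A) (M : R) Q :
  (forall a b, rnorm (h a - h b) <= M * rnorm (a - b)) ->
  (forall k a b, exists l, h (k *: a + b) = l *: h a + h b) -> h 0 = 0 ->
  closed_subspace Q -> closed_subspace (h @^-1` Q).
Proof.
move=> hM hl h0 [cQ Q0 Ql]; split.
- exact: closed_preimage_lipschitz cQ.
- by rewrite /= h0.
- by move=> k a b /= Qa Qb; have [l ->] := hl k a b; exact: Ql.
Qed.

Lemma closed_subspace_mull g Q : closed_subspace Q ->
  closed_subspace [set a | Q (g ** a)].
Proof.
apply: (@closed_subspace_preimage (cmul g) (rnorm g)) => [a b|k a b|].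
- by rewrite -cmulBr rnormM.
- by exists k; rewrite cmulDr cmulZr.
- exact: cmulr0.
Qed.

Lemma closed_subspace_mulr g Q : closed_subspace Q ->
  closed_subspace [set a | Q (a ** g)].
Proof.
apply: (@closed_subspace_preimage (fun a => a ** g) (rnorm g)) => [a b|k a b|].
- by rewrite -cmulBl mulrC rnormM.
- by exists k; rewrite cmulDl cmulZl.
- exact: cmul0.
Qed.

Lemma closed_subspace_star Q : closed_subspace Q ->
  closed_subspace [set a | Q (star a)].
Proof.
apply: (@closed_subspace_preimage star 1) => [a b|k a b|].
- by rewrite -starB rnorm_star mul1r.
- by exists (conjc k); rewrite starD starZc.
- exact: star0.
Qed.

Lemma closed_subspace_bigI (I : Type) (D : set I) (Q : I -> set A) :
  (forall i, D i -> closed_subspace (Q i)) ->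
  closed_subspace [set a | forall i, D i -> Q i a].
Proof.
move=> QD; split=> [|i Di|k a b Qa Qb i Di].
- apply/closed_rnormP => a aQ i Di; have [/closed_rnormP cQ _ _] := QD i Di.
  by apply: cQ => e /aQ[b Qb ab]; exists b => //; exact: Qb.
- by have [] := QD i Di.
- by have [_ _ h] := QD i Di; apply: h; [exact: Qa|exact: Qb].
Qed.

Lemma closed_subspaceI Q Q' : closed_subspace Q -> closed_subspace Q' ->
  closed_subspace (Q `&` Q').
Proof.
move=> [c1 z1 l1] [c2 z2 l2]; split; [exact: closedI|by split|].
by move=> k a b [a1 a2] [b1 b2]; split; [exact: l1|exact: l2].
Qed.

Lemma closed_subspace_functional_eq (psi phi : A -> R[i]) : scalar psi -> scalar phi ->
  bounded_functional psi -> bounded_functional phi ->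
  closed_subspace [set a | psi a = phi a].
Proof.
move=> psiL phiL [M psiM] [K phiK]; split.
- apply/closed_rnormP => a aQ /=; apply/eqP; rewrite -subr_eq0; apply/eqP.
  apply: Normc.eq0_normc; apply/eqP; rewrite eq_le normc_ge0 andbT.
  apply/ler_addgt0Pr => e e0; rewrite add0r.
  have M1 : 0 < `|M| + `|K| + 1 by rewrite ltr_wpDl// addr_ge0.
  have [b /= bE ab] := aQ _ (divr_gt0 e0 M1).
  have -> : psi a - phi a = psi (a - b) - phi (a - b).
    by rewrite (functionalB psiL) (functionalB phiL) bE opprB addrA subrK.
  move: ab; rewrite ltr_pdivlMr// mulrC => /ltW; apply: le_trans.
  apply: le_trans (normcB _ _) _; apply: le_trans (lerD (psiM _) (phiK _)) _.
  rewrite -mulrDl ler_wpM2r ?rnorm_ge0//.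
  by have := ler_norm M; have := ler_norm K; lra.
- by rewrite /= (functional0 psiL) (functional0 phiL).
- by move=> k a b /= Ea Eb; rewrite psiL phiL Ea Eb.
Qed.

End ClosedSubspaces.

(** * The span of the word monomials *)

Section WordSpan.
Variables (R : realType) (E : digraph) (A : cstarType R).
Variables (P : vtx E -> A) (S : edge E -> A).
Hypothesis PS : TCK_family P S.
Implicit Types (m : seq (edge E)) (v w : vtx E) (e f : edge E).

(* [s_m p_w]; it is zero unless [m] is a path of source [w]. *)
Fixpoint word_elt m w : A := if m is e :: m' then S e ** word_elt m' w else P w.

Definition tck_one : A := \sum_v P v.

Lemma mulP_word v m w :
  P v ** word_elt m w = if v == word_rng m w then word_elt m w else 0.
Proof.
case: m => [|e m] /=; first by rewrite (tck_mulPP PS); case: eqVneq => [->|].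
by rewrite cmulA (tck_mulPS PS); case: ifP => //; rewrite cmul0.
Qed.

Lemma word_mulP m w v :
  word_elt m w ** P v = if w == v then word_elt m w else 0.
Proof.
elim: m => [|e m IH] /=; first by rewrite (tck_mulPP PS).
by rewrite -cmulA IH; case: ifP => //; rewrite cmulr0.
Qed.

Lemma word_mulS m w e :
  word_elt m w ** S e = if w == rng e then word_elt (rcons m e) (src e) else 0.
Proof.
elim: m => [|f m IH] /=.
  by rewrite (tck_mulPS PS) (tck_mulSP PS).
by rewrite -cmulA IH; case: ifP => //; rewrite cmulr0.
Qed.

Lemma starS_word e f m w : star (S e) ** word_elt (f :: m) w =
  if (e == f) && (src e == word_rng m w) then word_elt m w else 0.
Proof.
rewrite /= cmulA (tck_mul_starSS PS); case: eqVneq => _ /=; last by rewrite cmul0.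
exact: mulP_word.
Qed.

Lemma star_word m w : star (word_elt m w) = P w ** star (word_elt m w).
Proof. by rewrite -{1}(tck_starP PS w) -starM word_mulP eqxx. Qed.

Hypothesis gen : cstar_generated_by (range P `|` range S).

Lemma closed_cset1 : closed [set 0 : A].
Proof.
apply/closed_rnormP => a a0 /=; apply: rnorm_eq0; apply/eqP.
rewrite eq_le rnorm_ge0 andbT; apply/ler_addgt0Pr => e /a0[b /= -> ab].
by rewrite add0r -(subr0 a) ltW.
Qed.

Lemma tck_starone : star tck_one = tck_one.
Proof. by rewrite star_sum; apply: eq_bigr => v _; rewrite (tck_starP PS). Qed.

Lemma sum_delta (I : finType) (i : I) (F : I -> A) :
  \sum_j (if j == i then F j else 0) = F i.
Proof.
by rewrite (bigD1 i)//= eqxx big1 ?addr0// => j ji; rewrite (negPf ji).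
Qed.

(** The elements on which [tck_one] acts as a unit form a closed star-subalgebra containing the
    generators. *)
Lemma tck_oneP a : tck_one ** a = a /\ a ** tck_one = a.
Proof.
pose D : set A := [set a | tck_one ** a = a /\ a ** tck_one = a].
suff DT : D = setT by have : D a by rewrite DT.
apply: gen; last first.
  move=> _ [[v _ <-]|[e _ <-]]; split.
  - rewrite cmul_suml -[RHS](@sum_delta _ v P); apply: eq_bigr => w _.
    by rewrite (tck_mulPP PS).
  - rewrite cmul_sumr -[RHS](@sum_delta _ v P); apply: eq_bigr => w _.
    by rewrite (tck_mulPP PS) eq_sym; case: eqVneq => [->|].
  - rewrite cmul_suml -[RHS](@sum_delta _ (rng e) (fun=> S e)).
    by apply: eq_bigr => w _; rewrite (tck_mulPS PS).
  - rewrite cmul_sumr -[RHS](@sum_delta _ (src e) (fun=> S e)).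
    by apply: eq_bigr => w _; rewrite (tck_mulSP_neq PS).
split.
- have -> : D = (fun a => tck_one ** a - a) @^-1` [set 0] `&`
               (fun a => a ** tck_one - a) @^-1` [set 0].
    apply/seteqP; split=> x /=; first by move=> [-> ->]; rewrite !subrr.
    by move=> [/eqP + /eqP]; rewrite !subr_eq0 => /eqP ? /eqP.
  apply: closedI; apply: (@closed_preimage_lipschitz _ _ _ (rnorm tck_one + 1)).
  + move=> x y; have -> : tck_one ** x - x - (tck_one ** y - y) =
        tck_one ** (x - y) - (x - y).
      rewrite cmulBr; lin_goal (R[i] : nzRingType) (A : lmodType R[i]); ring.
    by rewrite mulrDl mul1r (le_trans (rnormB _ _))// lerD2r rnormM.
  + exact: closed_cset1.
  + move=> x y; have -> : x ** tck_one - x - (y ** tck_one - y) =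
        (x - y) ** tck_one - (x - y).
      rewrite cmulBl; lin_goal (R[i] : nzRingType) (A : lmodType R[i]); ring.
    by rewrite mulrDl mul1r (le_trans (rnormB _ _))// lerD2r mulrC rnormM.
  + exact: closed_cset1.
- by split; rewrite ?cmul0 ?cmulr0.
- move=> k x y [x1 x2] [y1 y2]; split.
    by rewrite cmulDr cmulZr x1 y1.
  by rewrite cmulDl cmulZl x2 y2.
- move=> x y [x1 x2] [y1 y2]; split; first by rewrite cmulA x1.
  by rewrite -cmulA y2.
- move=> x [x1 x2]; split; rewrite -{1}tck_starone -starM ?x1 ?x2//.
Qed.

(** This is density of the span of the monomials, in the form of an induction principle. The
    smallest closed subspace [D] containing them is stable under left multiplication by the
    generators and their adjoints, hence by everything; it contains the unit, so it is the whole
    algebra. *)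
Lemma word_span_ind (Q : set A) : closed_subspace Q ->
  (forall m w m' w', Q (word_elt m w ** star (word_elt m' w'))) ->
  forall a, Q a.
Proof.
move=> Qs Qw.
pose good (Q : set A) := closed_subspace Q /\
  forall m w m' w', Q (word_elt m w ** star (word_elt m' w')).
pose D := [set a | forall Q, good Q -> Q a].
have Ds : closed_subspace D.
  by apply: closed_subspace_bigI => Q' [].
have Dw m w m' w' : D (word_elt m w ** star (word_elt m' w')) by move=> Q' [_].
have D0 : D 0 by case: Ds.
have Dind (Q' : set A) : good Q' -> forall d, D d -> Q' d by move=> gQ d; exact.
have Dstar d : D d -> D (star d).
  apply: (Dind [set d | D (star d)]); split; first exact: closed_subspace_star.
  by move=> m w m' w' /=; rewrite starM starK.
have DP v d : D d -> D (P v ** d).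
  apply: (Dind [set d | D (P v ** d)]); split; first exact: closed_subspace_mull.
  by move=> m w m' w' /=; rewrite cmulA mulP_word; case: ifP => // _; rewrite cmul0.
have DS e d : D d -> D (S e ** d).
  apply: (Dind [set d | D (S e ** d)]); split; first exact: closed_subspace_mull.
  by move=> m w m' w' /=; rewrite cmulA; exact: (Dw (e :: m)).
have DsS e d : D d -> D (star (S e) ** d).
  apply: (Dind [set d | D (star (S e) ** d)]); split; first exact: closed_subspace_mull.
  move=> [|f m] w m' w'; rewrite /= cmulA; last first.
    by rewrite starS_word; case: ifP => // _; rewrite cmul0.
  (* When the left word is empty, the adjoint of [S e] is absorbed by the right factor, whose word
     gets [e] as its last letter. *)
  rewrite -(tck_starP PS w) -starM (tck_mulPS PS); case: ifP => _; last first.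
    by rewrite star0 cmul0.
  rewrite -starM word_mulS; case: ifP => _; last by rewrite star0.
  by rewrite star_word; exact: (Dw [::]).
suff L a d : D d -> D (a ** d).
  move=> a; apply: (Dind Q) => //; rewrite -(tck_oneP a).2; apply: L.
  rewrite /tck_one; elim/big_ind: _ => // [x y Dx Dy|v _].
    by have [_ _ h] := Ds; rewrite -(scale1r x); exact: h.
  by have := Dw [::] v [::] v; rewrite /= (tck_starP PS) (tck_mulPP PS) eqxx.
(* Multiplication by [star a] is included so that [L] is closed under the involution. *)
pose L := [set a | forall d, D d -> D (a ** d) /\ D (star a ** d)].
suff LT : L = setT by move=> Dd; have /(_ d Dd)[] : L a by rewrite LT.
have Ls : closed_subspace L.
  have -> : L = [set a | forall d, D d -> [set x | D (x ** d)] a] `&`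
                [set a | forall d, D d -> [set x | D (star x ** d)] a].
    apply/seteqP; split=> x /=; first by move=> h; split=> y /h[].
    by move=> [h1 h2] y Dy; split; [exact: h1|exact: h2].
  apply: closed_subspaceI; apply: closed_subspace_bigI => c Dc.
    exact: closed_subspace_mulr.
  by apply: (closed_subspace_star (Q := [set x | D (x ** c)])); exact: closed_subspace_mulr.
apply: gen; last first.
  move=> _ [[v _ <-]|[e _ <-]] x Dx; split; [exact: DP| |exact: DS|exact: DsS].
  by rewrite (tck_starP PS); exact: DP.
have [L1 L2 L3] := Ls; split => //.
- move=> x y Lx Ly z Dz; rewrite starM -!cmulA; split.
    by apply: (Lx _ _).1; apply: (Ly _ _).1.
  by apply: (Ly _ _).2; apply: (Lx _ _).2.
- by move=> x Lx y Dy; rewrite starK; split; [exact: (Lx _ _).2|exact: (Lx _ _).1].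
Qed.

End WordSpan.

(** * Words with a source vertex and paths *)

Section WordsAndPaths.
Variables (R : realType) (E : digraph).
Implicit Types (m : seq (edge E)) (v w : vtx E) (e f : edge E) (mu nu : gpath E).

(** Here a path is recorded by its edges and its source, while [gpath] stores the range: the element
    [word_elt m w] ends with the vertex projection of the source. *)
Fixpoint word_path m w : bool :=
  if m is e :: m' then (word_rng m' w == src e) && word_path m' w else true.

Lemma path_from_word v m : path_from v m ->
  word_rng m (last v (map (@src E) m)) = v /\
  word_path m (last v (map (@src E) m)).
Proof.
elim: m v => [|e m IH] v //= /andP[/eqP ev /IH[r p]].
by split=> //; rewrite r eqxx p.
Qed.

Lemma word_path_from m w : word_path m w -> path_from (word_rng m w) m /\
  last (word_rng m w) (map (@src E) m) = w.
Proof.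
elim: m => [|e m IH] //= /andP[/eqP er /IH[pm lm]].
by rewrite eqxx -{1}er pm; split=> //; rewrite -[in RHS]lm -er; case: (m) lm => //=.
Qed.

Definition gpath_of_word m w (mw : word_path m w) : gpath E :=
  @GPath E (word_rng m w, m) (word_path_from mw).1.

Lemma psrc_gpath_of_word m w (mw : word_path m w) : psrc (gpath_of_word mw) = w.
Proof. exact: (word_path_from mw).2. Qed.

Lemma gpath_word_path mu : word_path (pedges mu) (psrc mu).
Proof. by have [] := path_from_word (gpathP mu). Qed.

Lemma gpath_eqE mu nu :
  (mu == nu) = (pedges mu == pedges nu) && (psrc mu == psrc nu).
Proof.
apply/eqP/andP => [->|[/eqP em /eqP es]]; first by rewrite !eqxx.
apply: val_inj; rewrite [LHS]surjective_pairing [RHS]surjective_pairing.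
congr (_, _) => //.
have [<- _] := path_from_word (gpathP mu); have [<- _] := path_from_word (gpathP nu).
by rewrite -[(val mu).2]/(pedges mu) -[(val nu).2]/(pedges nu) -/(psrc mu) -/(psrc nu) em es.
Qed.

Section Elements.
Variables (A : cstarType R) (P : vtx E -> A) (S : edge E -> A).
Hypothesis PS : TCK_family P S.

Lemma s_path_word mu : s_path P S mu = word_elt P S (pedges mu) (psrc mu).
Proof.
rewrite /s_path /psrc; case: (pedges mu) => //= e m.
elim: m e => [|f m IH] e /=; first by rewrite (tck_mulSP PS).
by rewrite IH.
Qed.

Lemma word_elt_eq0 m w : ~~ word_path m w -> word_elt P S m w = 0.
Proof.
elim: m => [|e m IH] //=; rewrite negb_and => /orP[er|/IH->]; last exact: cmulr0.
by rewrite -(tck_mulSP PS) -cmulA (mulP_word PS) eq_sym (negPf er) cmulr0.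
Qed.

Lemma star_word_mul m m' w w' : size m = size m' ->
  star (word_elt P S m' w') ** word_elt P S m w =
  if [&& m == m', w == w' & word_path m w] then P w else 0.
Proof.
elim: m m' => [|e m IH] [|f m'] //=.
  by rewrite (tck_starP PS) (tck_mulPP PS) andbT eq_sym; case: eqVneq => [->|].
case=> /IH{}IH; rewrite starM -cmulA (cmulA (star (S f))) (tck_mul_starSS PS).
rewrite eqseq_cons (eq_sym e f); case: eqVneq => [<-|_] /=; last by rewrite cmul0 cmulr0.
rewrite (mulP_word PS) eq_sym; case: eqVneq => [er|_] /=; last by rewrite cmulr0 !andbF.
exact: IH.
Qed.

End Elements.
End WordsAndPaths.

(** * Perron-Frobenius comparison *)

Section PerronFrobenius.
Variables (R : realType) (E : digraph).
Hypothesis E_sc : strongly_connected E.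
Implicit Types (x y z : vtx E -> R) (v w : vtx E).

Lemma adj_sum x v :
  \sum_(w : vtx E) (adj v w)%:R * x w = \sum_(e : edge E | rng e == v) x (src e).
Proof.
rewrite (partition_big (@src E) xpredT)//=; apply: eq_bigr => w _.
rewrite (eq_bigr (fun=> x w)) => [|e /andP[_ /eqP->]//].
rewrite sumr_const mulr_natl; congr (_ *+ _).
by apply: eq_card => e; rewrite !inE.
Qed.

(** At a zero of [z] the sum over incoming edges is at most 0, so [z] vanishes at their sources;
    strong connectivity carries this along a path to any vertex. *)
Lemma zero_propagates z (t : R) : (forall v, 0 <= z v) ->
  (forall v, \sum_(e : edge E | rng e == v) z (src e) <= t * z v) ->
  forall v w, z v = 0 -> z w = 0.
Proof.
move=> z0 Az v w zv0; have [mu [_ muv muw]] := E_sc v w.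
rewrite -muw /psrc; have := gpathP mu; rewrite -/(prng mu) -/(pedges mu) muv.
elim: (pedges mu) v zv0 {muv muw} => [|e m IH] v //= zv0 /andP[/eqP ev].
apply: IH; apply/eqP; rewrite eq_le z0 andbT.
have := Az v; rewrite zv0 mulr0; apply: le_trans.
by rewrite (bigD1 e) ?ev//= lerDl sumr_ge0.
Qed.

(* Subtract from [y] the largest multiple of [x] that keeps it nonnegative. *)
Lemma PF_compare x y (r t : R) : (forall v, 0 < x v) ->
  (forall v, \sum_(e : edge E | rng e == v) x (src e) = r * x v) ->
  (forall v, 0 <= y v) -> 0 < \sum_v y v ->
  (forall v, \sum_(e : edge E | rng e == v) y (src e) <= t * y v) ->
  t <= r ->
  t = r /\ exists c, forall v, y v = c * x v.
Proof.
move=> x0 Ax y0 ys Ay tr.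
have [v1 _] : exists v1 : vtx E, v1 \in vtx E by apply/card_gt0P; exact: digraph_nonempty.
pose v0 := [arg min_(v < v1) (y v / x v)]%O.
have v0min v : y v0 / x v0 <= y v / x v.
  by rewrite /v0; case: arg_minP => // i _; apply.
pose c := y v0 / x v0; pose z v := y v - c * x v.
have z0 v : 0 <= z v by rewrite subr_ge0 -ler_pdivlMr// v0min.
have z_v0 : z v0 = 0 by rewrite /z /c divfK ?subrr// gt_eqF.
(* Here [t <= r] and [y >= 0] turn the bound with [t] into one with [r], so that the difference [z]
   is itself subinvariant and its zero at [v0] propagates. *)
have Az v : \sum_(e : edge E | rng e == v) z (src e) <= r * z v.
  rewrite sumrB -mulr_sumr Ax /z mulrBr mulrCA lerB// (le_trans (Ay v))//.
  by rewrite ler_wpM2r.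
have yE v : y v = c * x v.
  by apply/eqP; rewrite -subr_eq0; apply/eqP; exact: (zero_propagates z0 Az) z_v0.
split; last by exists c.
have c0 : 0 < c.
  rewrite lt_def divr_ge0 ?(ltW (x0 _))// andbT; apply/eqP => c0.
  by move: ys; rewrite big1 ?ltxx// => v _; rewrite yE c0 mul0r.
apply/eqP; rewrite eq_le tr /=.
have := Ay v0; rewrite (eq_bigr (fun e => c * x (src e))) => [|e _]; last exact: yE.
by rewrite -mulr_sumr Ax yE mulrCA ler_pM2r// mulr_gt0.
Qed.

(** A path of positive length from a vertex to itself provides an edge into it, so the sum over its
    incoming edges is positive. *)
Lemma PF_eigenvalue_gt0 x (r : R) : (forall v, 0 < x v) ->
  (forall v, \sum_(e : edge E | rng e == v) x (src e) = r * x v) -> 0 < r.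
Proof.
move=> x0 Ax.
have [v _] : exists v : vtx E, v \in vtx E by apply/card_gt0P; exact: digraph_nonempty.
have [mu [mu1 muv _]] := E_sc v v.
have := gpathP mu; move: mu1; rewrite /plen -/(prng mu) -/(pedges mu) muv.
case: (pedges mu) => // e m _ /= /andP[ev _].
rewrite -(pmulr_lgt0 r (x0 v)) -Ax (bigD1 e)//= ltr_wpDr// sumr_ge0// => f _.
exact: ltW.
Qed.

End PerronFrobenius.

(** * Vertex weights of a KMS functional *)

Section GaugeKMSFunctionals.
Variables (R : realType) (E : digraph) (A : cstarType R).
Variables (P : vtx E -> A) (S : edge E -> A).
Hypothesis PS : TCK_family P S.
Variables (psi : A -> R[i]) (beta : R).
Hypothesis psiP : positive_functional psi.
Hypothesis psi1 : psi (tck_one P) = 1.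
Hypothesis psi_deg : forall m w m' w', size m != size m' ->
  psi (word_elt P S m w ** star (word_elt P S m' w')) = 0.
Hypothesis psi_kms : forall m w m' w',
  psi (word_elt P S m w ** star (word_elt P S m' w')) =
  (expR (- ((size m)%:R * beta)))%:C *
  psi (star (word_elt P S m' w') ** word_elt P S m w).

Definition vertex_weight v : R := complex.Re (psi (P v)).

Lemma vertex_weightE v : psi (P v) = (vertex_weight v)%:C.
Proof.
have [PP Ps] := tck_projection PS v.
by have := functional_ge0E psiP (P v); rewrite Ps PP.
Qed.

Lemma vertex_weight_ge0 v : 0 <= vertex_weight v.
Proof.
have [PP Ps] := tck_projection PS v.
by have := psiP.2 (P v); rewrite Ps PP vertex_weightE ler0c.
Qed.

Lemma sum_vertex_weight : \sum_v vertex_weight v = 1.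
Proof.
apply: complexI; rewrite rmorph_sum -[RHS]psi1 /tck_one (functional_sum psiP.1).
by apply: eq_bigr => v _; rewrite vertex_weightE.
Qed.

Lemma gauge_KMS_word m w m' w' :
  psi (word_elt P S m w ** star (word_elt P S m' w')) =
  if [&& m == m', w == w' & word_path m w]
  then (expR (- ((size m)%:R * beta)) * vertex_weight w)%:C else 0.
Proof.
have [sm|sm] := eqVneq (size m) (size m'); last first.
  rewrite psi_deg//; case: eqVneq => // mm.
  by rewrite mm eqxx in sm.
rewrite psi_kms (star_word_mul PS _ _ sm); case: ifP => _.
  by rewrite vertex_weightE -rmorphM.
by rewrite (functional0 psiP.1) mulr0.
Qed.

Lemma gauge_KMS_range e :
  psi (S e ** star (S e)) = (expR (- beta) * vertex_weight (src e))%:C.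
Proof.
have := gauge_KMS_word [:: e] (src e) [:: e] (src e).
by rewrite /= (tck_mulSP PS) !eqxx mul1r.
Qed.

Lemma gauge_KMS_gap v : psi (CK_gap P S v) =
  (vertex_weight v - expR (- beta) *
    \sum_(e : edge E | rng e == v) vertex_weight (src e))%:C.
Proof.
rewrite /CK_gap (functionalB psiP.1) (functional_sum psiP.1) vertex_weightE.
rewrite rmorphB; congr (_ - _); rewrite mulr_sumr rmorph_sum.
by apply: eq_bigr => e _; rewrite gauge_KMS_range.
Qed.

Lemma tck_gap_positive v : cpositive (CK_gap P S v).
Proof.
case: PS => _ _ _ /(_ v [set e | rng e == v]%SET) h.
have : cle (\sum_(e in [set e | rng e == v]%SET) S e ** star (S e)) (P v).
  by apply: h => e; rewrite inE => /eqP.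
rewrite /cle /CK_gap (eq_bigl (fun e => rng e == v))// => e.
by rewrite inE.
Qed.

Lemma vertex_weight_subinvariant v :
  \sum_(e : edge E | rng e == v) vertex_weight (src e) <=
  expR beta * vertex_weight v.
Proof.
have [b gb] := tck_gap_positive v.
have := psiP.2 b; rewrite -gb gauge_KMS_gap ler0c subr_ge0.
by rewrite expRN ler_pdivrMl// expR_gt0.
Qed.

Lemma vertex_weight_invariant v : psi (CK_gap P S v) = 0 ->
  \sum_(e : edge E | rng e == v) vertex_weight (src e) =
  expR beta * vertex_weight v.
Proof.
move=> gap0; have := gauge_KMS_gap v; rewrite gap0.
move=> /complexI/esym/eqP; rewrite subr_eq0 expRN => /eqP ->.
by rewrite mulVKf// gt_eqF// expR_gt0.
Qed.

End GaugeKMSFunctionals.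

(** * Vector states of the basis vectors *)

Section MatrixEntries.
Variables (R : realType) (X Y : finType).
Local Notation fn := (seq X -> Y -> R[i]).
Local Notation H := (l2_space R X Y).
Implicit Types (m : seq X) (w : Y) (f : fn).

Definition delta_fun m w : fn := fun m' w' => ((m' == m) && (w' == w))%:R.

Lemma ipN_delta N m w f : (size m < N)%N -> ipN N (delta_fun m w) f = f m w.
Proof.
move=> mN; rewrite -[RHS](@wsum_delta _ _ N m (f m w) mN).
apply: eq_wsum => m'; rewrite /delta_fun; case: eqVneq => [->|_] /=; last first.
  by rewrite big1// => w' _; rewrite conjc0_mul.
rewrite (bigD1 w)//= eqxx big1 => [|w' /negPf->]; last by rewrite conjc0_mul.
by rewrite addr0 [X in X * _](conjc1 R) mul1r.
Qed.

Lemma delta_l2 m w : delta_fun m w \in @l2_pred R X Y.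
Proof.
apply/l2_predP; exists 1 => N.
apply: le_trans (Re_ipN_homo _ (leq_addr (size m).+1 N)) _.
by rewrite ipN_delta ?addnS ?ltnS ?leq_addl// /delta_fun !eqxx.
Qed.

Definition delta m w : H := L2 (delta_l2 m w).

Lemma ip_delta m w (u : H) : ip (delta m w) u = (u : l2 R X Y) m w.
Proof.
apply: scvg_unique (l2_ipP _ _) _ => e e0; exists (size m).+1 => n mn.
by rewrite ipN_delta// subrr Normc.normc0.
Qed.

(** By [ip_delta] this diagonal matrix coefficient is the vector state of the basis vector at
    [(m, w)]. *)
Definition entry (a : bop H) m w : R[i] := (a (delta m w) : l2 R X Y) m w.

Lemma entry_linear m w : scalar (fun a => entry a m w).
Proof. by move=> k a b; rewrite /entry bop_linE; exact: l2_linE. Qed.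

Lemma entry_positive (a : bop H) m w : 0 <= entry (star a ** a) m w.
Proof.
rewrite /entry -ip_delta.
have -> : (star a ** a) (delta m w) = bop_adj_fun a (a (delta m w)) by [].
rewrite -bop_adj_funP; have [_ _ h] := ipP H; exact: h.
Qed.

Lemma entry_star (a : bop H) m w : entry (star a) m w = conjc (entry a m w).
Proof.
rewrite /entry -!ip_delta -ipC.
by rewrite -(bop_adj_funP a).
Qed.

End MatrixEntries.

Section LevelSums.
Variable X : finType.

Fixpoint lsum (V : nmodType) n (F : seq X -> V) : V :=
  if n is n'.+1 then \sum_e lsum n' (fun m => F (e :: m)) else F [::].

Lemma eq_lsum (V : nmodType) n (F G : seq X -> V) :
  (forall m, size m = n -> F m = G m) -> lsum n F = lsum n G.
Proof.
elim: n F G => [|n IH] F G FG /=; first exact: FG.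
by apply: eq_bigr => e _; apply: IH => m mn; apply: FG; rewrite /= mn.
Qed.

Lemma lsum0 (V : nmodType) n : lsum n (fun=> 0 : V) = 0.
Proof. by elim: n => //= n IH; rewrite big1. Qed.

Lemma lsumD (V : nmodType) n (F G : seq X -> V) :
  lsum n (fun m => F m + G m) = lsum n F + lsum n G.
Proof.
elim: n F G => //= n IH F G; rewrite -big_split.
by apply: eq_bigr => e _; rewrite IH.
Qed.

Lemma lsumZ (R : pzSemiRingType) (k : R) n (F : seq X -> R) :
  lsum n (fun m => k * F m) = k * lsum n F.
Proof.
elim: n F => //= n IH F; rewrite mulr_sumr.
by apply: eq_bigr => e _; rewrite IH.
Qed.

Lemma lsum_ge0 (R : numDomainType) n (F : seq X -> R) :
  (forall m, 0 <= F m) -> 0 <= lsum n F.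
Proof. by elim: n F => //= n IH F F0; rewrite sumr_ge0// => e _; apply: IH. Qed.

End LevelSums.

(** * States averaged over the paths of a fixed length *)

Section LevelStates.
Variables (R : realType) (E : digraph) (x : vtx E -> R) (r : R).
Hypothesis x_gt0 : forall v, 0 < x v.
Hypothesis r_gt0 : 0 < r.
Hypothesis Ax : forall v, \sum_(e : edge E | rng e == v) x (src e) = r * x v.
Local Notation H := (l2_space R (edge E) (vtx E)).
Local Notation B := (bop H).
Local Notation FP := (fock_P R (E:=E)).
Local Notation FS := (@fock_S R E).
Implicit Types (a b : B) (m : seq (edge E)) (v w : vtx E) (e f : edge E).

Definition level_weight m w : R := (word_path m w)%:R * r ^- size m * x w.

Definition level_state n (a : B) : R[i] :=
  lsum n (fun m => \sum_w (level_weight m w)%:C * entry a m w).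

Lemma level_weight_ge0 m w : 0 <= level_weight m w.
Proof. by rewrite !mulr_ge0 ?invr_ge0 ?exprn_ge0 ?(ltW r_gt0) ?(ltW (x_gt0 _)). Qed.

Lemma level_weight_cons e m w :
  level_weight (e :: m) w = r^-1 * ((word_rng m w == src e)%:R * level_weight m w).
Proof.
rewrite /level_weight /= exprS invfM; case: (_ == src e) => /=; last by rewrite !mul0r mulr0.
by rewrite mul1r; ring.
Qed.

Lemma level_state_positive n : positive_functional (level_state n).
Proof.
split=> [k a b|a]; last first.
  apply: lsum_ge0 => m; apply: sumr_ge0 => w _.
  by rewrite mulr_ge0 ?ler0c ?level_weight_ge0 ?entry_positive.
rewrite /level_state -lsumZ -lsumD; apply: eq_lsum => m _.
rewrite mulr_sumr -big_split; apply: eq_bigr => w _ /=.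
by rewrite (entry_linear m w) /= mulrDr mulrCA.
Qed.

Lemma entry_mulP v a m w :
  entry (FP v ** a) m w = if word_rng m w == v then entry a m w else 0.
Proof. by []. Qed.

Lemma entry_shift e f a d m w : entry (FS e ** a ** star (FS f)) (d :: m) w =
  if [&& d == e, d == f, word_rng m w == src e & word_rng m w == src f]
  then entry a m w else 0.
Proof.
rewrite star_shift_op /entry /=.
have -> : l2_map (@unshift_contraction _ _ f) (delta R (d :: m) w) =
    if (d == f) && (word_rng m w == src f) then delta R m w else 0.
  apply: val_inj; apply/funext => m'; apply/funext => w'.
  rewrite /= /unshift_fun /delta_fun eqseq_cons (eq_sym f d).
  have [_|_] /= := eqVneq d f; last by rewrite if_same.
  have [->|mm] /= := eqVneq m' m; last first.
    by rewrite if_same; case: ifP => //= _; rewrite /delta_fun (negPf mm).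
  have [->|ww] /= := eqVneq w' w; last first.
    by rewrite if_same; case: ifP => //= _; rewrite /delta_fun (negPf ww) andbF.
  by case: ifP => //= _; rewrite /delta_fun !eqxx.
by case: (d == e); case: (d == f); case: (word_rng m w == src e);
  case: (word_rng m w == src f); rewrite /= ?bop0.
Qed.

(** This recursion removes one edge from both words of a monomial. The factor [r^-1] is the ratio of
    the weights of [e :: m] and [m], and the vertex projection records that [m] must begin at the
    source of [e]. *)
Lemma level_state_shift n e f a :
  level_state n.+1 (FS e ** a ** star (FS f)) =
  if e == f then r^-1%:C * level_state n (FP (src e) ** a) else 0.
Proof.
rewrite /level_state /=; have [<-|ef] := eqVneq e f; last first.
  rewrite big1// => d _; rewrite -[RHS](@lsum0 (edge E) R[i] n).
  apply: eq_lsum => m _; rewrite big1// => w _; rewrite entry_shift.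
  by case: (eqVneq d e) => //= [->|_]; rewrite ?(negPf ef) mulr0.
rewrite (bigD1 e)//= [X in _ + X]big1 ?addr0 => [|d /negPf de]; last first.
  rewrite -[RHS](@lsum0 (edge E) R[i] n); apply: eq_lsum => m _.
  by rewrite big1// => w _; rewrite entry_shift de mulr0.
rewrite -lsumZ; apply: eq_lsum => m _; rewrite mulr_sumr; apply: eq_bigr => w _.
rewrite entry_shift entry_mulP !eqxx andbb /= level_weight_cons !rmorphM /=.
have C1 : (1 : R)%:C = 1 by [].
case: (_ == src e); rewrite ?mulr0// [X in _ * (X * _)]C1 mul1r.
exact: esym (mulrA _ _ _).
Qed.

(** The weights of the paths of length [n] with range [v] add up to [r^(- n)] times the entry at [v]
    of [A^n x], which is [x v]. *)
Lemma level_state_P n v : level_state n (FP v) = (x v)%:C.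
Proof.
have entryP m w : entry (FP v) m w = (word_rng m w == v)%:R.
  by rewrite /entry /= /diag_fun /delta_fun !eqxx; case: ifP.
have -> : level_state n (FP v) =
    (lsum n (fun m => \sum_w (word_rng m w == v)%:R * level_weight m w))%:C.
  rewrite /level_state.
  have lsumC k (F : seq (edge E) -> R) : (lsum k F)%:C = lsum k (fun m => (F m)%:C).
    elim: k F => //= k IH F; rewrite rmorph_sum; apply: eq_bigr => e _.
    exact: IH.
  rewrite lsumC; apply: eq_lsum => m _; rewrite rmorph_sum; apply: eq_bigr => w _.
  rewrite entryP mulrC -(rmorph_nat (real_complex R)).
  exact: esym (rmorphM (real_complex R) _ _).
congr (_%:C); elim: n v {entryP} => [|n IH] v /=.
  rewrite (bigD1 v)//= eqxx big1 ?addr0 => [|w /negPf->]; last by rewrite mul0r.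
  by rewrite /level_weight /= invr1 !mul1r.
have <- : r^-1 * (r * x v) = x v by rewrite mulKf// gt_eqF.
rewrite -Ax mulr_sumr [RHS]big_mkcond; apply: eq_bigr => e _.
case: eqVneq => _; last first.
  rewrite -[RHS](@lsum0 (edge E) R n); apply: eq_lsum => m _.
  by rewrite big1// => w _; rewrite mul0r.
rewrite -IH -lsumZ; apply: eq_lsum => m _; rewrite mulr_sumr.
by apply: eq_bigr => w _; rewrite mul1r level_weight_cons.
Qed.

Lemma level_state_star n a : level_state n (star a) = conjc (level_state n a).
Proof.
rewrite /level_state; have lsumJ k (F : seq (edge E) -> R[i]) :
    conjc (lsum k F) = lsum k (fun m => conjc (F m)).
  by elim: k F => //= k IH F; rewrite rmorph_sum; apply: eq_bigr => e _; exact: IH.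
rewrite lsumJ; apply: eq_lsum => m _; rewrite rmorph_sum; apply: eq_bigr => w _.
by rewrite entry_star -[in LHS](conjc_real (level_weight m w)) -(rmorphM (@conjc R)).
Qed.

(** The operators of degree [k] for the grading by word length; those of positive degree have zero
    diagonal, which settles monomials with words of different lengths. *)
Definition raises k (a : B) := forall (u : H) n,
  (forall m w, size m != n -> (u : l2 R _ _) m w = 0) ->
  forall m w, size m != (k + n)%N -> (a u : l2 R _ _) m w = 0.

Lemma raises_P v : raises 0 (FP v).
Proof. by move=> u n un m w mn; rewrite /= /diag_fun un// if_same. Qed.

Lemma raises_S e : raises 1 (FS e).
Proof.
move=> u n un [|d m] w //= mn.
by rewrite un ?if_same//; move: mn; rewrite add1n eqSS.
Qed.

Lemma raises_mul k l a b : raises k a -> raises l b -> raises (k + l) (a ** b).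
Proof.
move=> ka lb u n un m w mn; apply: (ka _ (l + n)%N); last by rewrite addnA.
exact: lb.
Qed.

Lemma raises_word m w : raises (size m) (word_elt FP FS m w).
Proof.
elim: m => [|e m IH] /=; first exact: raises_P.
exact: raises_mul (raises_S e) IH.
Qed.

Lemma level_state_raises n k a : raises k.+1 a -> level_state n a = 0.
Proof.
move=> ka; rewrite /level_state -[RHS](@lsum0 (edge E) R[i] n).
apply: eq_lsum => m _; rewrite big1// => w _.
rewrite /entry (ka _ (size m)) ?mulr0// => [m' w' mm|].
  rewrite /= /delta_fun; case: eqVneq => // m'm.
  by rewrite m'm eqxx in mm.
by rewrite -[X in X != _]add0n eqn_add2r.
Qed.

(** Edges are removed from both words at once until one is empty. If both are, the value is that of
    a vertex projection; if only one is, the remaining operator or its adjoint raises the length.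
    The level must be at least both lengths for every removal to be possible. *)
Lemma level_state_word n m w m' w' : (size m <= n)%N -> (size m' <= n)%N ->
  level_state n (word_elt FP FS m w ** star (word_elt FP FS m' w')) =
  if [&& m == m', w == w' & word_path m w] then (r ^- size m * x w)%:C else 0.
Proof.
have F := fock_TCK R E.
have L0 k : level_state k 0 = 0 by exact: (functional0 (level_state_positive k).1).
elim: m m' n => [|e m IH] [|f m'] n //=.
- move=> _ _; rewrite (tck_starP F) (tck_mulPP F) andbT.
  case: eqVneq => _; last exact: L0.
  by rewrite level_state_P expr0 invr1 mul1r.
- move=> _ _; rewrite -[FP w](tck_starP F) -starM level_state_star.
  rewrite (@level_state_raises _ (size m')) ?conjc0//.
  have := raises_mul (@raises_word (f :: m') w') (@raises_P w).
  by rewrite addn0.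
- move=> _ _; rewrite (tck_starP F) (@level_state_raises _ (size m))//.
  have := raises_mul (@raises_word (e :: m) w) (@raises_P w').
  by rewrite addn0.
case: n => // n mn m'n; rewrite starM cmulA -(cmulA (FS e)) level_state_shift.
rewrite eqseq_cons; case: eqVneq => //= _.
rewrite cmulA (mulP_word F) eq_sym; case: eqVneq => /= _; last first.
  by rewrite cmul0 L0// mulr0 !andbF.
rewrite IH//; case: ifP => _; last by rewrite mulr0.
by rewrite -(rmorphM (real_complex R)) mulrA exprS invfM.
Qed.

Lemma level_state_one n : \sum_v x v = 1 -> level_state n (tck_one FP) = 1.
Proof.
move=> x1; rewrite /tck_one (functional_sum (level_state_positive n).1).
rewrite -[RHS]/(1%:C) -x1 rmorph_sum; apply: eq_bigr => v _.
exact: level_state_P.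
Qed.

End LevelStates.

(** * Limits of positive functionals *)

Section FunctionalLimits.
Variables (R : realType) (A : cstarType R).
Implicit Types (a b : A) (F : nat -> A -> R[i]).

Lemma closed_subspace_convergence F (M : R) : (forall n, scalar (F n)) ->
  (forall n a, normc (F n a) <= M * rnorm a) ->
  closed_subspace [set a | exists l, scvg (F^~ a) l].
Proof.
move=> FL FM; split; last first.
- move=> k a b /= [l al] [l' bl]; exists (k * l + l').
  have := scvgD (scvgM (scvg_cst k) al) bl.
  by congr scvg; apply/funext => n; rewrite FL.
- exists 0; have := scvg_cst (0 : R[i]); congr scvg.
  by apply/funext => n; rewrite (functional0 (FL n)).
apply/closed_rnormP => a aQ; apply: scvg_complete => e e0.
have M1 : 0 < 4 * (`|M| + 1) by rewrite mulr_gt0// ltr_wpDl.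
have [b [l bl] ab] := aQ _ (divr_gt0 e0 M1).
(* Four such quarters add up to [e]: two from replacing [a] by [b], two from the convergence at
   [b]. *)
have Fab n : normc (F n a - F n b) < e / 4.
  rewrite -(functionalB (FL n)); apply: le_lt_trans (FM _ _) _.
  apply: (@le_lt_trans _ _ ((`|M| + 1) * rnorm (a - b))).
    by rewrite ler_wpM2r ?rnorm_ge0// (le_trans (ler_norm M))// lerDl.
  move: ab; rewrite ltr_pdivlMr//; lra.
have [N bN] := bl _ (divr_gt0 e0 (ltr0n R 4)); exists N => m n /bN mN /bN nN.
have -> : F m a - F n a = (F m a - F m b) + (F m b - l) - ((F n a - F n b) + (F n b - l)).
  by ring.
have := normcB (F m a - F m b + (F m b - l)) (F n a - F n b + (F n b - l)).
have := normcD (F m a - F m b) (F m b - l); have := normcD (F n a - F n b) (F n b - l).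
have := Fab m; have := Fab n; lra.
Qed.

Lemma positive_functional_limit F (phi : A -> R[i]) :
  (forall n, positive_functional (F n)) -> (forall a, scvg (F^~ a) (phi a)) ->
  positive_functional phi.
Proof.
move=> FP Fphi; split=> [k a b|a].
  apply: scvg_unique (Fphi _) _.
  have := scvgD (scvgM (scvg_cst k) (Fphi a)) (Fphi b).
  by congr scvg; apply/funext => n; rewrite (FP n).1.
have FE n := functional_ge0E (FP n) a.
have E : phi (star a ** a) = (complex.Re (phi (star a ** a)))%:C.
  have /scvg_ReImP[/scvg_realC re _] := Fphi (star a ** a).
  apply: scvg_unique (Fphi _) _; move: re; congr scvg.
  by apply/funext => n; rewrite -FE.
have : scvg (fun n => (complex.Re (F n (star a ** a)))%:C)
    (complex.Re (phi (star a ** a)))%:C.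
  by rewrite -E; have := Fphi (star a ** a); congr scvg; apply/funext.
move=> /(@scvg_ge _ _ _ 0 0%N) h; rewrite E ler0c; apply: h => n _.
by rewrite -ler0c -FE; exact: (FP n).2.
Qed.

Lemma positive_functional_star (psi : A -> R[i]) e a :
  (forall b, e ** b = b /\ b ** e = b) -> positive_functional psi ->
  psi (star a) = conjc (psi a).
Proof.
move=> eP psiP; have BP : positive_form (fun b c => psi (star b ** c)).
  split=> [b k c d|k b c d|b]; last exact: psiP.2.
    by rewrite cmulDr cmulZr psiP.1.
  by rewrite starD starZc cmulDl cmulZl psiP.1.
by have := positive_form_herm BP e a; rewrite (star_unit eP) (eP _).1 (eP _).2.
Qed.

End FunctionalLimits.

Section StarHomomorphisms.
Variables (R : realType) (A B : cstarType R) (f : A -> B).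
Hypothesis fP : star_hom f.

Lemma star_homD a b : f (a + b) = f a + f b.
Proof. by case: fP => fL _ _; have := fL 1 a b; rewrite !scale1r. Qed.

Lemma star_hom0 : f 0 = 0.
Proof. by apply: (@addrI _ (f 0)); rewrite -star_homD !addr0. Qed.

Lemma star_homZ (k : R[i]) a : f (k *: a) = k *: f a.
Proof. by case: fP => fL _ _; have := fL k a 0; rewrite star_hom0 !addr0. Qed.

Lemma star_hom_sum (I : Type) (r : seq I) (Q : pred I) (F : I -> A) :
  f (\sum_(i <- r | Q i) F i) = \sum_(i <- r | Q i) f (F i).
Proof. exact: (big_morph _ star_homD star_hom0). Qed.

Lemma star_homM a b : f (a ** b) = f a ** f b.
Proof. by case: fP. Qed.

Lemma star_hom_star a : f (star a) = star (f a).
Proof. by case: fP. Qed.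

Lemma positive_functional_comp (psi : B -> R[i]) :
  positive_functional psi -> positive_functional (psi \o f).
Proof.
move=> [psiL psi0]; split=> [k a b|a] /=.
  by rewrite star_homD star_homZ psiL.
by rewrite star_homM star_hom_star.
Qed.

Lemma word_elt_hom (E : digraph) (P : vtx E -> A) (S : edge E -> A) m w :
  f (word_elt P S m w) = word_elt (f \o P) (f \o S) m w.
Proof. by elim: m => //= e m IH; rewrite star_homM IH. Qed.

End StarHomomorphisms.

(** * Existence of the limit state *)

Section StateExistence.
Variables (R : realType) (E : digraph) (T : cstarType R).
Variables (p : vtx E -> T) (s : edge E -> T).
Hypothesis T_univ : universal_TCK p s.
Variables (x : vtx E -> R) (r : R).
Hypothesis x_gt0 : forall v, 0 < x v.
Hypothesis r_gt0 : 0 < r.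
Hypothesis Ax : forall v, \sum_(e : edge E | rng e == v) x (src e) = r * x v.
Hypothesis x_sum : \sum_v x v = 1.

Lemma Toeplitz_state_exists : exists phi : T -> R[i],
  [/\ positive_functional phi, phi (tck_one p) = 1
    & forall m w m' w', phi (word_elt p s m w ** star (word_elt p s m' w')) =
        if [&& m == m', w == w' & word_path m w]
        then (r ^- size m * x w)%:C else 0].
Proof.
have [ps gen univ] := T_univ.
have [pi [piP pi_p pi_s]] := univ _ _ _ (fock_TCK R E).
have pip : pi \o p = fock_P R (E:=E) by apply/funext.
have pis : pi \o s = @fock_S R E by apply/funext.
pose F n a := level_state x r n (pi a).
have FP n : positive_functional (F n).
  exact: (positive_functional_comp piP (level_state_positive x_gt0 r_gt0 n)).
have F1 n : F n (tck_one p) = 1.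
  rewrite -(level_state_one x_gt0 r_gt0 Ax n x_sum) /F; congr level_state.
  by rewrite /tck_one (star_hom_sum piP) -pip.
have Fw n m w m' w' : (size m <= n)%N -> (size m' <= n)%N ->
    F n (word_elt p s m w ** star (word_elt p s m' w')) =
    if [&& m == m', w == w' & word_path m w] then (r ^- size m * x w)%:C else 0.
  move=> mn m'n; rewrite -(level_state_word x_gt0 r_gt0 Ax w w' mn m'n) /F.
  by rewrite (star_homM piP) (star_hom_star piP) !(word_elt_hom piP) pip pis.
have Fw_cvg m w m' w' :
    scvg (F^~ (word_elt p s m w ** star (word_elt p s m' w')))
    (if [&& m == m', w == w' & word_path m w] then (r ^- size m * x w)%:C else 0).
  move=> e e0; exists (maxn (size m) (size m')) => n.
  by rewrite geq_max => /andP[mn m'n]; rewrite Fw// subrr Normc.normc0.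
(* All [F n] have norm bound 1, so convergence passes from the monomials to their closed span. *)
have F_cvg a : exists l, scvg (F^~ a) l.
  apply: (word_span_ind ps gen (Q := [set a | exists l, scvg (F^~ a) l])) a.
    apply: (@closed_subspace_convergence _ _ _ 1) => [n|n a]; first exact: (FP n).1.
    by have := functional_bound (tck_oneP ps gen) (FP n) a; rewrite F1.
  by move=> m w m' w'; exists (if [&& m == m', w == w' & word_path m w] then (r ^- size m * x w)%:C else 0).
have [phi phiP] := choice F_cvg.
exists phi; split.
- exact: positive_functional_limit FP phiP.
- apply: scvg_unique (phiP _) _; have := scvg_cst (1 : R[i]).
  by congr scvg; apply/funext => n; rewrite F1.
- by move=> m w m' w'; apply: scvg_unique (phiP _) _.
Qed.

End StateExistence.

Section TwistedCommutation.
Variables (R : realType) (A : cstarType R) (psi : A -> R[i]).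
Hypothesis psiL : scalar psi.

Lemma bounded_functional_comp (l : R[i]) (h : A -> A) (K : R) :
  (forall a, rnorm (h a) <= K * rnorm a) ->
  bounded_functional psi -> bounded_functional (fun a => l * psi (h a)).
Proof.
move=> hK [M psiM]; exists (normc l * (`|M| * K)) => a.
rewrite Normc.normcM -mulrA ler_wpM2l ?normc_ge0//; apply: le_trans (psiM _) _.
apply: (@le_trans _ _ (`|M| * rnorm (h a))).
  by rewrite ler_wpM2r ?rnorm_ge0 ?ler_norm.
by rewrite -mulrA ler_wpM2l.
Qed.

Lemma closed_subspace_twist (k : R[i]) b c : bounded_functional psi ->
  closed_subspace [set a | psi (b ** a) = k * psi (a ** c)].
Proof.
move=> psiB; apply: (@closed_subspace_functional_eq _ _ (fun a => psi (b ** a))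
  (fun a => k * psi (a ** c))).
- by move=> l y z; rewrite cmulDr cmulZr psiL.
- by move=> l y z; rewrite cmulDl cmulZl psiL mulrDr mulrCA.
- have [M psiM] := @bounded_functional_comp 1 (cmul b) (rnorm b) (rnormM b) psiB.
  by exists M => a; have := psiM a; rewrite mul1r.
- apply: (@bounded_functional_comp k (fun a => a ** c) (rnorm c)) => // a.
  by rewrite mulrC rnormM.
Qed.

End TwistedCommutation.

(** * From monomials to the full KMS condition *)

Section WordKMS.
Variables (R : realType) (A : cstarType R) (alpha : R -> A -> A) (beta : R).
Variables (phi : A -> R[i]) (W : set A).
Hypothesis phi_state : is_state phi.
Hypothesis phi_bounded : bounded_functional phi.
Hypothesis phi_invariant : forall t a, phi (alpha t a) = phi a.
Hypothesis alphaM : forall t, {morph alpha t : a b / a ** b}.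
Hypothesis W_dense : forall a c, (forall b, W b -> phi (a ** b) = phi (b ** c)) ->
  forall b, phi (a ** b) = phi (b ** c).
Hypothesis W_KMS : forall b, W b -> exists k, homogeneous alpha k b /\
  forall a, phi (a ** b) = (expR (k * beta))%:C * phi (b ** a).

(** The set [W] is abstract so that the lemma serves both algebras, with the monomials or with their
    images. The case [beta = 0] is included because [rho(A)] may be 1. *)
Lemma KMS_state_of_words : KMS_state alpha beta phi.
Proof.
split=> //; have [phiL _ _] := phi_state; case: eqVneq => [beta0|_].
  split=> // a; apply: W_dense => b /W_KMS[k [_ ->]].
  by rewrite beta0 mulr0 expR0 mul1r.
move=> a b f fP _; apply: W_dense => {}b /W_KMS[k [bk bphi]].
apply: (KMS_from_homogeneous (k := k) phiL phi_bounded bphi) fP => t c.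
(* Apply invariance to [b ** c]: the dynamics multiplies [b] by [expi (k * t)], and this phase
   cancels the factor [expi (- (k * t))]. *)
rewrite -[in RHS](phi_invariant t) alphaM bk cmulZl (functionalZ phiL) mulrA.
by rewrite -expiD addNr expi0 mul1r.
Qed.

End WordKMS.

(** * The KMS condition for the limit state *)

Section PerronFrobeniusState.
Variables (R : realType) (E : digraph) (A : cstarType R).
Variables (P : vtx E -> A) (S : edge E -> A).
Hypothesis PS : TCK_family P S.
Hypothesis gen : cstar_generated_by (range P `|` range S).
Variables (x : vtx E -> R) (r : R).
Hypothesis r_gt0 : 0 < r.
Hypothesis Ax : forall v, \sum_(e : edge E | rng e == v) x (src e) = r * x v.
Variable phi : A -> R[i].
Hypothesis phiP : positive_functional phi.
Hypothesis phi1 : phi (tck_one P) = 1.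
Hypothesis phi_word : forall m w m' w',
  phi (word_elt P S m w ** star (word_elt P S m' w')) =
  if [&& m == m', w == w' & word_path m w] then (r ^- size m * x w)%:C else 0.

Let eP := tck_oneP PS gen.
Let phiL := phiP.1.

Lemma word_state_bounded (psi : A -> R[i]) : positive_functional psi ->
  bounded_functional psi.
Proof. by move=> psiP; exists (complex.Re (psi (tck_one P))); exact: functional_bound. Qed.

Lemma word_state_eq (psi chi : A -> R[i]) :
  positive_functional psi -> positive_functional chi ->
  (forall m w m' w', psi (word_elt P S m w ** star (word_elt P S m' w')) =
     chi (word_elt P S m w ** star (word_elt P S m' w'))) -> psi = chi.
Proof.
move=> psiP chiP psichi; apply/funext.
apply: (word_span_ind PS gen (Q := [set a | psi a = chi a])) => //.
by apply: closed_subspace_functional_eq;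
  [exact: psiP.1|exact: chiP.1|exact: word_state_bounded|exact: word_state_bounded].
Qed.

(** The twisting factor is multiplicative in [b] and is inverted by [star], so the KMS condition for
    monomials reduces to the generators [P v] and [S e]. *)
Definition twisted (k : R) b := forall a, phi (b ** a) = k%:C * phi (a ** b).

Lemma word_twisted (k : R) b :
  (forall m w m' w', phi (b ** (word_elt P S m w ** star (word_elt P S m' w'))) =
     k%:C * phi ((word_elt P S m w ** star (word_elt P S m' w')) ** b)) ->
  twisted k b.
Proof.
apply: (word_span_ind PS gen (Q := [set a | phi (b ** a) = k%:C * phi (a ** b)])).
exact: closed_subspace_twist phiL _ _ _ (word_state_bounded phiP).
Qed.

Lemma twistedM k l b c : twisted k b -> twisted l c -> twisted (k * l) (b ** c).
Proof.
by move=> kb lc a; rewrite -cmulA kb -cmulA lc rmorphM /= -mulrA cmulA.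
Qed.

Lemma twisted_star k b : k != 0 -> twisted k b -> twisted k^-1 (star b).
Proof.
move=> k0 kb a; rewrite -{1}(starK a) -starM (positive_functional_star _ eP phiP).
have : phi (star a ** b) = k^-1%:C * phi (b ** star a).
  by rewrite kb mulrA -(rmorphM (real_complex R)) mulVf// mul1r.
have conjM (y z : R[i]) : conjc (y * z) = conjc y * conjc z by exact: rmorphM.
move=> ->; rewrite conjM conjc_real.
by rewrite -(positive_functional_star _ eP phiP) starM starK.
Qed.

Lemma twisted_P v : twisted 1 (P v).
Proof.
apply: word_twisted => m w m' w'; rewrite mul1r cmulA (mulP_word PS) -cmulA.
have -> : star (word_elt P S m' w') ** P v = star (P v ** word_elt P S m' w').
  by rewrite starM (tck_starP PS).
rewrite (mulP_word PS).
have [<-|mm] := eqVneq m m'; last first.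
  by do 2 case: ifP => _; rewrite ?star0 ?cmul0 ?cmulr0 ?phi_word ?(negPf mm) ?(functional0 phiL).
have [<-|ww] := eqVneq w w'; last first.
  by do 2 case: ifP => _; rewrite ?star0 ?cmul0 ?cmulr0 ?phi_word ?(negPf ww) ?andbF ?(functional0 phiL).
by case: ifP; rewrite ?star0 ?cmul0 ?cmulr0.
Qed.

Lemma twisted_S e : twisted r^-1 (S e).
Proof.
apply: word_twisted => m w m' w'.
rewrite cmulA -[S e ** word_elt P S m w]/(word_elt P S (e :: m) w) phi_word -cmulA.
case: m' => [|f m'].
  rewrite /= (tck_starP PS) (tck_mulPS PS); case: ifP => _; last first.
    by rewrite cmulr0 (functional0 phiL) mulr0.
  rewrite (word_mulS PS); case: ifP => _; last by rewrite (functional0 phiL) mulr0.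
  have := word_mulP PS (rcons m e) (src e) (src e); rewrite eqxx => <-.
  rewrite -(tck_starP PS) -[P _]/(word_elt P S [::] _) phi_word.
  by case: (m) => [|? ?]; rewrite mulr0.
have -> : star (word_elt P S (f :: m') w') ** S e =
    star (star (S e) ** word_elt P S (f :: m') w') by rewrite starM starK.
rewrite (starS_word PS) eqseq_cons /= (fun_if star) star0.
rewrite (fun_if (fun a => phi (word_elt P S m w ** a))) cmulr0 (functional0 phiL) phi_word.
case: (e == f) => /=; last by rewrite mulr0.
have [<-|_] := eqVneq m m'; last by rewrite if_same mulr0.
have [<-|_] := eqVneq w w'; last by rewrite if_same mulr0.
rewrite /= (eq_sym (src e)); case: (_ == src e) => /=; last by rewrite mulr0.
case: ifP => _; last by rewrite mulr0.
by rewrite -(rmorphM (real_complex R)) mulrA exprS invfM.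
Qed.

Lemma twisted_word m w : twisted (r ^- size m) (word_elt P S m w).
Proof.
elim: m => [|e m IH] /=; first by rewrite expr0 invr1; exact: twisted_P.
by rewrite exprS invfM; apply: twistedM IH; exact: twisted_S.
Qed.

Lemma word_state_KMS m w m' w' a :
  phi (a ** (word_elt P S m w ** star (word_elt P S m' w'))) =
  (expR (((size m)%:R - (size m')%:R) * ln r))%:C *
  phi (word_elt P S m w ** star (word_elt P S m' w') ** a).
Proof.
have rm n : r ^- n != 0 by rewrite invr_eq0 expf_neq0// gt_eqF.
have := twistedM (twisted_word m w) (twisted_star (rm _) (twisted_word m' w')).
move=> ->.
rewrite mulrA -(rmorphM (real_complex R)) mulrBl expRB !expRM_natl.
rewrite lnK ?posrE// mulf_div mulrC [_ * r ^- _]mulrC.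
have rn n : r ^+ n != 0 by rewrite expf_neq0// gt_eqF.
by rewrite mulVf// divff// divr1 mulr1.
Qed.

Lemma state_gap v : phi (CK_gap P S v) = 0.
Proof.
rewrite /CK_gap (functionalB phiL) (functional_sum phiL).
have -> : phi (P v) = (x v)%:C.
  have := phi_word [::] v [::] v.
  by rewrite /= (tck_starP PS) (tck_mulPP PS) !eqxx expr0 invr1 mul1r.
have SS e : phi (S e ** star (S e)) = (r^-1 * x (src e))%:C.
  have := phi_word [:: e] (src e) [:: e] (src e).
  by rewrite /= (tck_mulSP PS) !eqxx expr1.
rewrite (eq_bigr _ (fun e _ => SS e)) -rmorph_sum -mulr_sumr Ax mulKf ?gt_eqF//.
exact: subrr.
Qed.

(** Vanishing of [phi] alone is not stable under multiplication, so the closed ideal [N] asks that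
    [phi] vanish on all [b ** a ** c]. For a gap the factor on the right is handled by
    Cauchy-Schwarz, and a monomial on the left is first moved to the right by the KMS condition. *)
Lemma state_vanishes_CK_ideal a : CK_ideal P S a -> phi a = 0.
Proof.
move=> aJ; pose N := [set a | forall bc : A * A, setT bc -> phi (bc.1 ** a ** bc.2) = 0].
have phi0 : closed_subspace [set a | phi a = 0].
  apply: (@closed_subspace_functional_eq _ _ phi (fun=> 0)) => //.
  - by move=> k b c; rewrite mulr0 addr0.
  - exact: word_state_bounded.
  - by exists 0 => b; rewrite Normc.normc0 mul0r.
have [cN N0 NL] : closed_subspace N.
  apply: closed_subspace_bigI => bc _.
  exact: (closed_subspace_mull _ (closed_subspace_mulr bc.2 phi0)).
have /(_ (tck_one P, tck_one P) I) : N a.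
  apply: aJ; split; last first.
    move=> _ [v _ <-] [b c] _ /=; set g := CK_gap P S v.
    suff gb d : phi (g ** d) = 0.
      apply: (word_span_ind PS gen (Q := [set b | phi (b ** g ** c) = 0])) b.
        exact: (closed_subspace_mulr g (closed_subspace_mulr c phi0)).
      move=> m w m' w' /=; have := word_state_KMS m w m' w' (g ** c).
      rewrite -cmulA gb cmulA; move/esym/eqP.
      by rewrite mulf_eq0 (fmorph_eq0 (real_complex R)) gt_eqF ?expR_gt0//= => /eqP.
    have [h gh] := tck_gap_positive PS v.
    have := cauchy_schwarz phiP h (h ** d).
    rewrite cmulA -gh -/g state_gap mul0r => cs.
    apply: Normc.eq0_normc; apply/eqP; rewrite -sqrf_eq0 eq_le sqr_ge0 andbT.
    exact: cs.
  split=> // c b Nb; split=> -[y z] _ /=.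
    by rewrite cmulA; exact: (Nb (y ** c, z) I).
  by rewrite cmulA -(cmulA _ c); exact: (Nb (y, c ** z) I).
by rewrite /= (eP _).1 (eP _).2.
Qed.

End PerronFrobeniusState.

(** * KMS states for the gauge dynamics *)

Section GaugeDynamics.
Variables (R : realType) (E : digraph) (E_sc : strongly_connected E).
Variables (T : cstarType R) (p : vtx E -> T) (s : edge E -> T).
Hypothesis ps : TCK_family p s.
Hypothesis gen : cstar_generated_by (range p `|` range s).
Variables (gamma : R[i] -> T -> T) (alpha : R -> T -> T).
Hypothesis gammaP : is_gauge_action p s gamma.
Hypothesis alphaP : forall t, alpha t = gamma (expi t).

Let eP := tck_oneP ps gen.
Local Notation word_mono m w m' w' := (word_elt p s m w ** star (word_elt p s m' w')).

Lemma norm_expi (t : R) : `|expi t| = 1.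
Proof. by rewrite normcE /= cos2Dsin2 sqrtr1. Qed.

Lemma gauge_dynamics_hom t : star_hom (alpha t).
Proof. by case: gammaP => h _ _ _; rewrite alphaP; have [] := h _ (norm_expi t). Qed.

(** The gauge action is prescribed on paths; a monomial with a word that is not a path is zero. *)
Lemma word_mono_homogeneous m w m' w' :
  homogeneous alpha ((size m)%:R - (size m')%:R) (word_mono m w m' w').
Proof.
move=> t; have a0 := star_hom0 (gauge_dynamics_hom t).
have [mw|mw] := boolP (word_path m w); last first.
  by rewrite (word_elt_eq0 ps mw) cmul0 scaler0.
have [mw'|mw'] := boolP (word_path m' w'); last first.
  by rewrite (word_elt_eq0 ps mw') star0 cmulr0 scaler0.
case: gammaP => _ _ _ /(_ _ (norm_expi t) (gpath_of_word mw) (gpath_of_word mw')).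
rewrite !(s_path_word ps) !psrc_gpath_of_word alphaP => ->; congr (_ *: _).
by rewrite expi_expz; congr (expi (_ * t)); rewrite intrB.
Qed.

Lemma word_homogeneous m w : homogeneous alpha (size m)%:R (word_elt p s m w).
Proof.
have := word_mono_homogeneous m w [::] w; rewrite subr0 /= (tck_starP ps).
by rewrite (word_mulP ps) eqxx.
Qed.

Lemma star_word_homogeneous m w :
  homogeneous alpha (- (size m)%:R) (star (word_elt p s m w)).
Proof.
have := word_mono_homogeneous [::] w m w; rewrite sub0r /=.
by rewrite -(star_word ps).
Qed.

Lemma tck_one_homogeneous : homogeneous alpha 0 (tck_one p).
Proof.
move=> t; rewrite mul0r expi0 scale1r (star_hom_sum (gauge_dynamics_hom t)).
apply: eq_bigr => v _; have := word_homogeneous [::] v t.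
by rewrite mul0r expi0 scale1r.
Qed.

(* Applied to the quotient map onto the graph algebra and to the identity of
   the Toeplitz algebra. *)
Lemma KMS_word_relations (C : cstarType R) (q : T -> C) (alphaC : R -> C -> C)
    beta psi : star_hom q ->
  (forall c, q (tck_one p) ** c = c /\ c ** q (tck_one p) = c) ->
  (forall t a, alphaC t (q a) = q (alpha t a)) -> KMS_state alphaC beta psi ->
  [/\ positive_functional (psi \o q), psi (q (tck_one p)) = 1,
      forall m w m' w', size m != size m' -> psi (q (word_mono m w m' w')) = 0
    & forall m w m' w', psi (q (word_mono m w m' w')) =
        (expR (- ((size m)%:R * beta)))%:C *
        psi (q (star (word_elt p s m' w') ** word_elt p s m w))].
Proof.
move=> qP q1 alphaCP psiK; have [[psiL psi0 psiS] _] := psiK.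
have psiP : positive_functional psi by split.
have homq k a : homogeneous alpha k a -> homogeneous alphaC k (q a).
  by move=> ha t; rewrite alphaCP ha (star_homZ qP).
split.
- exact: (positive_functional_comp qP psiP).
- by apply: (is_state_unit q1 psiP).1.
- move=> m w m' w' mm.
  apply: (KMS_degree0 psiK q1 (homq _ _ tck_one_homogeneous)
            (homq _ _ (word_mono_homogeneous m w m' w'))).
  by rewrite subr_eq0 eqr_nat.
- move=> m w m' w'; rewrite !(star_homM qP).
  exact: (KMS_homogeneous psiK (homq _ _ (word_homogeneous m w))
            (homq _ _ (star_word_homogeneous m' w'))).
Qed.

Section PerronFrobenius.
Variables (x : vtx E -> R) (r : R).
Hypothesis x_gt0 : forall v, 0 < x v.
Hypothesis Ax : forall v, \sum_(e : edge E | rng e == v) x (src e) = r * x v.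
Hypothesis x_sum : \sum_v x v = 1.
Variable phi : T -> R[i].
Hypothesis phiP : positive_functional phi.
Hypothesis phi1 : phi (tck_one p) = 1.
Hypothesis phi_word : forall m w m' w', phi (word_mono m w m' w') =
  if [&& m == m', w == w' & word_path m w] then (r ^- size m * x w)%:C else 0.

Let r_gt0 : 0 < r := PF_eigenvalue_gt0 E_sc x_gt0 Ax.

Lemma word_state_invariant t a : phi (alpha t a) = phi a.
Proof.
have hom := gauge_dynamics_hom t.
suff : phi \o alpha t = phi by move=> /(congr1 (fun f => f a)).
apply: (word_state_eq ps gen) => //; first exact: (positive_functional_comp hom).
move=> m w m' w' /=; rewrite word_mono_homogeneous (functionalZ phiP.1) phi_word.
by case: eqVneq => [->|_]; rewrite ?mulr0// subrr mul0r expi0 mul1r.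
Qed.

Lemma word_state_KMS_state : KMS_state alpha (ln r) phi.
Proof.
have hom := gauge_dynamics_hom.
apply: (@KMS_state_of_words _ _ _ _ _
  [set b | exists m w m' w', b = word_mono m w m' w']).
- exact: (is_state_unit eP phiP).2.
- exact: (word_state_bounded ps gen phiP).
- exact: word_state_invariant.
- by move=> t; case: (hom t).
- move=> a c acW.
  suff h b : phi (a ** b) = 1 * phi (b ** c) by move=> b; rewrite h mul1r.
  apply: (word_span_ind ps gen (Q := [set b | phi (a ** b) = 1 * phi (b ** c)])) b.
    exact: closed_subspace_twist phiP.1 _ _ _ (word_state_bounded ps gen phiP).
  by move=> m w m' w'; rewrite /= mul1r; apply: acW; exists m, w, m', w'.
- move=> _ [m [w [m' [w' ->]]]]; exists ((size m)%:R - (size m')%:R); split.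
    exact: word_mono_homogeneous.
  by move=> a; exact: (word_state_KMS ps gen r_gt0 phiP phi_word).
Qed.

Section Uniqueness.
Variables (psi : T -> R[i]) (beta : R).
Hypothesis psiP : positive_functional psi.
Hypothesis psi1 : psi (tck_one p) = 1.
Hypothesis psi_deg : forall m w m' w', size m != size m' ->
  psi (word_mono m w m' w') = 0.
Hypothesis psi_kms : forall m w m' w', psi (word_mono m w m' w') =
  (expR (- ((size m)%:R * beta)))%:C *
  psi (star (word_elt p s m' w') ** word_elt p s m w).

Local Notation y := (vertex_weight p psi).
Let y_ge0 := vertex_weight_ge0 ps psiP.
Let y_sum : \sum_v y v = 1 := sum_vertex_weight ps psiP psi1.
Let y_sum_gt0 : 0 < \sum_v y v. Proof. by rewrite y_sum. Qed.

(** The bound [expR beta <= r] covers both the critical temperature, where uniqueness results, and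
    smaller [beta], where the conclusion [expR beta = r] is a contradiction. Since [y] and [x] both
    have sum 1, the factor between them is 1. *)
Lemma KMS_functional_unique : expR beta <= r -> expR beta = r /\ psi = phi.
Proof.
move=> br.
have [br' [c yc]] := PF_compare E_sc x_gt0 Ax y_ge0 y_sum_gt0
  (vertex_weight_subinvariant ps psiP psi_deg psi_kms) br.
split=> //; apply: (word_state_eq ps gen) => // m w m' w'.
have c1 : c = 1.
  by rewrite -y_sum (eq_bigr _ (fun v _ => yc v)) -mulr_sumr x_sum mulr1.
rewrite (gauge_KMS_word ps psiP psi_deg psi_kms) phi_word yc c1 mul1r.
by rewrite expRN expRM_natl br'.
Qed.

(** If [r < expR beta], the roles in the comparison are exchanged: vanishing gaps make [y] an
    eigenvector, strong connectivity makes it strictly positive, and [x] is compared with it,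
    forcing [r = expR beta]. *)
Lemma KMS_functional_CK_unique : (forall v, psi (CK_gap p s v) = 0) ->
  expR beta = r /\ psi = phi.
Proof.
move=> gap0; apply: KMS_functional_unique; have [//|rb] := leP (expR beta) r.
have Ay v := vertex_weight_invariant ps psiP psi_deg psi_kms (gap0 v).
have y_gt0 v : 0 < y v.
  rewrite lt_def y_ge0 andbT; apply/eqP => yv.
  have : \sum_v y v = 0.
    rewrite big1// => w _; apply: (zero_propagates E_sc y_ge0 (t := expR beta) _ w yv).
    by move=> u; rewrite Ay.
  by rewrite y_sum => /eqP; rewrite oner_eq0.
have [|v|rE _] := PF_compare E_sc y_gt0 Ay (fun v => ltW (x_gt0 v)) _ _ (ltW rb).
- by rewrite x_sum.
- by rewrite Ax.
- by rewrite rE ltxx in rb.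
Qed.

End Uniqueness.
End PerronFrobenius.
End GaugeDynamics.

Theorem theorem4p3 (R : realType) (E : digraph)
    (E_sc : strongly_connected E)
    (T : cstarType R) (p : vtx E -> T) (s : edge E -> T)
    (T_univ : universal_TCK p s)
    (gamma : R[i] -> T -> T) (gammaP : is_gauge_action p s gamma)
    (alpha : R -> T -> T) (alphaP : forall t, alpha t = gamma (expi t))
    (C : cstarType R) (q : T -> C) (qP : is_quotient_map (CK_ideal p s) q)
    (alphaC : R -> C -> C)
    (alphaCP : forall t a, alphaC t (q a) = q (alpha t a))
    (x : vtx E -> R) (xP : unimodular_PF x) :
  exists (phi : T -> R[i]) (phibar : C -> R[i]),
    [/\ (* (a) *)
        [/\ KMS_state alpha (ln (rhoA R E)) phi,
            forall psi, KMS_state alpha (ln (rhoA R E)) psi -> psi = phi,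
            forall mu nu : gpath E,
              phi (s_path p s mu ** star (s_path p s nu)) =
              ((mu == nu)%:R * rhoA R E ^- plen mu * x (psrc mu))%:C,
            KMS_state alphaC (ln (rhoA R E)) phibar
          & phi = phibar \o q],
        (* (b) *)
        forall (beta : R) (psi : C -> R[i]),
          KMS_state alphaC beta psi -> psi = phibar
      & (* (c) *)
        forall beta : R, beta < ln (rhoA R E) ->
          ~ exists psi : T -> R[i], KMS_state alpha beta psi].
Proof.
have [ps gen _] := T_univ; have [x_gt0 Ax x_sum] := xP.
set r := rhoA R E in Ax *.
have {}Ax v : \sum_(e : edge E | rng e == v) x (src e) = r * x v.
  by rewrite -Ax adj_sum.
have r_gt0 : 0 < r := PF_eigenvalue_gt0 E_sc x_gt0 Ax.
have [phi [phiP phi1 phi_word]] := Toeplitz_state_exists T_univ x_gt0 r_gt0 Ax x_sum.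
have eP := tck_oneP ps gen.
have [q_hom q_surj qJ] := qP.
have qone c : q (tck_one p) ** c = c /\ c ** q (tck_one p) = c.
  have [a <-] := q_surj c.
  by rewrite -!(star_homM q_hom) (eP a).1 (eP a).2.
have phi_J a : CK_ideal p s a -> phi a = 0.
  exact: (state_vanishes_CK_ideal ps gen r_gt0 Ax phiP phi_word).
(* A set-theoretic section of [q] is enough: [phi] vanishes on the kernel, so its value does not
   depend on the choice of representative. *)
have [sec secK] := choice q_surj.
pose phibar c := phi (sec c).
have phibarE a : phibar (q a) = phi a.
  apply/eqP; rewrite -subr_eq0 -(functionalB phiP.1); apply/eqP/phi_J/qJ.
  rewrite (star_homD q_hom) -scaleN1r (star_homZ q_hom) scaleN1r secK.
  exact: subrr.
have phibarP : positive_functional phibar.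
  split=> [k a b|a].
    rewrite -{1}(secK a) -{1}(secK b) -(star_homZ q_hom) -(star_homD q_hom).
    by rewrite phibarE phiP.1.
  by rewrite -(secK a) -(star_hom_star q_hom) -(star_homM q_hom) phibarE; exact: phiP.2.
have phi_hom := gauge_dynamics_hom gammaP alphaP.
have phiK := word_state_KMS_state E_sc ps gen gammaP alphaP x_gt0 Ax phiP phi1 phi_word.
have phi_inv := word_state_invariant ps gen gammaP alphaP phiP phi_word.
have uniq := KMS_functional_unique E_sc ps gen x_gt0 Ax x_sum phiP phi_word.
have idhom : star_hom (@id T) by [].
have T_unique beta psi : KMS_state alpha beta psi -> expR beta <= r ->
    expR beta = r /\ psi = phi.
  move=> psiK; have [psiP psi1 psi_deg psi_kms] :=
    KMS_word_relations ps gammaP alphaP idhom eP (fun _ _ => erefl) psiK.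
  exact: uniq.
exists phi, phibar; split.
- split=> //.
  + move=> psi psiK; have [] := T_unique _ _ psiK; rewrite lnK ?posrE//.
  + move=> mu nu; rewrite !(s_path_word ps) phi_word gpath_eqE gpath_word_path andbT.
    by rewrite /plen; case: andP => _; rewrite ?mul1r ?mul0r.
  + apply: (@KMS_state_of_words _ _ _ _ _ [set c | exists m w m' w',
      c = q (word_elt p s m w ** star (word_elt p s m' w'))]).
    * apply: (is_state_unit qone phibarP).2; by rewrite phibarE.
    * by exists (complex.Re (phibar (q (tck_one p)))); exact: functional_bound.
    * by move=> t c; rewrite -(secK c) alphaCP !phibarE phi_inv.
    * move=> t a b; rewrite -(secK a) -(secK b) -(star_homM q_hom) !alphaCP.
      by rewrite (star_homM (phi_hom t)) (star_homM q_hom).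
    * move=> a c; rewrite -(secK a) -(secK c) => W b; rewrite -(secK b).
      rewrite -!(star_homM q_hom) !phibarE -[RHS]mul1r.
      apply: (word_span_ind ps gen (Q := [set b | phi (sec a ** b) = 1 * phi (b ** sec c)])).
        exact: (closed_subspace_twist phiP.1 _ _ _ (word_state_bounded ps gen phiP)).
      move=> m w m' w' /=; rewrite mul1r -!phibarE !(star_homM q_hom) -(star_homM q_hom).
      by apply: W; exists m, w, m', w'.
    * move=> _ [m [w [m' [w' ->]]]]; exists ((size m)%:R - (size m')%:R); split.
        move=> t; rewrite alphaCP (word_mono_homogeneous ps gammaP alphaP).
        exact: star_homZ.
      move=> a; rewrite -(secK a) -!(star_homM q_hom) !phibarE.
      exact: (word_state_KMS ps gen r_gt0 phiP phi_word).
  + by apply/funext => a; rewrite /= phibarE.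
- move=> beta psi psiK.
  have [psiP psi1 psi_deg psi_kms] :=
    KMS_word_relations ps gammaP alphaP q_hom qone alphaCP psiK.
  have [v|_ psi_phi] := KMS_functional_CK_unique E_sc ps gen x_gt0 Ax x_sum phiP
    phi_word psiP psi1 psi_deg psi_kms.
    have -> : (psi \o q) (CK_gap p s v) = psi 0.
      congr psi; apply/qJ => I [_]; apply.
      (* The ideal is generated by the gaps at vertices receiving an edge; a closed path of positive
         length at [v] provides one. *)
      have [mu [mu1 muv _]] := E_sc v v; exists v => //=.
      have := gpathP mu; move: mu1; rewrite /plen -/(prng mu) -/(pedges mu) muv.
      by case: (pedges mu) => // e m _ /= /andP[/eqP ev _]; exists e.
    by have [[psiL _ _] _] := psiK; rewrite (functional0 psiL).
  apply/funext => c; rewrite -(secK c) phibarE -psi_phi.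
  by [].
- move=> beta beta_lt [psi psiK].
  have er : expR beta < r by rewrite -[r]lnK ?posrE// ltr_expR.
  have [] := T_unique _ _ psiK (ltW er).
  by move=> er'; rewrite er' ltxx in er.
Qed.
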